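(* Let $\mathbf k$ be a field of characteristic zero, let $\underline x=x_1,\dots,x_m$ be indeterminates over $\mathbf k$, and let $R$ be either $\mathbf k[\underline x]_{\mathfrak q}/I$ with $\mathfrak q\in\operatorname{Spec}\mathbf k[\underline x]$, or $\mathbf k[[\underline x]]/I$, where $I$ is a proper ideal. Assume that $R$ is reduced and one-dimensional, with canonical module $\omega_R$, and that $\Omega_R$ is torsionfree. Suppose that at least one of the following holds: (i) $\operatorname{Ext}^1_R(\operatorname{Tr}\Omega_R,\operatorname{Der}(R,\omega_R))=\operatorname{Ext}^2_R(\operatorname{Tr}\Omega_R,\operatorname{Der}(R,\omega_R))=0$; (ii) $\operatorname{Ext}^1_R(\Omega_R,\Omega_R)=\operatorname{Ext}^2_R(\operatorname{Tr}\Omega_R,\operatorname{Der}(R,\omega_R))=0$. Then $R$ is regular.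
   Context: All rings are commutative, unital and Noetherian. $\Omega_R$ denotes the universally finite differential module of $R$ over $\mathbf k$; if $R=\mathbf k[\underline x]_{\mathfrak q}/I$ it is the usual module of Kähler differentials, and if $R=\mathbf k[[\underline x]]/I$ it is $\bigoplus_{i=1}^m R\,dx_i$ modulo the submodule generated by $\sum_i \frac{\partial f}{\partial x_i}dx_i$, $f\in I$. $\operatorname{Der}(R,\omega_R)$ is the $R$-module of $\mathbf k$-derivations $R\to\omega_R$; $\operatorname{Der}(R,\omega_R)\cong\operatorname{Hom}_R(\Omega_R,\omega_R)$. The (Auslander) transpose $\operatorname{Tr}M$ of a finitely generated $R$-module $M$ is the cokernel of the dual map $F^*\to G^*$, where $G\to F\to M\to0$ is a minimal free presentation and $(-)^*=\operatorname{Hom}_R(-,R)$. (Such an $R$ is Cohen-Macaulay and, being a quotient of a regular local ring, has a canonical module.) *)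

(* Defs.v *)
From HB Require Import structures.
From mathcomp Require Import all_boot all_order all_algebra.
From mathcomp Require Import boolp classical_sets functions.
From mathcomp Require Import freeg mpoly.

Set Implicit Arguments.
Unset Strict Implicit.
Unset Printing Implicit Defensive.

Import GRing.Theory.
Local Open Scope ring_scope.
Local Open Scope quotient_scope.

Section QuotientModule.
Variables (R : comNzRingType) (M : lmodType R) (S : submodClosed M).

(* The library's submodClosed does not inherit from zmodClosed. *)
Definition quot_pred : {pred M} := S.
Lemma quot_pred_submod : submod_closed quot_pred.
Proof. exact: submodClosedP. Qed.
HB.instance Definition _ :=
  GRing.isSubmodClosed.Build R M quot_pred quot_pred_submod.

Definition quotmod : Type := Quotient.quot quot_pred.
HB.instance Definition _ := GRing.Zmodule.on quotmod.

Definition quot_pi (x : M) : quotmod := \pi_(Quotient.quot quot_pred) x.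
Definition quot_scale (a : R) (x : quotmod) : quotmod :=
  quot_pi (a *: repr (x : Quotient.quot quot_pred)).

Lemma quot_pi_eq (x y : M) : (quot_pi x = quot_pi y) <-> (x - y \in S).
Proof.
rewrite -[x - y \in S]/(x - y \in quot_pred) Quotient.idealrBE.
by split=> [h|/eqP//]; exact/eqP.
Qed.

Lemma quot_repr (x : quotmod) :
  quot_pi (repr (x : Quotient.quot quot_pred)) = x.
Proof. by rewrite /quot_pi reprK. Qed.

Lemma quot_piD : {morph quot_pi : x y / x + y}.
Proof. by move=> x y; rewrite /quot_pi raddfD. Qed.

Lemma quot_piZ a x : quot_pi (a *: x) = quot_scale a (quot_pi x).
Proof.
apply/quot_pi_eq; rewrite -scalerBr rpredZ//.
by apply/quot_pi_eq; rewrite quot_repr.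
Qed.

Let scaleA a b x : quot_scale a (quot_scale b x) = quot_scale (a * b) x.
Proof. by rewrite -(quot_repr x) -!quot_piZ scalerA. Qed.
Let scale1 : left_id 1 quot_scale.
Proof. by move=> x; rewrite -(quot_repr x) -!quot_piZ scale1r. Qed.
Let scaleDr : right_distributive quot_scale +%R.
Proof.
move=> a x y; rewrite -(quot_repr x) -(quot_repr y).
by rewrite -quot_piD -!quot_piZ -quot_piD scalerDr.
Qed.
Let scaleDl x : {morph quot_scale^~ x : a b / a + b}.
Proof.
by move=> a b; rewrite -(quot_repr x) -!quot_piZ -quot_piD scalerDl.
Qed.
HB.instance Definition _ :=
  GRing.Zmodule_isLmodule.Build R quotmod scaleA scale1 scaleDr scaleDl.

Lemma quot_pi_is_linear : linear quot_pi.
Proof. by move=> a x y; rewrite quot_piD quot_piZ. Qed.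
HB.instance Definition _ :=
  GRing.isLinear.Build R M quotmod *:%R quot_pi quot_pi_is_linear.

End QuotientModule.

Section Submodules.
Variable R : comNzRingType.

Definition span (M : lmodType R) (X : M -> Prop) : {pred M} := fun v =>
  `[< forall S : submodClosed M, (forall x, X x -> x \in S) -> v \in S >].

Lemma span_submod M X : submod_closed (@span M X).
Proof.
split; first by apply/asboolP=> S _; exact: rpred0.
move=> a u v /asboolP hu /asboolP hv; apply/asboolP=> S XS.
by rewrite rpredD ?rpredZ ?hu ?hv.
Qed.
HB.instance Definition _ M X :=
  GRing.isSubmodClosed.Build R M (@span M X) (span_submod X).

Definition limage (M N : lmodType R) (f : {linear M -> N}) : {pred N} :=
  fun y => `[< exists x, f x = y >].

Lemma limage_submod M N f : submod_closed (@limage M N f).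
Proof.
split; first by apply/asboolP; exists 0; rewrite linear0.
move=> a u v /asboolP[x <-] /asboolP[y <-]; apply/asboolP.
by exists (a *: x + y); rewrite linearP.
Qed.
HB.instance Definition _ M N f :=
  GRing.isSubmodClosed.Build R N (@limage M N f) (limage_submod f).

Definition lpreim (M N : lmodType R) (f : {linear M -> N})
  (S : submodClosed N) : {pred M} := fun x => f x \in S.

Lemma lpreim_submod M N f S : submod_closed (@lpreim M N f S).
Proof.
split; first by rewrite unfold_in linear0; exact: (submodClosedP S).1.
by move=> a u v; rewrite !unfold_in linearP => fu fv; exact: (submodClosedP S).2.
Qed.
HB.instance Definition _ M N f S :=
  GRing.isSubmodClosed.Build R M (@lpreim M N f S) (lpreim_submod f S).

Definition coker (M N : lmodType R) (f : {linear M -> N}) : lmodType R :=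
  quotmod (limage f).

Section Kernel.
Variables (M N : lmodType R) (f : {linear M -> N}).

Definition lker : {pred M} := fun x => f x == 0.

Lemma lker_submod : submod_closed lker.
Proof.
split; first by rewrite unfold_in linear0.
by move=> a u v; rewrite !unfold_in linearP => /eqP-> /eqP->; rewrite scaler0 addr0.
Qed.
HB.instance Definition _ := GRing.isSubmodClosed.Build R M lker lker_submod.

Record kernel := Kernel { kernel_val :> M; _ : kernel_val \in lker }.
HB.instance Definition _ := [isSub for kernel_val].
HB.instance Definition _ := [Choice of kernel by <:].
HB.instance Definition _ := [SubChoice_isSubLmodule of kernel by <:].

End Kernel.

Section Hom.
Variables M N : lmodType R.

Definition hom_pred : {pred M -> N} := fun f => `[< linear f >].

Lemma hom_submod : submod_closed hom_pred.
Proof.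
split.
  by apply/asboolP=> a x y; rewrite /GRing.zero /= scaler0 addr0.
move=> a f g /asboolP hf /asboolP hg; apply/asboolP=> b x y.
rewrite addrfctE scalrfctE /=; by rewrite hf hg !scalerDr !scalerA [b * a]mulrC addrACA.
Qed.
HB.instance Definition _ :=
  GRing.isSubmodClosed.Build R (M -> N) hom_pred hom_submod.

Record hom := Hom { hom_val :> M -> N; _ : hom_val \in hom_pred }.
HB.instance Definition _ := [isSub for hom_val].
HB.instance Definition _ := [Choice of hom by <:].
HB.instance Definition _ := [SubChoice_isSubLmodule of hom by <:].

End Hom.

Section Precomp.
Variables (L M N : lmodType R) (f : {linear L -> M}).

Lemma precomp_subproof (h : hom M N) : (h \o f) \in @hom_pred L N.
Proof.
have hP : hom_val h \in @hom_pred M N by exact: valP h.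
move/asboolP: hP => lh; apply/asboolP=> a x y /=.
by rewrite linearP lh.
Qed.

Definition precomp (h : hom M N) : hom L N := Hom (precomp_subproof h).

Lemma precomp_is_linear : linear precomp.
Proof. by move=> a g h; apply/val_inj. Qed.
HB.instance Definition _ :=
  GRing.isLinear.Build R (hom M N) (hom L N) *:%R precomp precomp_is_linear.

End Precomp.

Definition lmod_iso (M N : lmodType R) : Prop :=
  exists f : {linear M -> N}, bijective f.

Definition is_zero_module (M : lmodType R) : Prop := forall x : M, x = 0.

Definition fin_gen (M : lmodType R) : Prop :=
  exists (n : nat) (x : 'I_n -> M),
    forall v, exists c : 'I_n -> R, v = \sum_i c i *: x i.

Definition torsionfree (M : lmodType R) : Prop :=
  forall a : R, GRing.lreg a -> forall v : M, a *: v = 0 -> v = 0.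

Definition exact (L M N : lmodType R) (f : {linear L -> M})
    (g : {linear M -> N}) : Prop :=
  forall y, g y = 0 <-> exists x, f x = y.

Definition injective_module (E : lmodType R) : Prop :=
  forall (A B : lmodType R) (i : {linear A -> B}) (f : {linear A -> E}),
    injective i -> exists g : {linear B -> E}, forall x, g (i x) = f x.

Definition finite_injdim (M : lmodType R) : Prop :=
  exists (n : nat) (I : nat -> lmodType R) (e : {linear M -> I 0})
    (d : forall i, {linear I i -> I i.+1}),
    [/\ forall i, injective_module (I i),
        injective e,
        exact e (d 0),
        forall i, exact (d i) (d i.+1)
      & forall i, (n < i)%N -> is_zero_module (I i)].

End Submodules.

(* Ext, computed with the standard free resolution                            *)
(*   ... -> F(S2) -> F(S1) -> F(S0) -> M -> 0,                                *)
(* where F(S) = {freeg S / R} is the free module on the elements of S, S0 = M *)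
(* and S(n+1) is the kernel of the canonical surjection F(Sn) -> Sn.          *)
Section Ext.
Variable R : comNzRingType.

Definition free_module (X : choiceType) : lmodType R := {freeg X / R}.

Definition free_cover (M : lmodType R) : free_module M -> M := fglift id.

Lemma free_cover_is_linear M : linear (@free_cover M).
Proof.
have coverB : additive (@free_cover M) by exact: lift_is_additive.
pose F : {additive free_module M -> M} :=
  HB.pack (@free_cover M) (GRing.isAdditive.Build _ _ (@free_cover M) coverB).
move=> a D E; rewrite -[@free_cover M]/(F : _ -> _) raddfD; congr (_ + _).
have -> : a *: D = \sum_(x <- dom D) << a * coeff x D *g x >> :> free_module M by [].
rewrite raddf_sum -[in RHS](freeg_sumE D) (raddf_sum F) scaler_sumr.
by apply: eq_bigr => x _; rewrite /F /= /free_cover !liftU scalerA.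
Qed.
HB.instance Definition _ (M : lmodType R) :=
  GRing.isLinear.Build R (free_module M) M *:%R (@free_cover M)
    (@free_cover_is_linear M).

Definition syzygy (M : lmodType R) : lmodType R :=
  kernel (@free_cover M : {linear _ -> _}).

Definition res (M : lmodType R) (n : nat) : lmodType R :=
  free_module (iter n syzygy M).

Definition res_diff (M : lmodType R) (n : nat) :
    {linear res M n.+1 -> res M n} :=
  (val : {linear syzygy (iter n syzygy M) -> res M n}) \o
    @free_cover (syzygy (iter n syzygy M)).

Definition coboundaries (n : nat) (M N : lmodType R) :
    submodClosed (hom (res M n) N) :=
  match n with
  | 0 => span (fun h => h = 0)
  | n'.+1 => limage (@precomp _ _ _ N (res_diff M n'))
  end.

Definition cocycles (n : nat) (M N : lmodType R) : lmodType R :=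
  kernel (@precomp _ _ _ N (res_diff M n)).

Definition Ext (n : nat) (M N : lmodType R) : lmodType R :=
  quotmod (lpreim (val : {linear cocycles n M N -> hom (res M n) N})
                  (coboundaries n M N)).

End Ext.

Section LocalAlgebra.
Variable R : comUnitRingType.

Definition reduced_ring : Prop := forall (x : R) (n : nat), x ^+ n = 0 -> x = 0.

Definition noetherian : Prop :=
  forall I : idealr R, exists (n : nat) (x : 'I_n -> R),
    forall a, a \in I <-> exists c : 'I_n -> R, a = \sum_i c i * x i.

Definition prime_chain (n : nat) : Prop :=
  exists p : 'I_n.+1 -> prime_idealr R, forall i j : 'I_n.+1, (i < j)%N ->
    {subset p i <= p j} /\ exists2 x, x \in p j & x \notin p i.

Definition krull_dim (n : nat) : Prop := prime_chain n /\ ~ prime_chain n.+1.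

(* The maximal ideal of a local ring is its set of nonunits; the equivalence *)
(* below makes this set an ideal, hence R local.                             *)
Definition regular_local : Prop :=
  noetherian /\
  exists d (x : 'I_d -> R), krull_dim d /\
    forall a : R, a \isn't a GRing.unit <->
      exists c : 'I_d -> R, a = \sum_i c i * x i.

(* mM for the maximal ideal m *)
Definition max_smul (M : lmodType R) : submodClosed M :=
  span (fun v => exists a (w : M), a \isn't a GRing.unit /\ v = a *: w).

Definition residue_field : lmodType R := quotmod (max_smul R^o).

Fixpoint regular_seq (M : lmodType R) (s : seq R) : Prop :=
  if s is a :: s' then
    (forall v : M, a *: v = 0 -> v = 0) /\
    regular_seq (coker (GRing.scale a : {linear M -> M})) s'
  else exists v : M, v != 0.

Definition depth (M : lmodType R) (d : nat) : Prop :=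
  let max_regular_seq s :=
    {in s, forall a, a \isn't a GRing.unit} /\ regular_seq M s in
  (exists2 s, size s = d & max_regular_seq s) /\
  (forall s, max_regular_seq s -> (size s <= d)%N).

(* A maximal Cohen-Macaulay module of type 1 and of finite injective *)
(* dimension (Bruns-Herzog).                                         *)
Definition canonical_module (C : lmodType R) : Prop :=
  exists d, [/\ krull_dim d, fin_gen C, depth C d,
    lmod_iso (Ext d residue_field C) residue_field & finite_injdim C].

(* G -> F -> M -> 0 with F = R^f and G = R^g *)
Record min_presentation (M : lmodType R) := MinPresentation {
  pres_f : nat;
  pres_g : nat;
  pres_map : {linear 'rV[R]_pres_g -> 'rV[R]_pres_f};
  pres_aug : {linear 'rV[R]_pres_f -> M};
  pres_surj : forall v, exists x, pres_aug x = v;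
  pres_exact : exact pres_map pres_aug;
  pres_min_f : forall x, pres_aug x = 0 -> x \in max_smul 'rV[R]_pres_f;
  pres_min_g : forall y, pres_map y = 0 -> y \in max_smul 'rV[R]_pres_g
}.

Definition transpose (M : lmodType R) (P : min_presentation M) : lmodType R :=
  coker (@precomp R _ _ R^o (pres_map P)).

End LocalAlgebra.

Section Derivations.
Variables (k : comNzRingType) (R : comUnitAlgType k).

Definition derivation (M : lmodType R) (D : R -> M) : Prop :=
  [/\ forall x y, D (x + y) = D x + D y,
      forall x y, D (x * y) = x *: D y + y *: D x
    & forall c : k, D c%:A = 0].

Definition universal_derivation (M : lmodType R) (d : R -> M) : Prop :=
  derivation d /\
  forall (N : lmodType R) (D : R -> N), derivation D ->
    exists2 h : {linear M -> N}, (forall x, D x = h (d x)) &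
      forall h' : {linear M -> N}, (forall x, D x = h' (d x)) -> h' =1 h.

Variable M : lmodType R.

Definition der_pred : {pred R -> M} := fun D => `[< derivation D >].

Lemma der_submod : submod_closed der_pred.
Proof.
split.
  by apply/asboolP; split=> *; rewrite /GRing.zero /= ?scaler0 ?addr0.
move=> a D E /asboolP[Da Dm Dk] /asboolP[Ea Em Ek].
apply/asboolP; rewrite addrfctE scalrfctE; split=> /=.
- by move=> x y; rewrite Da Ea scalerDr addrACA.
- move=> x y; rewrite Dm Em !scalerDr !scalerA.
  by rewrite [a * x]mulrC [a * y]mulrC addrACA.
- by move=> c; rewrite Dk Ek scaler0 addr0.
Qed.
HB.instance Definition _ :=
  GRing.isSubmodClosed.Build R (R -> M) der_pred der_submod.

Record Der := MkDer { der_val :> R -> M; _ : der_val \in der_pred }.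
HB.instance Definition _ := [isSub for der_val].
HB.instance Definition _ := [Choice of Der by <:].
HB.instance Definition _ := [SubChoice_isSubLmodule of Der by <:].

End Derivations.

Section PowerSeries.
Variables (k : comNzRingType) (n : nat).

(* k[[x_1, .., x_n]] as families of coefficients. The alias keeps the pointwise *)
(* product of functions from being found as its ring structure.               *)
Definition powser : Type := 'X_{1..n} -> k^o.
HB.instance Definition _ := GRing.Lmodule.on powser.
Implicit Types (f g h : powser) (p q : {mpoly k[n]}) (m : 'X_{1..n}).

Definition ps_one : powser := fun m => (m == 0%MM)%:R.

Definition ps_mul f g : powser := fun m =>
  \sum_(u : 'X_{1..n < (mdeg m).+1, (mdeg m).+1} | m == (u.1 + u.2)%MM)
    f u.1 * g u.2.

Definition ps_deriv (i : 'I_n) f : powser := fun m => f (m + U_(i))%MM *+ (m i).+1.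

Let trunc d f : {mpoly k[n]} := \sum_(m : 'X_{1..n < d}) f m *: 'X_[m].

Let agree d f p := forall m, (mdeg m < d)%N -> p@_m = f m.

Let trunc_agree d f : agree d f (trunc d f).
Proof. by move=> m; exact: mcoeff_mpoly. Qed.

Let mul_agree d f g p q :
  agree d f p -> agree d g q -> agree d (ps_mul f g) (p * q).
Proof.
move=> fp gq m md; rewrite mcoeffM /ps_mul; apply: eq_bigr => u _.
by rewrite fp ?gq //; apply: (leq_trans (bmdeg _)).
Qed.

Let one_agree d : agree d ps_one 1.
Proof. by move=> m _; rewrite mcoeff1. Qed.

Let agree_eq f g : (forall d, exists2 p, agree d f p & agree d g p) -> f = g.
Proof.
move=> fg; apply/funext=> m.
by have [p fp gp] := fg (mdeg m).+1; rewrite -fp // gp.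
Qed.

Let ps_mulA : associative ps_mul.
Proof.
move=> f g h; apply: agree_eq => d.
exists (trunc d f * (trunc d g * trunc d h)); first by do !apply: mul_agree.
by rewrite mulrA; do !apply: mul_agree.
Qed.
Let ps_mulC : commutative ps_mul.
Proof.
move=> f g; apply: agree_eq => d.
exists (trunc d f * trunc d g); first exact: mul_agree.
by rewrite mulrC; exact: mul_agree.
Qed.
Let ps_mul1 : left_id ps_one ps_mul.
Proof.
move=> f; apply: agree_eq => d.
by exists (1 * trunc d f); [exact: mul_agree|rewrite mul1r].
Qed.
Let ps_mulDl : left_distributive ps_mul +%R.
Proof.
move=> f g h; apply/funext=> m.
rewrite -[RHS]/(ps_mul f h m + ps_mul g h m) /ps_mul -big_split /=.
by apply: eq_bigr => u _; rewrite mulrDl.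
Qed.
Let ps_one_neq0 : ps_one != 0.
Proof.
apply/eqP => /(congr1 (fun f : powser => f 0%MM)) /eqP.
by rewrite /ps_one eqxx oner_eq0.
Qed.
HB.instance Definition _ := GRing.Zmodule_isComNzRing.Build powser
  ps_mulA ps_mulC ps_mul1 ps_mulDl ps_one_neq0.

Let ps_scaleAl (a : k) (f g : powser) : a *: (f * g) = (a *: f) * g.
Proof.
apply/funext=> m.
rewrite -[LHS]/(a *: ps_mul f g m) -[RHS]/(ps_mul (a *: f) g m) /ps_mul.
rewrite scaler_sumr.
by apply: eq_bigr => u _; rewrite scalerAl.
Qed.
HB.instance Definition _ :=
  GRing.Lmodule_isLalgebra.Build k powser ps_scaleAl.
HB.instance Definition _ := GRing.Lalgebra_isComAlgebra.Build k powser.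

End PowerSeries.

Definition is_localization (k : comNzRingType) (A : comAlgType k)
    (q : prime_idealr A) (L : comUnitAlgType k) (iota : {lrmorphism A -> L}) :
    Prop :=
  [/\ forall s, s \notin q -> iota s \is a GRing.unit,
      forall z, exists a s, s \notin q /\ z = iota a / iota s
    & forall a, iota a = 0 -> exists2 s, s \notin q & s * a = 0].

(* R is k[x_1, .., x_m]_q / I or k[[x_1, .., x_m]] / I, where I is the kernel *)
(* of the given surjection (a proper ideal since R is nontrivial).            *)
Variant presentation (k : fieldType) (R : comUnitAlgType k) : Type :=
| LocalizedPolynomial (m : nat) (q : prime_idealr {mpoly k[m]})
    (L : comUnitAlgType k) (iota : {lrmorphism {mpoly k[m]} -> L})
    (pi : {lrmorphism L -> R}) of
    is_localization q iota & (forall y, exists x, pi x = y)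
| PowerSeries (m : nat) (pi : {lrmorphism powser k m -> R}) of
    (forall y, exists x, pi x = y).

Definition jacobian (k : fieldType) (R : comUnitAlgType k) (m : nat)
    (pi : {lrmorphism powser k m -> R}) : submodClosed 'rV[R]_m :=
  span (fun v => exists2 f, pi f = 0 & v = \row_i pi (ps_deriv i f)).

(* The universally finite differential module: by the universal property of   *)
(* Kaehler differentials for k[x]_q / I, by its explicit presentation for     *)
(* k[[x]] / I, where it differs from the module of Kaehler differentials.     *)
Definition differential_module (k : fieldType) (R : comUnitAlgType k)
    (P : presentation R) (Omega : lmodType R) : Prop :=
  match P with
  | LocalizedPolynomial _ _ _ _ _ _ _ =>
      exists d : R -> Omega, universal_derivation d
  | PowerSeries _ pi _ => lmod_iso (quotmod (jacobian pi)) Omega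
  end.

(* Main.v *)
(* Only the vanishing of Ext^2(Tr Omega, Der(R, omega)) is used. Write M for  *)
(* Omega, m for the maximal ideal and (-)^v for Hom(-, omega), and recall     *)
(* that Der(R, omega) = M^v. The vanishing says that every map M^* -> M^v is  *)
(* induced by an element of M (x) M^v. Hence every map to omega from the      *)
(* image E of M^* (x) M -> End M extends to End M. Since R is reduced, E has  *)
(* torsion cokernel; if 1 is not in E, some scalar c satisfies m c <= E and   *)
(* c not in E. As End M is maximal Cohen-Macaulay, maps from submodules of    *)
(* the form ker(P -> End M) to omega extend to P, because cosyzygies of omega *)
(* are injective. Applied to R + E -> End M, (r, e) |-> r c + e, this extends *)
(* every map m -> omega to R, so that Ext^1(R/m, omega) = 0, a contradiction. *)
(* Thus 1 is in E, i.e. M is projective.                                      *)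
(*   In characteristic zero m/m^2 embeds in M/mM, so for x1, x2 in m that are *)
(* independent modulo m^2 there are derivations with D1 x1 = 1, D2 x1 = 0 and *)
(* D2 x2 a unit. Since D1 x1 = 1, x1 lies in no minimal prime, hence          *)
(* x2^n = x1 b for some n; applying D2 repeatedly lowers n to 0, which is     *)
(* absurd. So m is principal.                                                 *)
Require Import Defs.
From HB Require Import structures.
From mathcomp Require Import all_boot all_order all_algebra.
From mathcomp Require Import boolp classical_sets functions.
From mathcomp Require Import ring zify freeg mpoly.
(* all_algebra shadows the names [hom] and [lker] of Defs. *)
Import Defs.

Set Implicit Arguments.
Unset Strict Implicit.
Unset Printing Implicit Defensive.

Import Order.TTheory GRing.Theory.
Local Open Scope ring_scope.

(** * Ideals of Noetherian rings *)

(** Write M for [Omega] and m for the maximal ideal. First, Der(R, omega) is Hom(M, omega), by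
    [universal_derivation_iso] and [ps_Der_iso]; over k[[x]] this uses that omega is separated
    ([canonical_separated]), so that derivations into it obey the chain rule for power series
    ([ps_chain_rule]). Dualizing F -> M gives 0 -> Hom(M, R) -> F' -> G' -> Tr M -> 0 with F' and G'
    free, so the vanishing of Ext^2(Tr M, N), common to (i) and (ii), extends every map Hom(M, R) ->
    N to F'. For N = Hom(M, omega) this describes all such maps by finitely many elements of N
    ([transpose_dual_surj]). This makes M projective ([trace_scalar1]). The scalars r for which r
    times the identity of M is a sum of rank-one maps form an ideal, which contains a nonzerodivisor
    because R is a field at each minimal prime. If the ideal is proper, some c outside it satisfies:
    m c lies inside. Then every map m -> omega extends to R ([socle_extend]), against Ext^1(R/m,
    omega) = R/m. The extension relies on injdim omega <= 1 ([baer1]): maps to omega defined on the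
    kernel of a map P -> R^n extend to P ([extend_from_kernel]). Finally d induces an injection of
    m/m^2 into M/mM, by a coefficient ring in the Kaehler case ([coefficient_ring]) and by Euler's
    formula in the power series case ([euler_mod]). Since M is projective, each f in m outside m^2
    therefore has a derivation D of R with D f = 1. In dimension one and characteristic zero this
    forces m to be principal ([maximal_ideal_principal]). *)

Section Ideals.
Variable R : comNzRingType.
Implicit Types J p : R -> Prop.

(** Ideals are plain predicates, so that colons, sums and unions can be written directly; [prime_of]
    converts primes to the bundled structure used by [krull_dim]. *)
Definition ideal J : Prop :=
  J 0 /\ forall a x y, J x -> J y -> J (a * x + y).

Definition fg_ideal J : Prop := exists (n : nat) (x : 'I_n -> R),
  forall a, J a <-> exists c : 'I_n -> R, a = \sum_i c i * x i.

Definition noetherian_ideals : Prop := forall J, ideal J -> fg_ideal J.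

Definition prime_ideal p : Prop :=
  [/\ ideal p, ~ p 1 & forall x y, p (x * y) -> p x \/ p y].

Lemma idealD J x y : ideal J -> J x -> J y -> J (x + y).
Proof. by move=> [_ h] Jx Jy; rewrite -[x]mul1r; exact: h. Qed.

Lemma idealM J a x : ideal J -> J x -> J (a * x).
Proof. by move=> [J0 h] Jx; rewrite -[a * x]addr0; exact: h. Qed.

Lemma idealB J x y : ideal J -> J x -> J y -> J (x - y).
Proof. by move=> hJ Jx Jy; apply: idealD => //; rewrite -mulN1r; exact: idealM. Qed.

Lemma ideal_sum J n (c x : 'I_n -> R) :
  ideal J -> (forall i, J (x i)) -> J (\sum_i c i * x i).
Proof.
move=> hJ Jx; elim/big_ind: _ => [|u v|i _].
- by case: hJ.
- exact: idealD.
- exact: idealM.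
Qed.

Lemma ideal_add J c : ideal J -> ideal (fun y => exists a x, J x /\ y = x + a * c).
Proof.
move=> hJ; split; first by exists 0, 0; split; [case: hJ|rewrite mul0r addr0].
move=> b y z [a [x [Jx ->]]] [a' [x' [Jx' ->]]].
exists (b * a + a'), (b * x + x'); split; last by ring.
by apply: idealD => //; exact: idealM.
Qed.

Lemma ideal_colon J c : ideal J -> ideal (fun x => J (x * c)).
Proof.
move=> hJ; split; first by rewrite mul0r; case: hJ.
by move=> a x y Jx Jy; rewrite mulrDl -mulrA; apply: idealD => //; exact: idealM.
Qed.

Lemma ideal_principal a : ideal (fun y => exists b, y = a * b).
Proof.
split; first by exists 0; rewrite mulr0.
by move=> b _ _ [u ->] [v ->]; exists (b * u + v); ring.
Qed.

Hypothesis noeth : noetherian_ideals.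

(** The union of the chain is finitely generated, and its generators all occur at some finite
    stage. *)
Lemma ideal_acc (J : nat -> R -> Prop) : (forall n, ideal (J n)) ->
  (forall n x, J n x -> J n.+1 x) -> exists n, forall m x, J m x -> J n x.
Proof.
move=> hJ hS.
have hle m n x : (m <= n)%N -> J m x -> J n x.
  move=> mn Jx; elim: n mn => [|n IH]; first by rewrite leqn0 => /eqP <-.
  by rewrite leq_eqVlt => /predU1P[<-//|/IH]; exact: hS.
have hU : ideal (fun x => exists n, J n x).
  split; first by exists 0; case: (hJ 0).
  move=> a x y [m Jx] [n Jy]; exists (maxn m n).
  by apply: (hJ _).2; [apply: hle Jx; exact: leq_maxl|apply: hle Jy; exact: leq_maxr].
have [n [x hx]] := noeth hU.
have /choice[f hf] : forall i, exists m, J m (x i).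
  move=> i; apply/hx; exists (fun j => (j == i)%:R).
  rewrite (bigD1 i) //= eqxx mul1r big1 ?addr0 // => j /negPf ->.
  by rewrite mul0r.
exists (\max_i f i) => m y Jy.
have /hx[c ->] : exists n, J n y by exists m.
by apply: ideal_sum => // i; apply: hle (hf i); exact: leq_bigmax.
Qed.

(** Without a maximal member, dependent choice would produce a strictly increasing chain. *)
Lemma ideal_max (Q : (R -> Prop) -> Prop) J0 : ideal J0 -> Q J0 ->
  exists J, [/\ ideal J, Q J & forall J', ideal J' -> Q J' ->
    (forall x, J x -> J' x) -> forall x, J' x -> J x].
Proof.
move=> hJ0 QJ0; apply: contrapT => hno.
have step (s : {J : R -> Prop | ideal J /\ Q J}) : {t : {J : R -> Prop | ideal J /\ Q J} |
    (forall x, sval s x -> sval t x) /\ exists2 x, sval t x & ~ sval s x}.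
  apply: cid; case: s => J [hJ QJ] /=; apply: contrapT => hn; apply: hno.
  exists J; split=> // J' hJ' QJ' JJ' x J'x; apply: contrapT => nJx.
  by apply: hn; exists (exist _ J' (conj hJ' QJ')); split=> //; exists x.
pose s := fix s n := if n is n'.+1 then sval (step (s n'))
  else exist _ J0 (conj hJ0 QJ0).
have [|n x|n hn] := @ideal_acc (fun n => sval (s n)).
- by move=> n; case: (svalP (s n)).
- by case: (svalP (step (s n))) => h _; exact: h.
- by case: (svalP (step (s n))) => _ [x /(hn n.+1)].
Qed.

(** An ideal p maximal among those containing J and missing S is prime: for x and y outside p, both
    p + (x) and p + (y) meet S, and the product of the two elements would lie in p if x y did. *)
Lemma prime_avoiding J (S : R -> Prop) : ideal J -> S 1 ->
  (forall x y, S x -> S y -> S (x * y)) -> (forall x, J x -> ~ S x) ->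
  exists p, [/\ prime_ideal p, forall x, J x -> p x & forall x, p x -> ~ S x].
Proof.
move=> hJ S1 SM JS.
have [p [hp [Jp pS] pmax]] := @ideal_max
  (fun K => (forall x, J x -> K x) /\ forall x, K x -> ~ S x) J hJ (conj (fun x h => h) JS).
exists p; split=> //; split=> // [/pS//|x y pxy].
have ext z : ~ p z -> exists a x, p x /\ S (x + a * z).
  move=> npz; apply: contrapT => hn; apply: npz.
  apply: (pmax _ (ideal_add z hp)).
  - split=> [u Ju|u [a [v [pv ->]]] Su]; last by apply: hn; exists a, v.
    by exists 0, u; split; [exact: Jp|rewrite mul0r addr0].
  - by move=> u pu; exists 0, u; rewrite mul0r addr0.
  - by exists 1, 0; rewrite mul1r add0r; split=> //; case: hp.
apply: contrapT => /not_orP[/ext[a [u [pu Su]]] /ext[b [v [pv Sv]]]].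
apply: (pS _ _ (SM _ _ Su Sv)).
have -> : (u + a * x) * (v + b * y) = (v + b * y) * u + (a * x * v + a * b * (x * y)) by ring.
by do 2?[apply: idealD => //]; apply: idealM.
Qed.

Lemma prime_radical J x : ideal J -> (forall n, ~ J (x ^+ n)) ->
  exists p, [/\ prime_ideal p, forall y, J y -> p y & ~ p x].
Proof.
move=> hJ hx; have [||y Jy [n yn]|p [hp Jp pS]] :=
  @prime_avoiding J (fun y => exists n, y = x ^+ n) hJ.
- by exists 0; rewrite expr0.
- by move=> _ _ [m ->] [n ->]; exists (m + n); rewrite exprD.
- by apply: (hx n); rewrite -yn.
- by exists p; split=> // /pS; apply; exists 1; rewrite expr1.
Qed.

(** The associated primes of R/J: a maximal proper colon ideal is prime. *)
Lemma prime_colon J : ideal J -> ~ J 1 ->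
  exists c, ~ J c /\ prime_ideal (fun x => J (x * c)).
Proof.
move=> hJ J1.
have [K [hp [c Jc eK] pmax]] := @ideal_max
  (fun K => exists2 c, ~ J c & K = (fun x => J (x * c))) _
  (ideal_colon 1 hJ) (ex_intro2 _ _ 1 J1 erefl).
subst K; exists c; split=> //; split=> //; first by rewrite mul1r.
move=> x y Jxy; case: (EM (J (y * c))) => [|nJy]; [by right|left].
apply: (pmax _ (ideal_colon (y * c) hJ)); first by exists (y * c).
  by move=> z Jz; rewrite mulrCA; exact: idealM.
by rewrite mulrA.
Qed.

(* A nonzerodivisor of J is an a in J with ann a minimal, as orthogonal sums  *)
(* shrink annihilators; minimality is maximality of the double annihilator.   *)
Lemma exists_regular J : (forall (x : R) n, x ^+ n = 0 -> x = 0) -> ideal J ->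
  (forall c, c != 0 -> exists2 r, J r & r * c != 0) ->
  exists2 a, J a & forall x, a * x = 0 -> x = 0.
Proof.
move=> red hJ annJ.
pose A (a x : R) := forall b, a * b = 0 -> b * x = 0.
have hA a : ideal (A a).
  split=> [b _|b x y Ax Ay z az]; first by rewrite mulr0.
  by rewrite mulrDr mulrCA Ax // Ay // mulr0 addr0.
have [K [_ [a Ja eK] amax]] := @ideal_max (fun K => exists2 a, J a & K = A a) _
  (hA 0) (ex_intro2 _ _ 0 hJ.1 erefl).
subst K; exists a => // b ab; apply/eqP; apply: contrapT => /negP b0.
have [r Jr rb0] := annJ b b0; set b' := b * r.
have ab' : a * b' = 0 by rewrite mulrA ab mul0r.
(* As a b' = 0 and R is reduced, ann(a + b') is the intersection of ann a and ann b'. *)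
have sub c : (a + b') * c = 0 -> a * c = 0 /\ b' * c = 0.
  move=> h; have ac : a * c = 0.
    apply: (red _ 2); have -> : (a * c) ^+ 2 = a * c * ((a + b') * c) - a * b' * c * c by ring.
    by rewrite h ab' !mulr0 !mul0r subr0.
  by split=> //; rewrite mulrDl ac add0r in h.
(* [b'] lies in the double annihilator of a + b', hence by maximality in that of a; since a b' = 0,
   its square vanishes. *)
have Ab' : A a b'.
  apply: (amax _ (hA (a + b'))) => [|x Ax z /sub[az _]|z /sub[_ zb]].
  - by exists (a + b') => //; apply: idealD => //; exact: idealM.
  - exact: Ax.
  - by rewrite mulrC.
by move/eqP: rb0; apply; rewrite mulrC; apply: (red _ 2); rewrite expr2; exact: Ab'.
Qed.

End Ideals.

(** * Local rings of dimension one *)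

Section PrimeChains.
Variable R : comUnitRingType.
Implicit Types J p : R -> Prop.

Definition nonunit (x : R) : Prop := x \isn't a GRing.unit.

Definition local_ring : Prop := forall x y : R, nonunit x -> nonunit y -> nonunit (x + y).

Lemma nonunitM (a x : R) : nonunit x -> nonunit (a * x).
Proof. by move=> ux; rewrite /nonunit unitrM (negPf ux) andbF. Qed.

Lemma nonunit0 : nonunit 0.
Proof. by rewrite /nonunit unitr0. Qed.

Lemma ideal_nonunit : local_ring -> ideal nonunit.
Proof.
move=> loc; split; first exact: nonunit0.
by move=> a x y ux uy; apply: loc => //; exact: nonunitM.
Qed.

Lemma prime_nonunit : local_ring -> prime_ideal nonunit.
Proof.
move=> loc; split; first exact: ideal_nonunit.
  by rewrite /nonunit unitr1.
by move=> x y; rewrite /nonunit unitrM => /nandP.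
Qed.

Lemma proper_nonunit J x : ideal J -> ~ J 1 -> J x -> nonunit x.
Proof. by move=> hJ J1 Jx; apply/negP => ux; apply: J1; rewrite -(mulVr ux); exact: idealM. Qed.

Section PrimeOfPred.
Variables (p : R -> Prop) (hp : prime_ideal p).
Definition prime_bool : {pred R} := fun x => `[< p x >].
Lemma prime_bool_idealr : idealr_closed prime_bool.
Proof.
case: hp => -[p0 pD] p1 _; split; [exact/asboolP|exact/asboolP|].
by move=> a u v /asboolP pu /asboolP pv; apply/asboolP; exact: pD.
Qed.
Lemma prime_bool_prime : prime_idealr_closed prime_bool.
Proof.
case: hp => _ _ pM u v /asboolP puv; apply/orP.
by case: (pM _ _ puv) => h; [left|right]; exact/asboolP.
Qed.
HB.instance Definition _ := isIdealr.Build R prime_bool prime_bool_idealr.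
HB.instance Definition _ := isPrimeIdealrClosed.Build R prime_bool prime_bool_prime.
Definition prime_of : prime_idealr R := prime_bool.
Lemma mem_prime_of x : x \in prime_of <-> p x.
Proof. by split=> [/asboolP|px]; [|exact/asboolP]. Qed.
End PrimeOfPred.

Lemma prime_chain3 p q r : prime_ideal p -> prime_ideal q -> prime_ideal r ->
  (forall x, p x -> q x) -> (forall x, q x -> r x) ->
  (exists2 x, q x & ~ p x) -> (exists2 x, r x & ~ q x) -> prime_chain R 2.
Proof.
move=> hp hq hr pq qr [x qx npx] [y ry nqy].
exists (fun i : 'I_3 => match val i with
  | 0 => prime_of hp | 1 => prime_of hq | _ => prime_of hr end) => i j.
have sub a b (ha : prime_ideal a) (hb : prime_ideal b) :
    (forall x, a x -> b x) -> (exists2 x, b x & ~ a x) ->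
    {subset prime_of ha <= prime_of hb} /\
    (exists2 x, x \in prime_of hb & x \notin prime_of ha).
  move=> ab [z bz naz]; split=> [u /mem_prime_of/ab h|]; first exact/mem_prime_of.
  by exists z; [exact/mem_prime_of|apply/negP => /mem_prime_of].
by case: i => -[|[|[|//]]] ?; case: j => -[|[|[|//]]] ? // _;
  apply: sub => //; [exists x|move=> u /pq/qr|exists y => // /pq|exists y].
Qed.

Lemma prime_chain_le m n : (m <= n)%N -> prime_chain R n -> prime_chain R m.
Proof.
move=> mn [p hp]; have h : (m.+1 <= n.+1)%N by [].
by exists (fun i => p (widen_ord h i)) => i j ij; apply: hp.
Qed.

Lemma krull_dim_unique m n : krull_dim R m -> krull_dim R n -> m = n.
Proof.
move=> [cm ncm] [cn ncn]; case: (ltngtP m n) => // h; exfalso.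
- by apply: ncm; apply: prime_chain_le cn.
- by apply: ncn; apply: prime_chain_le cm.
Qed.

End PrimeChains.

Section DimensionOne.
Variable R : comUnitRingType.
Hypothesis noeth : noetherian_ideals R.
Hypothesis loc : local_ring R.
Hypothesis dim1 : krull_dim R 1.
Implicit Types J p : R -> Prop.

(** A prime avoiding all the products s x^n lies strictly inside p, so p strictly inside m would
    give a chain of length two. *)
Lemma dim1_prime p x : prime_ideal p -> p x ->
  (forall s n, ~ p s -> s * x ^+ n <> 0) -> forall y, nonunit y -> p y.
Proof.
move=> hp px hx y uy; apply: contrapT => npy; apply: dim1.2.
have [id0 p1 pM] := hp.
have [|||_ -> [s [n [nps /esym]]]|q [hq _ qS]] :=
  @prime_avoiding _ noeth (fun y => y = 0)
    (fun y => exists s n, ~ p s /\ y = s * x ^+ n).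
- by split=> // a u v -> ->; rewrite mulr0 addr0.
- by exists 1, 0%N; rewrite mulr1.
- move=> _ _ [s [m [nps ->]]] [t [n [npt ->]]]; exists (s * t), (m + n)%N.
  by split; [case/pM|rewrite exprD mulrACA].
- exact: hx.
apply: (prime_chain3 hq hp (prime_nonunit loc)); last by exists y.
- move=> z qz; apply: contrapT => npz; apply: (qS _ qz).
  by exists z, 0%N; rewrite mulr1.
- by move=> z; apply: proper_nonunit.
- exists x => // qx; apply: (qS _ qx); exists 1, 1%N.
  by rewrite mul1r expr1.
Qed.

Lemma nonzero_nonunit : exists2 x : R, nonunit x & x != 0.
Proof.
have [[p hp] _] := dim1; have [_ [x xp1 xp0]] := hp ord0 ord_max isT.
exists x; last by apply: contra xp0 => /eqP ->; exact: rpred0.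
by apply/negP => ux; have := idealMr x^-1 xp1; rewrite mulVr // idealr1.
Qed.

Hypothesis red : reduced_ring R.

(** No c <> 0 is killed by m: if c is a nonunit then c^2 <> 0, and if it is a unit any nonzero
    nonunit will do. *)
Lemma exists_regular_nonunit : exists2 a : R, nonunit a & forall x, a * x = 0 -> x = 0.
Proof.
apply: exists_regular => //; first exact: ideal_nonunit.
move=> c c0; have [x ux x0] := nonzero_nonunit.
case: (boolP (c \is a GRing.unit)) => uc; last first.
  by exists c => //; apply: contra c0 => /eqP cc; rewrite (red (x := c) (n := 2) cc).
by exists x => //; apply: contra x0 => /eqP xc; rewrite -(mulrK uc x) xc mul0r.
Qed.

Section Regular.
Variable a : R.
Hypotheses (ua : nonunit a) (rega : forall x, a * x = 0 -> x = 0).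

Lemma regular_exp n x : a ^+ n * x = 0 -> x = 0.
Proof. by elim: n x => [|n IH] x; rewrite ?mul1r // exprS -mulrA => /rega/IH. Qed.

Lemma regular_not_prime p : prime_ideal p -> p a -> forall y, nonunit y -> p y.
Proof.
move=> hp pa; apply: (dim1_prime hp pa) => s n nps; rewrite mulrC => /regular_exp s0.
by apply: nps; rewrite s0; case: hp => -[].
Qed.

Lemma nonunit_nilp J x : ideal J -> J a -> nonunit x -> exists n, J (x ^+ n).
Proof.
move=> hJ Ja ux; apply: contrapT => /forallNP hn.
have [p [hp Jp npx]] := prime_radical noeth hJ hn.
by apply: npx; apply: (regular_not_prime hp) => //; exact: Jp.
Qed.

(** An associated prime of R/J contains the nonzerodivisor a, so it is m. *)
Lemma socle J : ideal J -> ~ J 1 -> J a ->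
  exists c, ~ J c /\ forall x, nonunit x -> J (x * c).
Proof.
move=> hJ J1 Ja; have [c [nJc hp]] := prime_colon noeth hJ J1.
exists c; split=> // x; apply: (regular_not_prime hp).
by rewrite mulrC; exact: idealM.
Qed.

(* A prime p <> m is minimal, so the reduced ring R_p is a field. *)
Lemma minimal_prime p : prime_ideal p -> ~ p a ->
  exists b, ~ p b /\ forall x, p x <-> x * b = 0.
Proof.
move=> hp npa; have [id1 p1 pM] := hp.
(* Otherwise [dim1_prime] would put a in p: by reducedness, s x^n = 0 already gives s x = 0. *)
have h x : p x -> exists2 s, ~ p s & s * x = 0.
  move=> px; apply: contrapT => hn; apply: npa; apply: (dim1_prime hp px) => // s n nps sx.
  apply: hn; exists s => //; apply: (red (n := n.+1)).
  have -> : (s * x) ^+ n.+1 = s ^+ n * x * (s * x ^+ n) by rewrite exprMn !exprS; ring.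
  by rewrite sx mulr0.
have [n [x hx]] := noeth id1.
have px i : p (x i).
  apply/hx; exists (fun j => (j == i)%:R).
  by rewrite (bigD1 i) //= eqxx mul1r big1 ?addr0 // => j /negPf ->; rewrite mul0r.
have /choice[s hs] : forall i, exists s, ~ p s /\ s * x i = 0.
  by move=> i; have [s ? ?] := h _ (px i); exists s.
exists (\prod_i s i); have npb : ~ p (\prod_i s i).
  elim/big_ind: _ => // [u v nu nv /pM[]//|i _].
  by case: (hs i).
split=> // y; split=> [/hx[c ->]|yb]; last first.
  by have [//|/npb] : p y \/ p (\prod_i s i) by apply: pM; rewrite yb; case: id1.
rewrite mulr_suml big1 // => i _; rewrite (bigD1 i) //=.
by rewrite -mulrA [x i * _]mulrA [x i * _]mulrC (hs i).2 mul0r mulr0.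
Qed.

End Regular.

(** Nakayama's lemma for m = (x) + m^2, with m^2 replaced by the ideals K above it. Let J be maximal
    among the ideals containing x and strictly inside m. If v w is not in J, for v and w in m, then
    J + (v w) = m contains v, so v (1 - b w) is in J and hence v is. Thus J contains m^2, and J =
    m. *)
Lemma nakayama_nonunit x : nonunit x ->
  (forall K, ideal K -> (forall y z : R, nonunit y -> nonunit z -> K (y * z)) -> K x ->
     forall z : R, nonunit z -> K z) ->
  forall z : R, nonunit z -> exists b, z = x * b.
Proof.
move=> ux hm; apply: contrapT => nm.
have [z uz nz] : exists2 z, nonunit z & ~ exists b, z = x * b.
  by apply: contrapT => hn; apply: nm => z uz; apply: contrapT => nz; apply: hn; exists z.
pose Q (J : R -> Prop) := [/\ J x, forall y, J y -> nonunit y & exists2 y, nonunit y & ~ J y].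
have [|J [hJ [xJ Jm [y uy nJy]] Jmax]] := @ideal_max _ noeth Q _ (ideal_principal x).
  split; [by exists 1; rewrite mulr1| |by exists z].
  by move=> _ [b ->]; rewrite mulrC; exact: nonunitM.
have big w : nonunit w -> ~ J w -> forall v, nonunit v -> exists b u, J u /\ v = u + b * w.
  move=> uw nJw v uv; apply: contrapT => nv; apply: nJw.
  apply: (Jmax _ (ideal_add w hJ)).
  - split; [by exists 0, x; rewrite mul0r addr0| |by exists v].
    by move=> _ [b [u [Ju ->]]]; apply: loc; [exact: Jm|exact: nonunitM].
  - by move=> u Ju; exists 0, u; rewrite mul0r addr0.
  - by exists 1, 0; rewrite mul1r add0r; split=> //; case: hJ.
apply: nJy; apply: hm => // v w uv uw; apply: contrapT => nJvw; apply: (nJvw).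
have [b [u [Ju vE]]] := big _ (nonunitM v uw) nJvw v uv.
have uu : 1 - b * w \is a GRing.unit.
  apply: contrapT => /negP nu; suff : nonunit (1 : R) by rewrite /nonunit unitr1.
  by rewrite -[1](subrK (b * w)); apply: loc => //; exact: nonunitM.
have -> : v = (1 - b * w)^-1 * u.
  apply: (mulrI uu); rewrite mulrA mulrV // mul1r.
  have -> : u = v - b * (v * w) by rewrite {1}vE addrK.
  ring.
by rewrite mulrAC; exact: idealM.
Qed.

End DimensionOne.

(** * Derivations and the principality of the maximal ideal *)

Section Derivations.
Variable R : comUnitRingType.
Hypothesis noeth : noetherian_ideals R.
Hypothesis loc : local_ring R.
Hypothesis dim1 : krull_dim R 1.
Hypothesis char0 : forall n, n.+1%:R \is a @GRing.unit R.

Definition leibniz (D : R -> R) : Prop :=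
  (forall x y, D (x + y) = D x + D y) /\ forall x y, D (x * y) = x * D y + y * D x.

Lemma leibniz0 D : leibniz D -> D 0 = 0.
Proof. by case=> hD _; apply: (addrI (D 0)); rewrite -hD !addr0. Qed.

Lemma leibnizN D x : leibniz D -> D (- x) = - D x.
Proof. by move=> hD; apply: (addrI (D x)); rewrite -hD.1 !subrr leibniz0. Qed.

Lemma leibnizX D x n : leibniz D -> D (x ^+ n.+1) = n.+1%:R * x ^+ n * D x.
Proof.
move=> hD; elim: n => [|n IH]; first by rewrite expr1 mulr1 mul1r.
by rewrite exprS hD.2 IH -[n.+2%:R]natr1 exprS; ring.
Qed.

(** Applying s D to s x^(n+1) = 0 leaves (n+1) s^2 x^n = 0, and s^2 is again outside p. *)
Lemma leibniz_parameter D p x : leibniz D -> D x = 1 -> prime_ideal p ->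
  forall s n, ~ p s -> s * x ^+ n <> 0.
Proof.
move=> hD Dx [p0 p1 pM] s n; elim: n s => [|n IH] s nps.
  by rewrite mulr1 => s0; apply: nps; rewrite s0; case: p0.
move=> sx; apply: (IH (s * s)) => [/pM[]//|].
have : s * D (s * x ^+ n.+1) = 0 by rewrite sx leibniz0 // mulr0.
rewrite hD.2 leibnizX // Dx mulr1 mulrDr [X in _ + X]mulrA sx mul0r addr0 => h.
by apply: (mulrI (char0 n)); rewrite mulr0 -h; ring.
Qed.

Hypothesis cotangent : forall (f : R) (K : R -> Prop), nonunit f -> ideal K ->
  (forall y z : R, nonunit y -> nonunit z -> K (y * z)) -> ~ K f ->
  exists2 D, leibniz D & D f = 1.

(** If x1, outside m^2, did not generate m, an x2 independent of x1 modulo m^2 would exist. A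
    derivation killing x1 but not x2 then contradicts the fact that m is the only prime containing
    x1. *)
Lemma maximal_ideal_principal : exists x : R, nonunit x /\
  forall z : R, nonunit z -> exists b, z = x * b.
Proof.
have outside x : nonunit x -> ~ (forall z : R, nonunit z -> exists b, z = x * b) ->
    exists K (z : R), [/\ ideal K, forall y z : R, nonunit y -> nonunit z -> K (y * z),
      K x, nonunit z & ~ K z].
  move=> ux hn; apply: contrapT => hK; apply: hn; apply: nakayama_nonunit => //.
  move=> K hK' Km Kx z uz; apply: contrapT => nKz; apply: hK.
  by exists K, z.
have [z uz z0] := nonzero_nonunit dim1.
have [|K1 [x1 [hK1 K1m _ ux1 nK1]]] := outside 0 (nonunit0 R).
  by move=> /(_ z uz)[b zb]; rewrite zb mul0r eqxx in z0.
exists x1; split=> //; apply: contrapT => /(outside _ ux1)[K [x2 [hK Km Kx1 ux2 nKx2]]].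
have [D1 hD1 D1x1] := cotangent ux1 hK1 K1m nK1.
(* This keeps y outside K, since x1 is in K, and makes D1 y a multiple of x1. *)
pose y := x2 - D1 x2 * x1.
have uy : nonunit y by apply: loc => //; rewrite -mulNr; exact: nonunitM.
have nKy : ~ K y.
  move=> Ky; apply: nKx2; have -> : x2 = y + D1 x2 * x1 by rewrite subrK.
  by apply: idealD => //; exact: idealM.
have [E hE Ey] := cotangent uy hK Km nKy.
(* The correction kills x1, and D y remains a unit because D1 y is in m. *)
pose D x := E x - E x1 * D1 x.
have hD : leibniz D.
  by split=> u v; rewrite /D ?hE.1 ?hD1.1 ?hE.2 ?hD1.2; ring.
have Dx1 : D x1 = 0 by rewrite /D D1x1 mulr1 subrr.
have uDy : D y \is a GRing.unit.
  have -> : D y = 1 - E x1 * - (x1 * D1 (D1 x2)).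
    by rewrite /D Ey /y hD1.1 (leibnizN _ hD1) hD1.2 D1x1; ring.
  apply: contrapT => /negP nu; suff : nonunit (1 : R) by rewrite /nonunit unitr1.
  rewrite -[1](subrK (E x1 * - (x1 * D1 (D1 x2)))); apply: loc => //.
  by rewrite mulrN -mulNr mulrCA mulrC; exact: nonunitM.
have [n [b yn]] : exists n b, y ^+ n = x1 * b.
  apply: contrapT => hn.
  have [|p [hp xp npy]] := @prime_radical _ noeth _ y (ideal_principal x1).
    by move=> n yn; apply: hn; exists n.
  apply: npy; apply: (dim1_prime noeth loc dim1 hp) => //.
    by apply: xp; exists 1; rewrite mulr1.
  exact: (leibniz_parameter hD1 D1x1 hp).
(* Applying D to y^(n+1) = x1 b lowers the exponent; at exponent 0 the element x1 would be a
   unit. *)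
elim: n b yn => [|n IH] b yn.
  by move: ux1; rewrite /nonunit => /negP[]; apply/unitrP; exists b; rewrite mulrC -yn expr0.
have := congr1 D yn; rewrite leibnizX // hD.2 Dx1 mulr0 addr0 => h.
apply: (IH (D b * (D y)^-1 * n.+1%:R^-1)).
apply: (mulrI (char0 n)); apply: (mulIr uDy); rewrite h.
rewrite mulrCA; have -> (u v w : R) : x1 * (u * (D b * v * w)) * D y = x1 * D b * (v * D y) * (u * w) by ring.
by rewrite mulVr // mulrV // !mulr1.
Qed.

Lemma regular_of_leibniz : regular_local R.
Proof.
split.
  move=> I; apply: noeth; split; first exact: rpred0.
  by move=> a x y Ix Iy; rewrite rpredD // idealMr.
have [x [ux hx]] := maximal_ideal_principal.
exists 1%N, (fun=> x); split=> // a; split=> [/hx[b ->]|[c ->]].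
  by exists (fun=> b); rewrite big_ord1 mulrC.
by rewrite big_ord1; exact: nonunitM.
Qed.

End Derivations.

(** * Injective dimension *)

(** Defines a map by a formula on representatives; it takes the value 0 off the image of k. *)
Lemma factor_fun (T U : Type) (V : nmodType) (P : T -> Prop) (k : T -> U) (v : T -> V) :
  (forall t t', P t -> P t' -> k t = k t' -> v t = v t') ->
  exists f, forall t, P t -> f (k t) = v t.
Proof.
move=> h; suff /choice[f hf] : forall u, exists w, forall t, P t -> k t = u -> w = v t.
  by exists f => t Pt; exact: hf.
move=> u; case: (EM (exists2 t, P t & k t = u)) => [[t Pt tu]|hn].
  by exists (v t) => t' Pt' t'u; apply: h => //; rewrite tu.
by exists 0 => t Pt tu; case: hn; exists t.
Qed.

(** * Lifting, factoring and extending linear maps *)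

Section LinearMaps.
Variable R : comNzRingType.

Lemma linear_map (A B : lmodType R) (f : A -> B) : linear f ->
  exists g : {linear A -> B}, forall x, g x = f x.
Proof.
move=> hf; pose g : {linear A -> B} := HB.pack f (GRing.isLinear.Build _ _ _ _ f hf).
by exists g.
Qed.

Lemma lift_injective (A K P : lmodType R) (j : {linear K -> P}) (w : {linear A -> P}) :
  injective j -> (forall a, exists x, j x = w a) ->
  exists v : {linear A -> K}, forall a, j (v a) = w a.
Proof.
move=> inj /choice[v hv]; have [|v' hv'] := @linear_map _ _ v.
  by move=> a x y; apply: inj; rewrite linearP !hv linearP.
by exists v' => a; rewrite hv'.
Qed.

Lemma lift_surjective (A B N : lmodType R) (p : {linear A -> B}) (w : {linear A -> N}) :
  (forall b, exists a, p a = b) -> (forall a, p a = 0 -> w a = 0) ->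
  exists v : {linear B -> N}, forall a, v (p a) = w a.
Proof.
move=> surj ker; have [|v hv] := @factor_fun _ _ N (fun=> True) p w.
  by move=> a a' _ _ paa'; apply/eqP; rewrite -subr_eq0 -linearB ker // linearB paa' subrr.
have [|v' hv'] := @linear_map _ _ v; last by exists v' => a; rewrite hv' hv.
move=> c x y; have [a <-] := surj x; have [b <-] := surj y.
by rewrite -linearP !hv // linearP.
Qed.

Definition submodule (P : lmodType R) (S : P -> Prop) : Prop :=
  S 0 /\ forall a x y, S x -> S y -> S (a *: x + y).

Definition linear_on (P N : lmodType R) (S : P -> Prop) (g : P -> N) : Prop :=
  forall a x y, S x -> S y -> g (a *: x + y) = a *: g x + g y.

Section SubmoduleType.
Variables (P : lmodType R) (S : P -> Prop) (hS : submodule S).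
Definition submod_bool : {pred P} := fun x => `[< S x >].
Lemma submod_bool_closed : submod_closed submod_bool.
Proof.
split; first by apply/asboolP; case: hS.
by move=> a u v /asboolP Su /asboolP Sv; apply/asboolP; exact: hS.2.
Qed.
HB.instance Definition _ := GRing.isSubmodClosed.Build R P submod_bool submod_bool_closed.
Definition submod_of : submodClosed P := submod_bool.

Lemma mem_submod_of x : x \in submod_of <-> S x.
Proof. by split=> [/asboolP|Sx]; [|exact/asboolP]. Qed.

(** Realized as the kernel of the quotient map, to inherit the module structure of [kernel]. *)
Definition submod : lmodType R := kernel (quot_pi submod_bool).
Definition submod_val : {linear submod -> P} := val.

Lemma submod_valP (x : submod) : S (submod_val x).
Proof.
have : submod_val x \in Defs.lker (quot_pi submod_bool) by exact: valP.
rewrite unfold_in => /eqP; rewrite -(linear0 (quot_pi submod_bool)).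
by move/quot_pi_eq; rewrite subr0 => /asboolP.
Qed.

Lemma submod_val_onto x : S x -> exists y : submod, submod_val y = x.
Proof.
move=> Sx; have h : x \in Defs.lker (quot_pi submod_bool).
  rewrite unfold_in; apply/eqP; rewrite -(linear0 (quot_pi submod_bool)).
  by apply/quot_pi_eq; rewrite subr0; apply/asboolP.
by exists (Kernel h).
Qed.
End SubmoduleType.

Lemma injective_extend (E P : lmodType R) (S : P -> Prop) (g : P -> E) :
  injective_module E -> submodule S -> linear_on S g ->
  exists G : {linear P -> E}, forall x, S x -> G x = g x.
Proof.
move=> injE hS hg.
have [|h hh] := @linear_map (submod hS) E (fun x => g (submod_val hS x)).
  by move=> a x y; cbv beta; rewrite linearP; apply: hg; exact: submod_valP.
have [G hG] := injE _ _ (submod_val hS) h val_inj.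
by exists G => x /(submod_val_onto hS)[y <-]; rewrite hG hh.
Qed.

Lemma linear_on0 (P N : lmodType R) S (g : P -> N) : submodule S -> linear_on S g -> g 0 = 0.
Proof.
move=> [S0 _] hg; have := hg 1 0 0 S0 S0; rewrite !scale1r addr0 => h.
by apply: (addrI (g 0)); rewrite -h addr0.
Qed.

Lemma linear_onD (P N : lmodType R) S (g : P -> N) x y : linear_on S g -> S x -> S y ->
  g (x + y) = g x + g y.
Proof. by move=> hg Sx Sy; rewrite -{1}[x]scale1r hg // scale1r. Qed.

Lemma linear_onZ (P N : lmodType R) S (g : P -> N) a x : submodule S -> linear_on S g -> S x ->
  g (a *: x) = a *: g x.
Proof.
by move=> hS hg Sx; rewrite -[a *: x]addr0 hg ?(linear_on0 hS hg) ?addr0 //; case: hS.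
Qed.

End LinearMaps.

Lemma regular_scaleE (R : comNzRingType) (r x : R) : r *: (x : R^o) = r * x.
Proof. by []. Qed.

Lemma submodule_ideal (R : comNzRingType) (J : R -> Prop) : ideal J -> submodule (J : R^o -> Prop).
Proof. by []. Qed.

Lemma ideal_linear_on (R : comNzRingType) (N : lmodType R) (J : R -> Prop) (g : R^o -> N) x y :
  ideal J -> linear_on (J : R^o -> Prop) g -> J y -> g (x * y) = x *: g y.
Proof. move=> hJ hg; exact: (linear_onZ x (submodule_ideal hJ) hg). Qed.

(** * Finite injective dimension in dimension one *)

Section InjectiveDimension.
Variable R : comUnitRingType.
Hypothesis noeth : noetherian_ideals R.
Hypothesis loc : local_ring R.
Hypothesis dim1 : krull_dim R 1.
Hypothesis red : reduced_ring R.

Section Resolution.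
Variables (I : nat -> lmodType R) (d : forall i, {linear I i -> I i.+1}).
Hypothesis injI : forall i, injective_module (I i).
Hypothesis exI : forall i, exact (d i) (d i.+1).

(* The cosyzygy [ker (d j)] passes Baer's criterion. *)
Definition baer (j : nat) : Prop := forall (J : R -> Prop) (phi : R^o -> I j),
  ideal J -> linear_on (J : R^o -> Prop) phi -> (forall x, J x -> d j (phi x) = 0) ->
  exists2 v, d j v = 0 & forall x, J x -> phi x = x *: v.

Variables (a c0 : R).
Hypotheses (ua : nonunit a) (rega : forall x, a * x = 0 -> x = 0).
Hypotheses (ac0 : ~ exists b, c0 = a * b)
  (mc0 : forall x, nonunit x -> exists b, x * c0 = a * b).

(** The cosyzygy is an image of the injective module [I i], and injectives are divisible by
    nonzerodivisors. *)
Lemma cosyzygy_divisible i (z : I i.+1) : d i.+1 z = 0 ->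
  exists2 w, d i.+1 w = 0 & a *: w = z.
Proof.
move=> /exI[u <-]; have [phi hphi] : exists phi : R^o -> I i, forall r, True -> phi (a * r) = r *: u.
  apply: factor_fun => r r' _ _ ar; congr (_ *: _); apply/eqP; rewrite -subr_eq0; apply/eqP.
  by apply: rega; rewrite mulrBr ar subrr.
have [||G hG] := @injective_extend _ _ R^o (fun y => exists b, y = a * b) phi (@injI i).
- exact: ideal_principal.
- move=> r _ _ [x ->] [y ->]; rewrite !hphi //.
  by rewrite regular_scaleE mulrCA -mulrDr hphi // scalerDl scalerA.
exists (d i (G 1)); first by apply/exI; exists (G 1).
rewrite -linearZ -linearZ regular_scaleE hG; last by exists 1.
by rewrite hphi // scale1r.
Qed.

(** Injectivity of [I i.+1] gives phi x = x t with p killing d t, and t has to be moved into the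
    kernel of d. The criterion one step further on supplies the correction. *)
Lemma baer_prime i (p : R -> Prop) (phi : R^o -> I i.+1) : baer i.+2 -> prime_ideal p ->
  linear_on (p : R^o -> Prop) phi -> (forall x, p x -> d i.+1 (phi x) = 0) ->
  exists2 v, d i.+1 v = 0 & forall x, p x -> phi x = x *: v.
Proof.
move=> hb [hp p1 pM] hphi dphi.
have [G hG] := injective_extend (@injI i.+1) (submodule_ideal hp) hphi.
have {}hG x : p x -> phi x = x *: G 1 by move=> px; rewrite -linearZ regular_scaleE mulr1 hG.
set t := G 1 in hG; have dt x : p x -> x *: d i.+1 t = 0.
  by move=> px; rewrite -linearZ -hG // dphi.
(* t is corrected by a multiple b *: w with p b w = 0, in order to kill d t. *)
suff [b [w [pbw bw]]] : exists b w, (forall x, p x -> (x * b) *: w = 0) /\ b *: d i.+1 w = d i.+1 t.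
  exists (t - b *: w); first by rewrite linearB linearZ /= bw subrr.
  by move=> x px; rewrite scalerBr scalerA pbw // subr0 hG.
have dd (u : I i.+1) : d i.+2 (d i.+1 u) = 0 by apply/exI; exists u.
(* If a is in p then p = m. On the ideal (a, c0), a r + c0 s -> s (d t) is well defined, as a unit s
   would put c0 in (a). Extending it gives w with c0 (d w) = d t and a (d w) = 0; divisibility makes
   w itself a-torsion, and since m c0 is in (a), m kills c0 w. *)
have [pa|npa] := EM (p a).
  have pm : forall y, nonunit y -> p y by apply: regular_not_prime pa.
  have [psi hpsi] : exists psi : R^o -> I i.+2,
      forall rs : R * R, True -> psi (a * rs.1 + c0 * rs.2) = rs.2 *: d i.+1 t.
    apply: factor_fun => -[r s] [r' s'] _ _ /= h.
    apply/eqP; rewrite -subr_eq0 -scalerBl dt //; apply: pm; apply/negP => us; apply: ac0.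
    exists ((r' - r) / (s - s')); rewrite mulrA; apply: (mulIr us); rewrite mulrVK //.
    by apply/eqP; rewrite -subr_eq0; apply/eqP; transitivity (a * r + c0 * s - (a * r' + c0 * s')); [ring|rewrite h subrr].
  have [|||y dy hy] := hb (fun y => exists rs : R * R, y = a * rs.1 + c0 * rs.2) psi.
  - split; first by exists (0, 0); rewrite !mulr0 addr0.
    by move=> r _ _ [u ->] [v ->]; exists (r * u.1 + v.1, r * u.2 + v.2); rewrite /=; ring.
  - move=> r _ _ [u ->] [v ->]; rewrite !hpsi // scalerA -scalerDl.
    rewrite -(hpsi (r * u.1 + v.1, r * u.2 + v.2)) //=; congr psi.
    by rewrite regular_scaleE; ring.
  - by move=> _ [u ->]; rewrite hpsi // linearZ /= dd scaler0.
  have [w wy] := (exI y).1 dy.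
  have ay : a *: d i.+1 w = 0.
    by rewrite wy -hy; [rewrite -[a]addr0 -{1}[a]mulr1 -(mulr0 c0) (hpsi (1, 0)) // scale0r|
      exists (1, 0); rewrite mulr1 mulr0 addr0].
  have [z dz az] : exists2 z, d i.+1 z = 0 & a *: z = a *: w.
    by apply: cosyzygy_divisible; rewrite linearZ.
  exists c0, (w - z); split=> [x px|].
    have [b ->] := mc0 (proper_nonunit hp p1 px).
    by rewrite mulrC -scalerA scalerBr az subrr scaler0.
  rewrite linearB dz subr0 wy -hy; last by exists (0, 1); rewrite mulr0 mulr1 add0r.
  by rewrite -[c0]mulr1 -[_ * _]add0r -(mulr0 a) (hpsi (0, 1)) // scale1r.
(* Here p is a minimal prime, the annihilator of b, and the map to extend is b r -> r (d t). *)
have [b [npb pb]] := minimal_prime noeth loc dim1 red ua (And3 hp p1 pM) npa.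
have [psi hpsi] : exists psi : R^o -> I i.+2, forall r, True -> psi (b * r) = r *: d i.+1 t.
  apply: factor_fun => r r' _ _ h; apply/eqP; rewrite -subr_eq0 -scalerBl dt //.
  by apply/pb; rewrite mulrC mulrBr h subrr.
have [|||y dy hy] := hb (fun y => exists r, y = b * r) psi.
- exact: ideal_principal.
- move=> r _ _ [x ->] [y ->]; rewrite !hpsi //.
  by rewrite regular_scaleE mulrCA -mulrDr hpsi // scalerDl scalerA.
- by move=> _ [r ->]; rewrite hpsi // linearZ /= dd scaler0.
have [w wy] := (exI y).1 dy.
exists b, w; split=> [x /pb ->|]; first by rewrite scale0r.
by rewrite wy -hy; [rewrite -[b]mulr1 hpsi // scale1r|exists 1; rewrite mulr1].
Qed.

(** For a maximal counterexample J and a prime colon p = (J : c), the prime case applied to x -> phi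
    (x c) extends phi to J + (c), and this extension is a larger counterexample. *)
Lemma baer_descent i : baer i.+2 -> baer i.+1.
Proof.
move=> hb J0 phi0 hJ0 lphi0 dphi0; apply: contrapT => nphi0.
pose Q J := exists phi : R^o -> I i.+1, [/\ linear_on (J : R^o -> Prop) phi, forall x, J x -> d i.+1 (phi x) = 0
  & ~ exists2 v, d i.+1 v = 0 & forall x, J x -> phi x = x *: v].
have [|J [hJ [phi [lphi dphi nphi]] Jmax]] := @ideal_max _ noeth Q _ hJ0; first by exists phi0.
apply: nphi; have [J1|nJ1] := EM (J 1).
  exists (phi 1); first exact: dphi.
  by move=> x _; rewrite -(ideal_linear_on x hJ lphi J1) mulr1.
have [c [nJc hp]] := prime_colon noeth hJ nJ1.
have [||n1 dn1 hn1] := @baer_prime i _ (fun x => phi (x * c)) hb hp.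
- by move=> r x y Jx Jy; rewrite -lphi // mulrDl -mulrA.
- by move=> x; exact: dphi.
have [psi hpsi] : exists psi : R^o -> I i.+1,
    forall t : R * R, J t.1 -> psi (t.1 + t.2 * c) = phi t.1 + t.2 *: n1.
  apply: factor_fun => -[x r] [y s] /= Jx Jy h.
  have xy : x - y = (s - r) * c.
    by apply/eqP; rewrite -subr_eq0; apply/eqP; transitivity (x + r * c - (y + s * c)); [ring|rewrite h subrr].
  have := hn1 (s - r); rewrite -xy => /(_ (idealB hJ Jx Jy)) e.
  rewrite -[x in LHS](subrK y) (linear_onD lphi) //; last exact: idealB.
  by rewrite e scalerBl addrAC subrK addrC.
have : ~ Q (fun y => exists r x, J x /\ y = x + r * c).
  move=> hQ; apply: nJc; apply: (Jmax _ (ideal_add c hJ) hQ).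
    by move=> x Jx; exists 0, x; rewrite mul0r addr0.
  by exists 1, 0; rewrite mul1r add0r; split=> //; case: hJ.
move=> nQ; apply: contrapT => nv; apply: nQ; exists psi; split.
- move=> r _ _ [s [x [Jx ->]]] [t [y [Jy ->]]].
  rewrite (hpsi (x, s)) // (hpsi (y, t)) //=.
  have -> : r *: (x + s * c : R^o) + (y + t * c) = (r * x + y) + (r * s + t) * c.
    by rewrite regular_scaleE; ring.
  rewrite (hpsi (r * x + y, r * s + t)) /=; last exact: hJ.2.
  by rewrite lphi // scalerDl scalerDr scalerA addrACA.
- by move=> _ [s [x [Jx ->]]]; rewrite (hpsi (x, s)) //= linearD linearZ /= dn1 dphi // scaler0 addr0.
- move=> [v dv hv]; apply: nv; exists v => // x Jx.
  by rewrite -hv; [rewrite -[x in RHS]addr0 -(mul0r c) (hpsi (x, 0)) //= scale0r addr0|exists 0, x; rewrite mul0r addr0].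
Qed.

End Resolution.

(** Descent from the zero end of the resolution: the first cosyzygy is injective, i.e. the injective
    dimension is at most one. *)
Lemma baer1 I d : (forall i, injective_module (I i)) ->
  (forall i, exact (d i) (d i.+1)) ->
  (exists n, forall i, (n < i)%N -> is_zero_module (I i)) -> @baer I d 1.
Proof.
move=> injI exI [n hn].
have [a ua rega] := exists_regular_nonunit noeth loc dim1 red.
have [||c0 [ac0 mc0]] := @socle R noeth loc dim1 a rega _ (ideal_principal a).
- move=> [b /esym ab]; move: ua; rewrite /nonunit => /negP; apply.
  by apply/unitrP; exists b; rewrite mulrC.
- by exists 1; rewrite mulr1.
suff h m i : (n <= i + m)%N -> baer d i.+1 by apply: (h n); rewrite add0n.
elim: m i => [|m IH] i; last first.
  by rewrite addnS -addSn => /IH; exact: (baer_descent injI exI ua rega ac0 mc0).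
rewrite addn0 => ni J phi _ _ _; have z := hn i.+1 ni.
by exists 0; [rewrite linear0|move=> x _; rewrite (z (phi x)) scaler0].
Qed.

(* [Ext^1(L, omega) = 0] for [L] embedded in a free module by functionals [u]. *)
Lemma extend_from_kernel (omega : lmodType R) : finite_injdim omega ->
  forall (P : lmodType R) n (u : 'I_n -> {linear P -> R^o}) (g : P -> omega),
  linear_on (fun x => forall i, u i x = 0) g ->
  exists G : {linear P -> omega}, forall x, (forall i, u i x = 0) -> G x = g x.
Proof.
move=> [n0 [I [e [d [injI inje exe exI hn]]]]] P.
have b1 : baer d 1 by apply: baer1 => //; exists n0.
have de x : d 0 (e x) = 0 by apply/exe; exists x.
(* One functional at a time. Extend e g to G with values in [I 0]; then [d 0] G factors through u,
   so by Baer's criterion it is multiplication of u by some [d 0 w], and G - u w takes values in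
   omega. *)
have step (S : P -> Prop) (u : {linear P -> R^o}) (g : P -> omega) : submodule S ->
    linear_on (fun x => S x /\ u x = 0) g ->
    exists2 h, linear_on S h & forall x, S x -> u x = 0 -> h x = g x.
  move=> hS hg; have [||G hG] := @injective_extend _ _ P (fun x => S x /\ u x = 0) (fun x => e (g x)) (injI 0).
  - split; first by rewrite linear0; split=> //; case: hS.
    by move=> a x y [Sx ux] [Sy uy]; rewrite linearP ux uy scaler0 addr0; split=> //; exact: hS.2.
  - by move=> a x y Sx Sy; rewrite hg // linearP.
  have [phi hphi] : exists phi : R^o -> I 1, forall x, S x -> phi (u x) = d 0 (G x).
    apply: factor_fun => x y Sx Sy uxy; apply/eqP; rewrite -subr_eq0 -!linearB /=.
    rewrite hG ?de //; split; last by rewrite linearB uxy subrr.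
    by rewrite addrC -scaleN1r; exact: hS.2.
  have [|||y dy hy] := b1 (fun r => exists2 x, S x & r = u x) phi.
  - split; first by exists 0; rewrite ?linear0 //; case: hS.
    move=> a _ _ [x Sx ->] [y Sy ->]; exists (a *: x + y); first exact: hS.2.
    by rewrite linearP.
  - move=> a _ _ [x Sx ->] [y Sy ->].
    by rewrite -linearP !hphi //; [rewrite !linearP|exact: hS.2].
  - by move=> _ [x Sx ->]; rewrite hphi //; apply/exI; exists (G x).
  have [w wy] := (exI 0 y).1 dy.
  have /choice[h hh] : forall x, exists v, S x -> e v = G x - u x *: w.
    move=> x; have [Sx|nSx] := EM (S x); last by exists 0.
    have [|v hv] := (exe (G x - u x *: w)).1; last by exists v.
    by rewrite linearB linearZ /= wy -hy ?hphi ?subrr //; exists x.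
  exists h => [a x z Sx Sz|x Sx ux]; apply: inje.
    rewrite linearP !hh //; last exact: hS.2.
    by rewrite !linearP /= scalerBr scalerDl scalerA opprD addrACA.
  by rewrite hh // ux scale0r subr0 hG.
elim=> [|n IH] u g hg.
  have [|G hG] := @linear_map _ P omega g; last by exists G => x _; rewrite hG.
  by move=> a x y; apply: hg => -[].
have [||h hh hg'] := step (fun x => forall i : 'I_n, u (fintype.lift ord_max i) x = 0) (u ord_max) g.
- by split=> [i|a x y ux uy i]; rewrite ?linear0 // linearP ux uy scaler0 addr0.
- have k x : (forall i : 'I_n, u (fintype.lift ord_max i) x = 0) /\ u ord_max x = 0 -> forall i, u i x = 0.
    by move=> [h1 h2] i; case: (unliftP ord_max i) => [j|] ->.
  by move=> a x y /k Sx /k Sy; exact: hg.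
have [G hG] := IH _ _ hh; exists G => x ux.
by rewrite hG ?hg' // => i; exact: ux.
Qed.

End InjectiveDimension.

(** * Projective modules and Ext *)

Section Projective.
Variable R : comNzRingType.

Lemma hom_linear (M N : lmodType R) (h : hom M N) : linear h.
Proof. by have /asboolP := valP h. Qed.

Definition hom_lin (M N : lmodType R) (h : hom M N) : M -> N := h.
HB.instance Definition _ (M N : lmodType R) (h : hom M N) :=
  GRing.isLinear.Build R M N *:%R (hom_lin h) (@hom_linear M N h).

Lemma hom_sumE (M N : lmodType R) (I : Type) (r : seq I) (h : I -> hom M N) x :
  (\sum_(i <- r) h i) x = \sum_(i <- r) h i x.
Proof. by rewrite -[LHS]/(val _ x) raddf_sum fct_sumE. Qed.

Lemma linear_hom (M N : lmodType R) (f : M -> N) : linear f ->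
  exists h : hom M N, forall x, h x = f x.
Proof.
move=> hf; have fP : f \in @hom_pred R M N by apply/asboolP.
by exists (Hom fP).
Qed.

Definition projective (P : lmodType R) : Prop :=
  forall (B C : lmodType R) (p : {linear B -> C}) (w : {linear P -> C}),
  (forall x, exists b, p b = w x) -> exists v : {linear P -> B}, forall x, p (v x) = w x.

Lemma projective_basis (P : lmodType R) n (c : 'I_n -> {linear P -> R^o}) (e : 'I_n -> P) :
  (forall x, x = \sum_i c i x *: e i) -> projective P.
Proof.
move=> hP B C p w hw; have /choice[b hb] : forall i, exists b, p b = w (e i) by move=> i; exact: hw.
have [|v hv] := @linear_map _ P B (fun x => \sum_i c i x *: b i).
  move=> a x y; rewrite scaler_sumr -big_split; apply: eq_bigr => i _ /=.
  by rewrite linearP scalerDl scalerA.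
exists v => x; rewrite hv linear_sum {2}[x]hP linear_sum; apply: eq_bigr => i _.
by rewrite !linearZ /= hb.
Qed.

Lemma projective_regular : projective (R^o : lmodType R).
Proof.
apply: (@projective_basis _ 1 (fun=> idfun) (fun=> 1)) => x.
by rewrite big_ord1 regular_scaleE mulr1.
Qed.

Lemma projective_dual_row n : projective (hom 'rV[R]_n R^o).
Proof.
pose c i : {linear hom 'rV[R]_n R^o -> R^o} :=
  HB.pack (fun h : hom 'rV[R]_n R^o => h (delta_mx 0 i) : R^o)
    (GRing.isLinear.Build R _ R^o *:%R (fun h : hom 'rV[R]_n R^o => h (delta_mx 0 i) : R^o)
       (fun a g h => erefl)).
have /choice[e he] : forall i : 'I_n, exists h : hom 'rV[R]_n R^o, forall x, h x = x 0 i.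
  by move=> i; apply: linear_hom => a x y; rewrite !mxE.
apply: (@projective_basis _ n c e) => h; apply/val_inj/funext => x.
have -> : val h x = \sum_i x 0 i * h (delta_mx 0 i).
  rewrite -[val h x]/(hom_lin h x) [in LHS](row_sum_delta x) linear_sum.
  by apply: eq_bigr => i _; rewrite linearZ.
rewrite raddf_sum fct_sumE; apply: eq_bigr => i _.
by rewrite /= -[LHS]/(_ * _) mulrC -he.
Qed.

Lemma free_cover_gen (M : lmodType R) (x : M) : free_cover << x >> = x.
Proof. by rewrite /free_cover liftU scale1r. Qed.

Lemma linear_free (X : choiceType) (A : lmodType R) (g : {linear free_module R X -> A})
  (D : free_module R X) : g D = \sum_(x <- dom D) coeff x D *: g << x >>.
Proof.
rewrite -[in LHS](freeg_sumE D) raddf_sum; apply: eq_bigr => x _.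
rewrite -linearZ; congr (g _); apply/eqP/freeg_eqP => y.
by rewrite coeffZ !coeffU mul1r.
Qed.

Lemma projective_free (X : choiceType) : projective (free_module R X).
Proof.
move=> B C p w hw; have /choice[f hf] : forall x : X, exists b, p b = w << x >> by move=> x; exact: hw.
have [|v hv] := @linear_map _ (free_module R X) B (fglift f).
  move=> a D E; have coverB := lift_is_additive f.
  pose F : {additive free_module R X -> B} :=
    HB.pack (fglift f) (GRing.isAdditive.Build _ _ (fglift f) coverB).
  rewrite -[fglift f]/(F : _ -> _) raddfD; congr (_ + _).
  have -> : a *: D = \sum_(x <- dom D) << a * coeff x D *g x >> :> free_module R X by [].
  rewrite raddf_sum -[in RHS](freeg_sumE D) (raddf_sum F) scaler_sumr.
  by apply: eq_bigr => x _; rewrite /F /= !liftU scalerA.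
exists v => D; rewrite [in LHS]linear_free [in RHS]linear_free linear_sum.
by apply: eq_bigr => x _; rewrite linearZ /= hv liftU scale1r hf.
Qed.

Lemma syzygy_val_eq0 (M : lmodType R) (z : syzygy M) : free_cover (val z) = 0.
Proof. by apply/eqP; have := valP z; rewrite unfold_in. Qed.

(** Composed with the cover, g is a cocycle; a cochain that bounds it is the extension. *)
Lemma Ext_extend n (M N : lmodType R) : is_zero_module (Ext n.+1 M N) ->
  forall g : {linear iter n.+1 (@syzygy R) M -> N},
  exists h : {linear res M n -> N}, forall z, h (val z) = g z.
Proof.
move=> E0 g; have [|f hf] := @linear_hom (res M n.+1) N (fun x => g (free_cover x)).
  by move=> a x y; rewrite !linearP.
have fP : f \in lker (@precomp _ _ _ N (res_diff M n.+1)).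
  rewrite unfold_in; apply/eqP/val_inj/funext => x /=.
  by rewrite hf /= syzygy_val_eq0 linear0.
have := E0 (quot_pi _ (Kernel fP)); rewrite -(linear0 (quot_pi _)) => /quot_pi_eq.
rewrite subr0 unfold_in /= => /asboolP[h hh].
have [h' hh'] := linear_map (hom_linear h); exists h' => z.
rewrite hh'; have := congr1 (fun k : hom _ _ => k << z >>) hh.
by rewrite /= hf /= free_cover_gen.
Qed.

End Projective.

(** * Ext read off from other resolutions *)

Section ExtComparison.
Variable R : comNzRingType.

Lemma syzygy_intro (M : lmodType R) (x : free_module R M) : free_cover x = 0 ->
  exists z : syzygy M, val z = x.
Proof.
move=> cx; have xP : x \in lker (@free_cover R M) by rewrite unfold_in; apply/eqP.
by exists (Kernel xP).
Qed.

Lemma syzygy_lift (M A : lmodType R) (w : {linear A -> free_module R M}) :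
  (forall x, free_cover (w x) = 0) -> exists v : {linear A -> syzygy M}, forall x, val (v x) = w x.
Proof.
move=> hw; apply: (@lift_injective _ A (syzygy M) (free_module R M) (val : {linear syzygy M -> free_module R M})).
  exact: val_inj.
by move=> x; have [z zx] := syzygy_intro (hw x); exists z.
Qed.

(* The standard resolution and the given complex are compared by chain maps  *)
(* phi, psi and a homotopy s from phi psi to the identity.                   *)
Lemma Ext2_extend (N K F G X : lmodType R) (j : {linear K -> F}) (T : {linear F -> G})
    (q : {linear G -> X}) :
  projective F -> projective G -> injective j -> exact j T -> exact T q ->
  (forall x, exists y, q y = x) -> is_zero_module (Ext 2 X N) ->
  forall g : {linear K -> N}, exists h : {linear F -> N}, forall z, h (j z) = g z.
Proof.
move=> prF prG injj exjT exTq surq E0 g.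
pose v1 : {linear syzygy X -> free_module R X} := val.
pose v2 : {linear syzygy (syzygy X) -> free_module R (syzygy X)} := val.
have Tj z : T (j z) = 0 by apply/exjT; exists z.
have qT x : q (T x) = 0 by apply/exTq; exists x.
have [psi0 hpsi0] := prG _ _ (@free_cover R X) q (fun y => ex_intro _ << q y >> (free_cover_gen (q y))).
have [|sg hsg] := @syzygy_lift X F (psi0 \o T).
  by move=> x /=; rewrite hpsi0 qT.
have [psi1 hpsi1] := prF _ _ (@free_cover R (syzygy X)) sg
  (fun y => ex_intro _ << sg y >> (free_cover_gen (sg y))).
have [phi0 hphi0] := @projective_free R X _ _ q (@free_cover R X) (fun y => surq _).
have [|phi1 hphi1] := @projective_free R (syzygy X) _ _ T
    (phi0 \o v1 \o @free_cover R (syzygy X)).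
  by move=> x; apply/exTq; rewrite /= hphi0; exact: syzygy_val_eq0.
have [|phi2 hphi2] := @lift_injective _ (syzygy (syzygy X)) _ _ j (phi1 \o v2) injj.
  by move=> z; apply/exjT; rewrite /= hphi1 /= syzygy_val_eq0 !linear0.
(* The homotopy: T s0 = phi0 psi0 - id and j s1 = phi1 psi1 - id - s0 T. *)
pose w0 : {linear G -> G} := (phi0 \o psi0) \- idfun.
have [|s0 hs0] := prG _ _ T w0.
  by move=> y; apply/exTq; rewrite /= linearB hphi0 hpsi0 subrr.
pose w1 : {linear F -> F} := (phi1 \o psi1) \- idfun \- (s0 \o T).
have psiT x : val (free_cover (psi1 x)) = psi0 (T x) by rewrite hpsi1 hsg.
have [|s1 hs1] := @lift_injective _ F _ _ j w1 injj.
  move=> x; apply/exjT; rewrite /= !linearB hs0 hphi1 /= /v1 /= psiT.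
  exact: subrr.
have [h hh] := @Ext_extend R 1 X N E0 (g \o phi2).
(* On j z the first term is g (phi2 z') with j z sent by psi1 to z', and s1 (j z) = phi2 z' - z. *)
pose h1 : {linear F -> N} := (h \o psi1) \- (g \o s1).
exists h1 => z; rewrite /h1 /=.
have [z' z'E] : exists z' : syzygy (syzygy X), val z' = psi1 (j z).
  by apply: syzygy_intro; apply: val_inj; rewrite /= psiT Tj linear0.
rewrite -z'E hh /= -linearB; congr (g _); apply: injj.
rewrite linearB hphi2 hs1 /= /v2 /= z'E Tj linear0 subr0.
by rewrite opprB addrCA subrr addr0.
Qed.

(** A cocycle is a map g on the standard syzygy. It is pulled back to K by psi, extended to P, and
    brought back by phi; the homotopy s = psi phi - id corrects the result. *)
Lemma Ext1_zero (N K P X : lmodType R) (j : {linear K -> P}) (q : {linear P -> X}) :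
  projective P -> injective j -> exact j q -> (forall x, exists y, q y = x) ->
  (forall g : {linear K -> N}, exists h : {linear P -> N}, forall z, h (j z) = g z) ->
  is_zero_module (Ext 1 X N).
Proof.
move=> prP injj exjq surq ext x; rewrite -(quot_repr x) -(linear0 (quot_pi _)).
set f := repr _; apply/quot_pi_eq; rewrite subr0 unfold_in; apply/asboolP.
have fP : val f \in lker (@precomp _ _ _ N (res_diff X 1)) by exact: valP.
set f0 := kernel_val f in fP *; have [f1 hf1] := linear_map (hom_linear f0).
have f1d y : f1 (res_diff X 1 y) = 0.
  rewrite hf1; move: fP; rewrite unfold_in => /eqP/(congr1 (fun k : hom _ _ => k y)).
  by [].
have [||g hg] := @lift_surjective _ (res X 1) (syzygy X) N (@free_cover R (syzygy X)) f1.
- by move=> z; exists << z >>; exact: free_cover_gen.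
- by move=> y /syzygy_intro[z <-]; rewrite -(free_cover_gen z) -[RHS](f1d << z >>).
have [psi hpsi] := prP _ _ (@free_cover R X) q (fun y => ex_intro _ << q y >> (free_cover_gen (q y))).
have [phi hphi] := @projective_free R X _ _ q (@free_cover R X) (fun y => surq _).
have [|psi1 hpsi1] := @syzygy_lift X K (psi \o j).
  by move=> u /=; rewrite hpsi; apply/exjq; exists u.
have [G hG] := ext (g \o psi1).
have [|s hs] := @syzygy_lift X (free_module R X) ((psi \o phi) \- idfun).
  by move=> y /=; rewrite linearB hpsi hphi subrr.
have [|h hh] := @linear_hom R (res X 0) N ((G \o phi) \- (g \o s)).
  by move=> a y z; rewrite linearP.
exists h; apply/val_inj/funext => y /=; rewrite hh /= -hf1 -hg.
have [z zE] : exists z, j z = phi (val (free_cover y)).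
  by apply/exjq; rewrite hphi; exact: syzygy_val_eq0.
rewrite -zE hG /= -linearB; congr (g _); apply: val_inj.
by rewrite /= hpsi1 hs /= zE opprB addrCA subrr addr0.
Qed.
End ExtComparison.

(** * The trace ideal *)

Section Trace.
Variable R : comUnitRingType.
Hypothesis noeth : noetherian_ideals R.
Hypothesis loc : local_ring R.
Hypothesis dim1 : krull_dim R 1.
Hypothesis red : reduced_ring R.

Lemma mem_max_smul (x : R) : (x : R^o) \in max_smul R^o <-> nonunit x.
Proof.
split=> [/asboolP h|ux]; last first.
  by apply/asboolP => S; apply; exists x, (1 : R^o); rewrite regular_scaleE mulr1.
have hN := submodule_ideal (ideal_nonunit loc).
apply/(mem_submod_of hN); apply: h => _ [a [w [ua ->]]].
by apply/(mem_submod_of hN); rewrite regular_scaleE mulrC; exact: nonunitM.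
Qed.

Lemma residue_field_neq0 : ~ is_zero_module (residue_field R).
Proof.
move=> h; have := h (quot_pi (max_smul R^o) 1).
rewrite -(linear0 (quot_pi (max_smul R^o))) => /quot_pi_eq; rewrite subr0 => /mem_max_smul.
by rewrite /nonunit unitr1.
Qed.

Lemma Ext1_residue_field (omega : lmodType R) :
  (forall phi : R^o -> omega, linear_on (nonunit (R := R) : R^o -> Prop) phi ->
     exists n, forall x : R, nonunit x -> phi x = x *: n) ->
  is_zero_module (Ext 1 (residue_field R) omega).
Proof.
move=> ext; have hN := submodule_ideal (ideal_nonunit loc).
apply: (Ext1_zero (j := submod_val hN) (q := quot_pi (max_smul R^o))).
- exact: projective_regular.
- exact: val_inj.
- move=> y; rewrite -(linear0 (quot_pi (max_smul R^o))).
  split=> [/quot_pi_eq|[x <-]].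
    by rewrite subr0 => /mem_max_smul/(submod_val_onto hN).
  by apply/quot_pi_eq; rewrite subr0; apply/mem_max_smul; exact: (submod_valP (hS := hN)).
- by move=> x; exists (repr x); exact: quot_repr.
move=> g; have [phi hphi] : exists phi : R^o -> omega, forall z, True -> phi (submod_val hN z) = g z.
  by apply: factor_fun => z z' _ _ /val_inj ->.
have [|n hn] := ext phi.
  move=> a x y /(submod_val_onto hN)[u <-] /(submod_val_onto hN)[v <-].
  by rewrite -linearP !hphi // linearP.
have [|h hh] := @linear_map _ R^o omega (fun r => r *: n).
  by move=> a x y; rewrite scalerDl scalerA.
exists h => z; rewrite hh -hn ?hphi //; exact: (submod_valP (hS := hN)).
Qed.

Section Presented.
Variables (M : lmodType R) (f : nat) (aug : {linear 'rV[R]_f -> M}).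
Hypothesis surj_aug : forall v, exists c, aug c = v.

Local Notation gen i := (aug (delta_mx 0 i)).

Lemma aug_sum c : aug c = \sum_i c 0 i *: gen i.
Proof.
by rewrite [in LHS](row_sum_delta c) linear_sum; apply: eq_bigr => i _; rewrite linearZ.
Qed.

(* The scalars of [End M] lying in the image of [M^* (x) M]. *)
Definition trace_scalar (r : R) : Prop := exists t : 'I_f -> {linear M -> R^o},
  forall v, r *: v = \sum_i t i v *: gen i.

Lemma ideal_trace_scalar : ideal trace_scalar.
Proof.
split; first by exists (fun=> \0) => v; rewrite scale0r big1 // => i _; rewrite scale0r.
move=> a x y [t ht] [u hu]; exists (fun i => (a \*: t i \+ u i)) => v.
rewrite scalerDl -scalerA ht hu scaler_sumr -big_split; apply: eq_bigr => i _ /=.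
by rewrite scalerDl scalerA.
Qed.

(* With [R_p] a field, a maximal subfamily of generators independent over it *)
(* yields dual functionals after multiplication by [b] and denominators.     *)
Lemma trace_scalar_prime (p : R -> Prop) b : prime_ideal p -> ~ p b ->
  (forall x, p x <-> x * b = 0) -> exists2 r, trace_scalar r & ~ p r.
Proof.
move=> [hp p1 pM] npb pb.
pose indep (I : {set 'I_f}) := `[< forall r : 'I_f -> R,
  \sum_(i in I) (r i * b) *: gen i = 0 -> forall i, i \in I -> p (r i) >].
have [|I /maxsetP[/asboolP indI maxI] _] := @maxset_exists _ indep finset.set0.
  by apply/asboolP => r _ i; rewrite finset.in_set0.
have /choice[s hs] j : exists t : R * ('I_f -> R), ~ p t.1 /\
    (t.1 * b) *: gen j = \sum_(i in I) (t.2 i * b) *: gen i.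
  have [jI|njI] := boolP (j \in I).
    exists (1, fun i => (i == j)%:R); split=> //=; rewrite (bigD1 j) //= eqxx big1 ?addr0 //.
    by move=> i /andP[_ /negPf ->]; rewrite mul0r scale0r.
  have : ~~ indep (j |: I).
    apply/negP => /maxI h; move: njI; rewrite -h ?setU11 //; exact: subsetU1.
  move=> /asboolP/existsNP[r] /not_implyP[]; rewrite big_setU1 //= => e hr.
  have npj : ~ p (r j).
    move=> pj; apply: hr => i; rewrite in_setU1 => /predU1P[->//|]; apply: indI.
    by move: e; rewrite (proj1 (pb _) pj) scale0r add0r.
  exists (r j, fun i => - r i); split=> //=; apply/eqP; rewrite -subr_eq0 -sumrN.
  by apply/eqP; rewrite -[RHS]e; congr (_ + _); apply: eq_bigr => i _; rewrite mulNr scaleNr opprK.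
pose S := \prod_j (s j).1.
have nS : ~ p S.
  by rewrite /S; elim/big_ind: _ => // [x y nx ny /pM[]//|j _]; case: (hs j).
pose c j i := \prod_(l | l != j) (s l).1 * (s j).2 i.
have hc j : (S * b) *: gen j = \sum_(i in I) (c j i * b) *: gen i.
  have -> : S * b = \prod_(l | l != j) (s l).1 * ((s j).1 * b) by rewrite /S (bigD1 j) //=; ring.
  rewrite -scalerA (hs j).2 scaler_sumr; apply: eq_bigr => i _.
  by rewrite scalerA mulrA.
exists (S * b); last by case/pM.
have /choice[t ht] i : exists t : {linear M -> R^o},
    forall x, t (aug x) = if i \in I then \sum_j x 0 j * (c j i * b) else 0.
  case: (boolP (i \in I)) => iI; last first.
    by exists \0 => x.
  have [|w hw] := @linear_map _ 'rV[R]_f R^o (fun x => \sum_j x 0 j * (c j i * b)).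
    move=> r x y; rewrite scaler_sumr -big_split; apply: eq_bigr => j _ /=.
    by rewrite !mxE mulrDl -mulrA.
  have [||t ht] := @lift_surjective _ _ _ _ aug w.
  - exact: surj_aug.
  - move=> x x0; rewrite hw.
    have : \sum_(i in I) ((\sum_j x 0 j * c j i) * b) *: gen i = 0.
      transitivity ((S * b) *: aug x); last by rewrite x0 scaler0.
      rewrite aug_sum scaler_sumr; under [RHS]eq_bigr => j _.
        rewrite scalerA mulrC -scalerA hc scaler_sumr; over.
      rewrite exchange_big; apply: eq_bigr => k _ /=.
      by rewrite mulr_suml scaler_suml; apply: eq_bigr => j _; rewrite scalerA mulrA.
    move/indI => /(_ i iI)/pb; rewrite mulr_suml => e; rewrite -[RHS]e.
    by apply: eq_bigr => j _; rewrite mulrA.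
  - by exists t => x; rewrite ht hw.
exists t => v; have [x <-] := surj_aug v.
rewrite {1}aug_sum scaler_sumr; under eq_bigr => j _.
  rewrite scalerA mulrC -scalerA hc scaler_sumr; over.
rewrite exchange_big [RHS](bigID (mem I)) /= [X in _ = _ + X]big1 ?addr0; last first.
  by move=> i /negPf iI; rewrite ht iI scale0r.
apply: eq_bigr => i iI; rewrite ht iI scaler_suml.
by apply: eq_bigr => j _; rewrite scalerA.
Qed.

(** For c <> 0 and a regular nonunit a, some prime misses c a. It is minimal since it misses a, so
    it misses a trace scalar r, and r c <> 0. *)
Lemma regular_trace_scalar : exists2 r, trace_scalar r & forall x, r * x = 0 -> x = 0.
Proof.
apply: exists_regular => //; first exact: ideal_trace_scalar.
move=> c c0; have [a ua rega] := exists_regular_nonunit noeth loc dim1 red.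
have zero_ideal : ideal (fun x : R => x = 0).
  by split=> // r x y -> ->; rewrite mulr0 addr0.
have [|p [hp _ npca]] := prime_radical (x := c * a) noeth zero_ideal.
  by move=> n /red; rewrite mulrC => /rega/eqP; rewrite (negPf c0).
have [idp _ pM] := hp.
have [|b [npb pb]] := minimal_prime noeth loc dim1 red ua hp.
  by move=> pa; apply: npca; exact: idealM.
have [r hr npr] := trace_scalar_prime hp npb pb; exists r => //.
apply/eqP => rc; have [] : p r \/ p c by apply: pM; rewrite rc; case: idp.
  by [].
by move=> pc; apply: npca; rewrite mulrC; exact: idealM.
Qed.

Section Extension.
Variable omega : lmodType R.
Hypothesis inj_omega : finite_injdim omega.
Hypothesis tf : torsionfree M.
(* Surjectivity of [M (x) Hom(M, omega) -> Hom(M^*, Hom(M, omega))]. *)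
Hypothesis dual_surj : forall xi : {linear hom M R^o -> hom M omega},
  exists n : 'I_f -> {linear M -> omega},
  forall phi v, xi phi v = \sum_i phi (gen i) *: n i v.

(** On pairs (r, t) where r c plus the endomorphism of t is 0, the map (r, t) -> phi r is defined
    and extends to all pairs. Its second component is a functional on sums of rank-one maps, which
    [dual_surj] expresses by elements of Hom(M, omega), and so it can be evaluated at -x c. *)
Lemma socle_extend c : (forall x, nonunit x -> trace_scalar (x * c)) -> ~ trace_scalar c ->
  forall phi : R^o -> omega, linear_on (nonunit (R := R) : R^o -> Prop) phi ->
  exists n, forall x : R, nonunit x -> phi x = x *: n.
Proof.
move=> mc nc phi hphi.
have [s [sg hsg] regs] := regular_trace_scalar.
(* [tau] sends T onto the sums of rank-one endomorphisms of M, and [act] adds multiples of c. *)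
pose T : lmodType R := {ffun 'I_f -> hom M R^o}.
pose tau (t : T) v := \sum_l t l v *: gen l.
pose P : lmodType R := (R^o * T)%type.
pose act (x : P) v := (x.1 * c) *: v + tau x.2 v.
have tauP a t t' v : tau (a *: t + t') v = a *: tau t v + tau t' v.
  rewrite scaler_sumr -big_split; apply: eq_bigr => l _ /=.
  by rewrite !ffunE scalerA -scalerDl.
have tau_lin t a v w : tau t (a *: v + w) = a *: tau t v + tau t w.
  rewrite scaler_sumr -big_split; apply: eq_bigr => l _ /=.
  by rewrite (hom_linear (t l)) scalerA -scalerDl.
have actP a x y v : act (a *: x + y) v = a *: act x v + act y v.
  by rewrite /act /= tauP scalerDr !scalerA mulrDl -mulrA scalerDl addrACA.
have act_lin x a v w : act x (a *: v + w) = a *: act x v + act x w.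
  by rewrite /act tau_lin !scalerDr !scalerA [_ * a]mulrC addrACA.
(* The maps [sg] evaluated on generators embed End M in a free module: they recover s v with s
   regular, and M is torsionfree. Hence ker [act] is cut out by functionals. *)
have /choice[u hu] (k : 'I_#|{: 'I_f * 'I_f}|) : exists u : {linear P -> R^o},
    forall x, u x = sg (enum_val k).1 (act x (gen (enum_val k).2)).
  have [|u hu] := @linear_map _ P R^o (fun x => sg (enum_val k).1 (act x (gen (enum_val k).2))).
    by move=> a x y; rewrite actP linearP.
  by exists u.
have ker_act x : (forall k, u k x = 0) <-> forall v, act x v = 0.
  split=> [ux v|ax k]; last by rewrite hu ax linear0.
  have gen0 j : act x (gen j) = 0.
    apply: (tf (a := s)).
      by move=> y z e; apply/eqP; rewrite -subr_eq0; apply/eqP; apply: regs; rewrite mulrBr e subrr.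
    rewrite hsg big1 // => i _; have := ux (enum_rank (i, j)).
    by rewrite hu enum_rankK /= => ->; rewrite scale0r.
  have [y <-] := surj_aug v; have [|a0 ha0] := @linear_map _ M M (act x).
    by move=> a w z; exact: act_lin.
  rewrite -ha0 aug_sum linear_sum big1 // => j _.
  by rewrite linearZ /= ha0 gen0 scaler0.
(* A unit first component would make c a trace scalar, so phi applies on ker [act]. *)
have ker_nonunit x : (forall v, act x v = 0) -> nonunit x.1.
  move=> ax; apply/negP => ux; apply: nc.
  have : trace_scalar (x.1 * c).
    exists (fun l => (\- hom_lin (x.2 l)) : {linear M -> R^o}) => v.
    move: (ax v) => /eqP; rewrite addr_eq0 => /eqP ->; rewrite -sumrN.
    by apply: eq_bigr => l _; rewrite -scaleNr.
  by move/(idealM x.1^-1 ideal_trace_scalar); rewrite mulKr.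
have [|G hG] := @extend_from_kernel R noeth loc dim1 red omega inj_omega P _ u (fun x => phi x.1).
  by move=> a x y /ker_act/ker_nonunit ux /ker_act/ker_nonunit uy; rewrite -hphi.
pose n0 := G (1, 0); pose chi (t : T) := G (0, t).
have chiP a t t' : chi (a *: t + t') = a *: chi t + chi t'.
  rewrite /chi; have -> : (0, a *: t + t') = a *: (0, t) + (0, t') :> P.
    by apply: injective_projections => //=; rewrite addr0; exact/esym/mulr0.
  exact: linearP.
have phi0 : phi 0 = 0.
  by apply: (linear_on0 (submodule_ideal (ideal_nonunit loc)) hphi).
have phiE r t : (forall v, act (r, t) v = 0) -> phi r = r *: n0 + chi t.
  move=> /ker_act/hG <-; rewrite /n0 /chi; have -> : (r, t) = r *: (1, 0) + (0, t) :> P.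
    apply: injective_projections => /=; last by rewrite scaler0 add0r.
    by rewrite addr0; exact/esym/mulr1.
  exact: linearP.
have chi_tau t t' : (forall v, tau t v = tau t' v) -> chi t = chi t'.
  move=> e; have h : 0 = -1 *: chi t' + chi t.
    have := @phiE 0 (-1 *: t' + t); rewrite phi0 scale0r add0r chiP; apply=> v.
    by rewrite /act mul0r scale0r add0r /= tauP e scaleN1r addNr.
  by apply/eqP; rewrite -subr_eq0 addrC -scaleN1r -h.
have /choice[rho hrho] := surj_aug.
(* The value of chi at the rank-one map w -> phi'(w) v; it is linear in v because chi depends only
   on [tau]. *)
pose b (phi' : hom M R^o) v := chi [ffun l => rho v 0 l *: phi'].
have tau_b phi' v w : tau [ffun l => rho v 0 l *: phi'] w = phi' w *: v.
  rewrite /tau -[in RHS](hrho v) aug_sum scaler_sumr; apply: eq_bigr => l _.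
  by rewrite ffunE scalerA mulrC.
have b_lin phi' : linear (b phi').
  move=> a v w; rewrite /b -chiP; apply: chi_tau => z.
  by rewrite tauP !tau_b scalerDr !scalerA mulrC.
have /choice[xi0 hxi0] : forall phi' : hom M R^o, exists h : hom M omega, forall v, h v = b phi' v.
  by move=> phi'; apply: linear_hom; exact: b_lin.
have [|xi hxi] := @linear_map _ (hom M R^o) (hom M omega) xi0.
  move=> a p q; apply/val_inj/funext => v; rewrite /= hxi0.
  rewrite -[RHS]/(a *: (xi0 p v) + xi0 q v) !hxi0 -chiP /b; congr chi.
  by apply/ffunP => l; rewrite !ffunE scalerDr !scalerA mulrC.
have [n hn] := dual_surj xi.
(* For [tau] t = -x c, expanding chi t over rank-one maps gives the sum of the n_i ([tau] t (gen
   i)), that is -x c times the sum of the n_i (gen i). *)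
exists (n0 - c *: \sum_i n i (gen i)) => x ux.
have [t0 ht0] := mc x ux.
have /choice[t1 ht1] : forall l, exists h : hom M R^o, forall v, h v = - t0 l v.
  by move=> l; apply: linear_hom => a v w; rewrite linearP opprD scalerN.
pose t : T := [ffun l => t1 l].
have tauE v : tau t v = - ((x * c) *: v).
  by rewrite ht0 -sumrN; apply: eq_bigr => l _; rewrite ffunE ht1 scaleNr.
rewrite (@phiE x t) => [|v]; last by rewrite /act /= tauE subrr.
rewrite scalerBr scalerA; congr (_ + _).
transitivity (\sum_l b (t l) (gen l)).
  have [|chi' hchi] := @linear_map _ T omega chi; first by move=> a v w; exact: chiP.
  rewrite /b; under eq_bigr do rewrite -hchi.
  rewrite -linear_sum hchi; apply: chi_tau => w.
  have [|tau' htau] := @linear_map _ T M (fun t => tau t w); first by move=> a v z; exact: tauP.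
  rewrite -[RHS]htau linear_sum; apply: eq_bigr => l _.
  by rewrite htau tau_b.
rewrite scaler_sumr -sumrN.
under eq_bigr => l _ do rewrite -hxi0 -hxi hn.
rewrite exchange_big; apply: eq_bigr => i _ /=.
rewrite -linearZ -linearN -tauE linear_sum; apply: eq_bigr => l _.
exact/esym/linearZ.
Qed.

Lemma trace_scalar1 : ~ is_zero_module (Ext 1 (residue_field R) omega) -> trace_scalar 1.
Proof.
move=> nE; apply: contrapT => n1; apply: nE.
have [s hs regs] := regular_trace_scalar.
have [c [nc mc]] := socle noeth loc dim1 regs ideal_trace_scalar n1 hs.
by apply: Ext1_residue_field; exact: socle_extend mc nc.
Qed.

End Extension.

End Presented.
End Trace.

(** * From the vanishing of Ext to regularity *)

Section Regularity.
Variable R : comUnitRingType.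

(** [Ext2_extend] for the dualized presentation extends xi to the dual of R^f, which is free on the
    coordinate functionals; the n_i are their images. *)
Lemma transpose_dual_surj (M N omega : lmodType R) (F : min_presentation M) :
  lmod_iso N (hom M omega) -> is_zero_module (Ext 2 (transpose F) N) ->
  forall xi : {linear hom M R^o -> hom M omega},
  exists n : 'I_(pres_f F) -> {linear M -> omega},
  forall phi v, xi phi v = \sum_i phi (pres_aug F (delta_mx 0 i)) *: n i v.
Proof.
move=> [th [th' thK thK']] E0 xi.
have [|xi' hxi'] := @lift_injective _ _ N _ th xi (can_inj thK).
  by move=> phi; exists (th' (xi phi)).
have [||||||h hh] := @Ext2_extend R N _ _ _ _ (@precomp _ _ _ R^o (pres_aug F))
    (@precomp _ _ _ R^o (pres_map F)) (quot_pi (limage (@precomp _ _ _ R^o (pres_map F))))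
    _ _ _ _ _ _ E0 xi'.
- exact: projective_dual_row.
- exact: projective_dual_row.
- move=> p q pq; apply/val_inj/funext => v; have [x <-] := pres_surj F v.
  exact: (congr1 (fun k : hom _ _ => k x) pq).
- move=> y; split=> [y0|[x <-]]; last first.
    apply/val_inj/funext => u /=; have -> : pres_aug F (pres_map F u) = 0.
      by apply/pres_exact; exists u.
    exact: (linear0 (hom_lin x)).
  have [||x hx] := @lift_surjective _ _ _ _ (pres_aug F) (hom_lin y).
  + exact: pres_surj.
  + by move=> u /pres_exact[z <-]; exact: (congr1 (fun k : hom _ _ => k z) y0).
  have [|x' hx'] := @linear_hom _ M R^o x; first by move=> a u v; rewrite linearP.
  by exists x'; apply/val_inj/funext => u /=; rewrite hx' hx.
- move=> y; rewrite -(linear0 (quot_pi _)); split=> [/quot_pi_eq|[x <-]].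
    by rewrite subr0 => /asboolP.
  by apply/quot_pi_eq; rewrite subr0; apply/asboolP; exists x.
- by move=> x; exists (repr x); exact: quot_repr.
have /choice[e he] : forall i : 'I_(pres_f F), exists e : hom 'rV[R]_(pres_f F) R^o,
    forall x, e x = x 0 i.
  by move=> i; apply: linear_hom => a x y; rewrite !mxE.
exists (fun i => hom_lin (th (h (e i)))) => phi v.
have -> : xi phi = th (h (precomp (pres_aug F) phi)) by rewrite hh hxi'.
have -> : precomp (pres_aug F) phi = \sum_i phi (pres_aug F (delta_mx 0 i)) *: e i.
  apply/val_inj/funext => x; rewrite [RHS]hom_sumE /=.
  rewrite [in LHS](row_sum_delta x) linear_sum -[LHS]/(hom_lin phi _) linear_sum.
  apply: eq_bigr => i _; rewrite !linearZ /= -[RHS]/(_ * _) he mulrC.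
  by [].
rewrite !linear_sum hom_sumE; apply: eq_bigr => i _.
by rewrite !linearZ.
Qed.

(** Trace scalar 1 gives functionals t_i forming a dual basis of M. If f is not in K then d f is not
    in mM, so some t_i (d f) is a unit, and t_i d divided by it is a derivation taking f to 1. *)
Lemma regular_of_cotangent (M N omega : lmodType R) (F : min_presentation M) (d : R -> M) :
  noetherian_ideals R -> local_ring R -> krull_dim R 1 -> reduced_ring R ->
  (forall n, n.+1%:R \is a @GRing.unit R) ->
  canonical_module omega -> torsionfree M ->
  (forall x y, d (x + y) = d x + d y) -> (forall x y, d (x * y) = x *: d y + y *: d x) ->
  (forall (f : R) (K : R -> Prop), nonunit f -> ideal K ->
     (forall y z : R, nonunit y -> nonunit z -> K (y * z)) -> d f \in max_smul M -> K f) ->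
  lmod_iso N (hom M omega) -> is_zero_module (Ext 2 (transpose F) N) ->
  regular_local R.
Proof.
move=> noeth loc dim1 red char0 [n [dimn _ _ [th [th' thK thK']] idim]] tf dD dM cot isoN E0.
rewrite (krull_dim_unique dimn dim1) in th th' thK thK'.
have nE : ~ is_zero_module (Ext 1 (residue_field R) omega).
  by move=> E1; apply: (@residue_field_neq0 R loc) => x; rewrite -(thK' x) (E1 (th' x)) linear0.
have [t ht] := trace_scalar1 noeth loc dim1 red (pres_surj F) idim tf (transpose_dual_surj isoN E0) nE.
apply: regular_of_leibniz => // f K uf hK mK nKf.
have : exists i, t i (d f) \is a GRing.unit.
  apply: contrapT => /forallNP hn; apply: nKf; apply: cot => //.
  rewrite -[d f]scale1r ht; apply: rpred_sum => i _.
  apply/asboolP => S; apply; exists (t i (d f)), (pres_aug F (delta_mx 0 i)).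
  by split=> //; apply/negP.
move=> [i ui]; exists (fun x => (t i (d f))^-1 * t i (d x)); last by rewrite mulVr.
split=> x y; first by rewrite dD linearD mulrDr.
rewrite dM linearP linearZ /= [_ *: t i (d y)]regular_scaleE [_ *: t i (d x)]regular_scaleE.
by ring.
Qed.

End Regularity.

(** * Noetherianity of polynomial and power series rings *)

Lemma fg_of_seq (R : comNzRingType) (J : R -> Prop) (s : seq R) : ideal J ->
  (forall x, x \in s -> J x) ->
  (forall K, ideal K -> (forall x, x \in s -> K x) -> forall y, J y -> K y) -> fg_ideal J.
Proof.
move=> hJ Js gen; exists (size s), (fun i => s`_i) => a; split; last first.
  by move=> [c ->]; apply: ideal_sum => // i; apply: Js; exact: mem_nth.
apply: (gen (fun a => exists c : 'I_(size s) -> R, a = \sum_i c i * s`_i)) => [|x xs].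
  split; first by exists (fun=> 0); rewrite big1 // => i _; rewrite mul0r.
  move=> b _ _ [c ->] [e ->]; exists (fun i => b * c i + e i).
  rewrite mulr_sumr -big_split; apply: eq_bigr => i _ /=.
  by rewrite mulrDl mulrA.
exists (fun i : 'I_(size s) => (i == index x s :> nat)%:R).
have xi : (index x s < size s)%N by rewrite index_mem.
rewrite (bigD1 (Ordinal xi)) //= eqxx mul1r nth_index // big1 ?addr0 // => i.
by rewrite -val_eqE /= => /negPf ->; rewrite mul0r.
Qed.

Lemma noetherian_surj (A B : comNzRingType) (h : {rmorphism A -> B}) :
  (forall y, exists x, h x = y) -> noetherian_ideals A -> noetherian_ideals B.
Proof.
move=> surj noeth J hJ; have [|n [x hx]] := noeth (fun a => J (h a)).
  by split=> [|a u v Ju Jv]; rewrite ?rmorph0 ?rmorphD ?rmorphM; [case: hJ|exact: hJ.2].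
exists n, (h \o x) => b; split=> [Jb|[c ->]].
  have [a ab] := surj b; have /hx[c ac] : J (h a) by rewrite ab.
  exists (h \o c); rewrite -ab ac rmorph_sum; apply: eq_bigr => i _.
  exact: rmorphM.
apply: ideal_sum => // i; apply/hx; exists (fun j => (j == i)%:R).
by rewrite (bigD1 i) //= eqxx mul1r big1 ?addr0 // => j /negPf ->; rewrite mul0r.
Qed.

(** * Dickson's lemma *)

Section Dickson.

Lemma monotone_subsequence (s : nat -> nat) : exists g : nat -> nat,
  (forall i j, (i < j)%N -> (g i < g j)%N) /\ forall i j, (i <= j)%N -> (s (g i) <= s (g j))%N.
Proof.
(* [mu N] is a position where s attains its minimum from N on. *)
have /choice[mu hmu] : forall N, exists m, (N <= m)%N /\ forall m', (N <= m')%N -> (s m <= s m')%N.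
  move=> N; have ex : exists v, `[< exists2 m, (N <= m)%N & s m = v >].
    by exists (s N); apply/asboolP; exists N.
  have [v /asboolP[m Nm <-] vmin] := ex_minnP ex.
  by exists m; split=> // m' Nm'; apply: vmin; apply/asboolP; exists m'.
pose g := fix g n := if n is n'.+1 then mu (g n').+1 else mu 0.
have gS n : (g n < g n.+1)%N by have [] := hmu (g n).+1.
have gh i j : (i < j)%N -> (g i < g j)%N by apply: (homo_ltn ltn_trans gS).
exists g; split; first exact: gh.
move=> i j; rewrite leq_eqVlt => /predU1P[->//|ij].
case: i ij => [_|i ij]; first by apply: (hmu 0).2.
apply: (hmu _).2; apply: (@leq_trans (g i.+1)); first exact: gS.
exact/ltnW/gh.
Qed.

Variable n : nat.

Lemma dickson_subsequence (l : seq 'I_n) (s : nat -> 'X_{1..n}) : exists g : nat -> nat,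
  (forall i j, (i < j)%N -> (g i < g j)%N) /\
  forall i j c, (i <= j)%N -> c \in l -> (s (g i) c <= s (g j) c)%N.
Proof.
elim: l s => [|c l IH] s; first by exists id.
have [g [gi gs]] := monotone_subsequence (fun i => s i c).
have [h [hi hs]] := IH (s \o g); exists (g \o h); split=> [i j /hi/gi//|i j c' ij].
have hij : (h i <= h j)%N.
  by move: ij; rewrite leq_eqVlt => /predU1P[->//|/hi/ltnW].
by rewrite in_cons => /predU1P[->|/hs]; [exact: gs|exact].
Qed.

(** Otherwise a sequence in A arises in which no term divides a later one, but it has a subsequence
    monotone in every coordinate. *)
Lemma dickson_basis (A : 'X_{1..n} -> Prop) : exists l : seq 'X_{1..n},
  (forall u, u \in l -> A u) /\ forall m, A m -> exists2 u, u \in l & (u <= m)%MM.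
Proof.
apply: contrapT => hn.
have step (l : {l : seq 'X_{1..n} | forall u, u \in l -> A u}) :
    {m | A m & forall u, u \in sval l -> ~ (u <= m)%MM}.
  apply: cid2; case: l => l hl /=; apply: contrapT => hm; apply: hn; exists l; split=> // m Am.
  by apply: contrapT => hu; apply: hm; exists m => // u ul um; apply: hu; exists u.
have ext l : forall u, u \in s2val (step l) :: sval l -> A u.
  by move=> u; rewrite in_cons => /predU1P[->|]; [exact: (s2valP (step l))|exact: (svalP l)].
pose L := fix L i := if i is i'.+1 then exist _ _ (ext (L i'))
  else exist (fun l => forall u, u \in l -> A u) [::] (fun u (h : u \in [::]) => False_ind _ (notF h)).
pose s i := s2val (step (L i)).
have sL i j : (i < j)%N -> s i \in sval (L j).
  elim: j => // j IH; rewrite ltnS leq_eqVlt => /predU1P[->|/IH h] /=; first exact: mem_head.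
  by rewrite in_cons h orbT.
have [g [gi gs]] := dickson_subsequence (enum 'I_n) s.
apply: (s2valP' (step (L (g 1%N))) (s (g 0%N)) (sL _ _ (gi 0%N 1%N isT))).
by apply/mnm_lepP => c; apply: gs => //; rewrite mem_enum.
Qed.

End Dickson.

(** Elements of J whose leading monomials form a Dickson basis generate J, by induction on the
    leading monomial. *)
Lemma noetherian_mpoly (k : fieldType) n : noetherian_ideals {mpoly k[n]}.
Proof.
move=> J hJ; have [l [lA lP]] := dickson_basis (fun m => exists f, [/\ J f, f != 0 & mlead f = m]).
have /choice[F hF] : forall u, exists f, u \in l -> [/\ J f, f != 0 & mlead f = u].
  move=> u; case: (boolP (u \in l)) => [/lA[f hf]|nu]; first by exists f.
  by exists 0.
apply: (@fg_of_seq _ _ [seq F u | u <- l]) => // [_ /mapP[u ul ->]|K hK KF f].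
  by case: (hF u ul).
elim/mleadrect: f => f IH Jf; set m := mlead f in IH.
have [->|f0] := eqVneq f 0; first by case: hK.
have [|u ul um] := lP m; first by exists f.
have [JF F0 Fu] := hF u ul.
pose g := (mleadc f / mleadc (F u)) *: 'X_[m - u] * F u.
have lF : mleadc (F u) != 0 by rewrite mleadc_eq0.
have lf : mleadc f != 0 by rewrite mleadc_eq0.
have X0 : ('X_[m - u] : {mpoly k[n]}) != 0 by rewrite -msupp_eq0 msuppX.
have gm : mlead g = m.
  rewrite /g -scalerAl mleadZ; last by rewrite mulf_neq0 ?invr_eq0.
  by rewrite mleadM // mleadXm Fu submK.
have Kg : K g by apply: idealM => //; apply: KF; exact: map_f.
have Jg : J g by exact: idealM.
rewrite -[f](subrK g); apply: idealD => //.
have [->|fg0] := eqVneq (f - g) 0; first by case: hK.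
apply: IH; last exact: idealB.
rewrite lt_neqAle (le_trans (mleadB_le _ _)) ?gm ?joinxx // andbT.
apply/eqP => e; move: fg0; rewrite -mleadc_eq0 e mcoeffB.
have -> : g@_m = f@_m.
  rewrite /g -scalerAl mcoeffZ -[X in _ * (_)@_X = _](submK um) mleadcMW ?mleadXm ?Fu //.
  have Fuu : (F u)@_u != 0 by move: lF; rewrite Fu.
  by rewrite mcoeffX eqxx mul1r ?Fu divfK.
by rewrite subrr eqxx.
Qed.

(** * Arithmetic of power series *)

Section PowerSeries.
Variables (k : fieldType) (n : nat).
Implicit Types f g h : powser k n.

Lemma psD f g m : (f + g) m = f m + g m. Proof. by []. Qed.
Lemma psB f g m : (f - g) m = f m - g m. Proof. by []. Qed.
Lemma psZ (c : k) f m : (c *: f) m = c * f m. Proof. by []. Qed.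
Lemma ps0 m : (0 : powser k n) m = 0. Proof. by []. Qed.
Lemma ps1 m : (1 : powser k n) m = (m == 0%MM)%:R. Proof. by []. Qed.
Lemma psM f g m : (f * g) m =
  \sum_(u : 'X_{1..n < (mdeg m).+1, (mdeg m).+1} | m == (u.1 + u.2)%MM) f u.1 * g u.2.
Proof. by []. Qed.
Lemma ps_sum (I : Type) (r : seq I) (P : pred I) (F : I -> powser k n) m :
  (\sum_(i <- r | P i) F i) m = \sum_(i <- r | P i) F i m.
Proof. by elim/big_rec2: _ => [|i x y _ <-]; rewrite ?ps0 ?psD. Qed.

Definition ps_agree d f g : Prop := forall m, (mdeg m < d)%N -> f m = g m.

Lemma ps_agreeM d f f' g g' : ps_agree d f f' -> ps_agree d g g' -> ps_agree d (f * g) (f' * g').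
Proof.
move=> ff' gg' m md; rewrite !psM; apply: eq_bigr => u _.
by rewrite ff' ?gg' //; apply: leq_trans (bmdeg _) md.
Qed.

Lemma ps_agreeD d f f' g g' : ps_agree d f f' -> ps_agree d g g' -> ps_agree d (f + g) (f' + g').
Proof. by move=> ff' gg' m md; rewrite !psD ff' ?gg'. Qed.

Lemma ps_agree_refl d f : ps_agree d f f. Proof. by []. Qed.

Lemma ps_agree_eq f g : (forall d, ps_agree d f g) -> f = g.
Proof. by move=> fg; apply/funext => m; exact: (fg (mdeg m).+1). Qed.

Definition ps_of (p : {mpoly k[n]}) : powser k n := fun m => p@_m.

Lemma ps_ofM p q : ps_of (p * q) = ps_of p * ps_of q.
Proof.
apply/funext => m; rewrite psM /ps_of mcoeffM; exact: eq_bigr.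
Qed.

Definition ps_trunc d f : {mpoly k[n]} := \sum_(m : 'X_{1..n < d}) f m *: 'X_[m].

Lemma ps_truncP d f : ps_agree d f (ps_of (ps_trunc d f)).
Proof. by move=> m md; rewrite /ps_of mcoeff_mpoly. Qed.

(** Reduced to polynomials by truncation; a derivative loses one degree, hence the precision d +
    1. *)
Lemma ps_derivM i f g : ps_deriv i (f * g) = ps_deriv i f * g + f * ps_deriv i g.
Proof.
have deriv_agree d p q : ps_agree d.+1 p q -> ps_agree d (ps_deriv i p) (ps_deriv i q).
  by move=> pq m md; rewrite /ps_deriv pq // mdegD mdeg1 addn1 ltnS.
have derivE p : ps_deriv i (ps_of p) = ps_of p^`M(i).
  by apply/funext => m; rewrite /ps_deriv /ps_of mcoeff_mderiv.
apply: ps_agree_eq => d.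
have fP := @ps_truncP d.+1 f; have gP := @ps_truncP d.+1 g.
have f'P := deriv_agree _ _ _ fP; have g'P := deriv_agree _ _ _ gP.
have le p q : ps_agree d.+1 p q -> ps_agree d p q by move=> pq m md; apply: pq; exact: ltnW.
move=> m md; rewrite (deriv_agree _ _ _ (ps_agreeM fP gP)) // -ps_ofM derivE mderivM.
rewrite (ps_agreeD (ps_agreeM f'P (le _ _ gP)) (ps_agreeM (le _ _ fP) g'P)) //.
by rewrite !derivE -!ps_ofM /ps_of mcoeffD psD.
Qed.

Lemma ps_derivD i f g : ps_deriv i (f + g) = ps_deriv i f + ps_deriv i g.
Proof. by apply/funext => m; rewrite /ps_deriv psD mulrnDl. Qed.

Definition psX (w : 'X_{1..n}) : powser k n := fun m => (m == w)%:R.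

Lemma psXE w : psX w = ps_of 'X_[w].
Proof. by apply/funext => m; rewrite /psX /ps_of mcoeffX eq_sym. Qed.

Lemma psXM w f m : (psX w * f) m = if (w <= m)%MM then f (m - w)%MM else 0.
Proof.
rewrite psM; case: ifP => wm; last first.
  rewrite big1 // => u /eqP mE; rewrite /psX; case: eqP => [uw|_]; last by rewrite mul0r.
  by rewrite mE -uw lem_addr in wm.
have mw : (mdeg w < (mdeg m).+1)%N by rewrite ltnS -(submK wm) mdegD leq_addl.
have mmw : (mdeg (m - w)%MM < (mdeg m).+1)%N by rewrite ltnS mdegB.
rewrite (bigD1 (BMultinom mw, BMultinom mmw)) /=; last by rewrite addmC submK.
rewrite /psX eqxx mul1r big1 ?addr0 // => -[u v] /andP[/eqP/= mE ne].
case: eqP => [uw|_]; last by rewrite mul0r.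
case/eqP: ne; congr (_, _); apply/val_inj => //=; apply: (@addmI _ w).
by rewrite -{1}uw -mE addmC submK.
Qed.

Lemma psXD u w : psX (u + w) = psX u * psX w.
Proof. by rewrite !psXE mpolyXD ps_ofM. Qed.

Lemma psX_exp i N : psX (U_(i) *+ N) = psX U_(i) ^+ N.
Proof.
elim: N => [|N IH]; first by rewrite mulm0n expr0; apply/funext => m.
by rewrite mulmS psXD IH exprS.
Qed.

Lemma ps_derivX i j : ps_deriv i (psX U_(j)) = (i == j)%:R.
Proof.
apply/funext => m; rewrite /ps_deriv /psX; case: (eqVneq i j) => [<-|ij].
  rewrite -[X in _ == X]add0m eqm_add2r mulr1n [RHS]ps1.
  by case: eqVneq => [->|_]; rewrite ?mul0rn // mnm0E.
rewrite mulr0n ps0; case: eqP => [/mnmP/(_ i)|_]; last by rewrite mul0rn.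
by rewrite mnmDE !mnm1E eqxx eq_sym (negPf ij) addn1.
Qed.

(** A monomial with some exponent at least N is assigned to one such index i; the others have degree
    at most n N and form a polynomial. *)
Lemma ps_decompose N f : exists (p : {mpoly k[n]}) (g : 'I_n -> powser k n),
  f = ps_of p + \sum_i psX U_(i) ^+ N * g i /\ forall m, p@_m != 0 -> forall i, (m i < N)%N.
Proof.
pose big (m : 'X_{1..n}) := [pick i : 'I_n | (N <= m i)%N].
pose p : {mpoly k[n]} := \sum_(m : 'X_{1..n < (n * N).+1} | big m == None) f m *: 'X_[m].
have small m : big m = None -> (mdeg m < (n * N).+1)%N /\ forall i, (m i < N)%N.
  rewrite /big; case: pickP => // hm _; split=> [|i]; last by rewrite ltnNge hm.
  rewrite ltnS mdegE; apply: (@leq_trans (\sum_(i < n) N)).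
    by apply: leq_sum => i _; apply: ltnW; rewrite ltnNge hm.
  by rewrite sum_nat_const card_ord.
have pE m : p@_m = if big m == None then f m else 0.
  rewrite /p raddf_sum /=; under eq_bigr do rewrite mcoeffZ mcoeffX.
  case: eqP => [/[dup] bm /small[md _]|nbm].
    rewrite (bigD1 (BMultinom md)) /= ?bm // eqxx mulr1 big1 ?addr0 // => u /andP[_ ne].
    case: eqP => [um|]; last by rewrite mulr0.
    by case/eqP: ne; exact/val_inj.
  rewrite big1 // => u /eqP bu; case: eqP => [um|]; last by rewrite mulr0.
  by rewrite -um in nbm.
exists p, (fun i m => if big (m + U_(i) *+ N)%MM == Some i then f (m + U_(i) *+ N)%MM else 0).
split; last by move=> m; rewrite pE; case: (big m =P None) => [/small[_ h] _|_ /eqP].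
apply/funext => m; rewrite psD ps_sum /ps_of pE.
case bm: (big m) => [i|] /=; last first.
  rewrite big1 ?addr0 // => i _; rewrite -psX_exp psXM; case: ifP => // le.
  by rewrite submK // bm.
rewrite add0r (bigD1 i) //= big1 ?addr0 => [|j ji]; rewrite -psX_exp psXM; last first.
  case: ifP => // le; rewrite submK // bm; case: eqP => // -[ij].
  by rewrite ij eqxx in ji.
have -> : (U_(i) *+ N <= m)%MM.
  apply/mnm_lepP => j; rewrite mulmnE mnm1E; case: eqVneq => [<-|_]; rewrite ?mul0n // mul1n.
  by move: bm; rewrite /big; case: pickP => // x hx [<-].
rewrite submK ?bm ?eqxx //.
apply/mnm_lepP => j; rewrite mulmnE mnm1E; case: eqVneq => [<-|_]; rewrite ?mul0n // mul1n.
by move: bm; rewrite /big; case: pickP => // x hx [<-].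
Qed.

End PowerSeries.

(** * Units and division of power series *)

Section PowerSeriesRing.
Variables (k : fieldType) (n : nat).
Implicit Types f g h : powser k n.

Lemma psM0 f g : (f * g) 0%MM = f 0%MM * g 0%MM.
Proof.
have h0 : (mdeg (0%MM : 'X_{1..n}) < (mdeg (0%MM : 'X_{1..n})).+1)%N by [].
rewrite psM (bigD1 (BMultinom h0, BMultinom h0)) /=; last by rewrite addm0.
rewrite big1 ?addr0 // => -[u v] /andP[/=]; rewrite eq_sym mnmD_eq0 => /andP[/eqP u0 /eqP v0].
by case/eqP; congr (_, _); exact/val_inj.
Qed.

Lemma psX_small h j m : h 0%MM = 0 -> (mdeg m < j)%N -> (h ^+ j) m = 0.
Proof.
move=> h0; elim: j m => // j IH m mj; rewrite exprS psM big1 // => u /eqP mE.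
have [->|u0] := eqVneq (u.1 : 'X_{1..n}) 0%MM; first by rewrite h0 mul0r.
have mdE : (mdeg m = mdeg u.1 + mdeg u.2)%N by rewrite -mdegD -mE.
have lt (a b c : nat) : c = (a + b)%N -> a != 0%N -> (c < j.+1)%N -> (b < j)%N by lia.
by rewrite IH ?mulr0 //; apply: lt mdE _ mj; rewrite mdeg_eq0.
Qed.

Lemma ps_unit f : f 0%MM != 0 -> exists g, f * g = 1.
Proof.
move=> f0; pose h : powser k n := 1 - (f 0%MM)^-1 *: f.
have h0 : h 0%MM = 0 by rewrite /h psB psZ ps1 eqxx mulVf // subrr.
pose g : powser k n := fun m => \sum_(j < (mdeg m).+1) (h ^+ j) m.
have gP d : ps_agree d g (\sum_(j < d) h ^+ j).
  move=> m md; rewrite ps_sum -(big_mkord xpredT (fun j => (h ^+ j) m)).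
  rewrite (@big_cat_nat _ _ _ (mdeg m).+1 0 d) //= big_mkord [X in _ + X]big_nat_cond.
  by rewrite [X in _ + X]big1 ?addr0 // => j /andP[/andP[jm _] _]; exact: psX_small.
exists ((f 0%MM)^-1 *: g); rewrite -scalerAr scalerAl.
have -> : (f 0%MM)^-1 *: f = 1 - h by rewrite /h opprB addrCA subrr addr0.
apply: ps_agree_eq => d m md.
rewrite (ps_agreeM (@ps_agree_refl _ _ d _) (gP d)) //.
have -> : (1 - h) * (\sum_(j < d) h ^+ j) = 1 - h ^+ d.
  by rewrite -opprB mulNr -subrX1 opprB.
by rewrite psB psX_small // subr0.
Qed.

Section Division.
Variables (s : nat) (F : 'I_s -> powser k n) (U : 'I_s -> 'X_{1..n}).
Hypothesis F1 : forall i, F i (U i) = 1.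
Hypothesis F0 : forall i m, (m < U i)%O -> F i m = 0.
Variable J : powser k n -> Prop.
Hypothesis hJ : ideal J.
Hypothesis JF : forall i, J (F i).
Hypothesis JU : forall f, J f -> forall u, f u != 0 -> (forall m, (m < u)%O -> f m = 0) ->
  exists i, (U i <= u)%MM.

Lemma ps_least f : f != 0 -> exists2 u, f u != 0 & forall m, (m < u)%O -> f m = 0.
Proof.
move=> f0; apply: contrapT => hn; case/eqP: f0; apply/funext => m.
elim/(well_founded_ind (@ltom_wf n)): m => m IH.
by apply/eqP; apply: contrapT => /negP fm; apply: hn; exists m.
Qed.

(** Initial monomials are the least ones for the degree-compatible order. Those of degree d are
    cancelled one by one, with coefficients of order at least d - deg (U i). *)
Lemma ps_division_step d f : J f -> (forall m, (mdeg m < d)%N -> f m = 0) ->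
  exists c : 'I_s -> powser k n,
    (forall i m, (mdeg m + mdeg (U i) < d)%N -> c i m = 0) /\
    forall m, (mdeg m <= d)%N -> (f - \sum_i c i * F i) m = 0.
Proof.
(* The monomials of degree at most d not below the initial one; their number drops at each
   cancellation. *)
pose A f := [set m : 'X_{1..n < d.+1} | ~~ `[< forall m' : 'X_{1..n}, (m' <= (m : 'X_{1..n}))%O -> f m' = 0 >]].
move: {2}#|A f| (leqnn #|A f|) => N; elim: N f => [|N IH] f fN Jf fd.
  exists (fun=> 0); split=> // m md; rewrite big1 => [|i _]; last by rewrite mul0r.
  rewrite subr0; move: fN; rewrite leqn0 cards_eq0 => /eqP A0.
  have : BMultinom (md : (mdeg m < d.+1)%N) \notin A f by rewrite A0 finset.in_set0.
  by rewrite finset.in_set negbK => /asboolP; apply.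
have [[m md fm]|hn] := EM (exists2 m, (mdeg m <= d)%N & f m != 0); last first.
  exists (fun=> 0); split=> // m md; rewrite big1 => [|i _]; last by rewrite mul0r.
  by rewrite subr0; apply/eqP; apply: contrapT => /negP fm; apply: hn; exists m.
have [|u fu umin] := @ps_least f; first by apply: contra fm => /eqP ->.
have um : (u <= m)%O by rewrite leNgt; apply/negP => /umin/eqP; rewrite (negPf fm).
have ud : (mdeg u <= d)%N := leq_trans (lemc_mdeg um) md.
have du : (d <= mdeg u)%N by rewrite leqNgt; apply/negP => /fd/eqP; rewrite (negPf fu).
have [i iu] := JU Jf fu umin.
pose c0 := f u *: psX k (u - U i)%MM.
pose f' := f - c0 * F i.
have c0F m' : (c0 * F i) m' = if (u - U i <= m')%MM then f u * F i (m' - (u - U i))%MM else 0.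
  by rewrite /c0 -scalerAl psZ psXM; case: ifP; rewrite ?mulr0.
have f'0 m' : (m' <= u)%O -> f' m' = 0.
  rewrite le_eqVlt => /predU1P[->|m'u]; rewrite /f' psB c0F.
    rewrite lem_subr; have -> : (u - (u - U i) = U i)%MM.
      by apply: (@addmI _ (u - U i)%MM); rewrite addmC submK ?lem_subr // submK.
    by rewrite F1 mulr1 subrr.
  rewrite umin // sub0r; case: ifP => [le|_]; last by rewrite oppr0.
  rewrite F0 ?mulr0 ?oppr0 //.
  by rewrite -(ltmc_add2l _ _ (u - U i)%MM) submK // addmC submK.
have Jf' : J f' by apply: idealB => //; apply: idealM.
have [|//|m' m'd|c' [c'0 c'P]] := IH f'.
- rewrite -ltnS; apply: leq_trans fN; apply: proper_card; apply/properP; split.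
    apply/fintype.subsetP => v; rewrite !finset.in_set; apply: contra => /asboolP fv.
    apply/asboolP => w wv; have [wu|uw] := leP w u; first exact: f'0.
    by case/eqP: fu; apply: fv; exact: le_trans (ltW uw) wv.
  exists (BMultinom (ud : (mdeg u < d.+1)%N)); rewrite finset.in_set.
    by apply/asboolP => /(_ u (lexx _)) /eqP; rewrite (negPf fu).
  by rewrite negbK; apply/asboolP.
- by apply: f'0; apply/ltW/lt_mdeg_ltmc; exact: leq_trans du.
exists (fun j => (if j == i then c0 else 0) + c' j); split=> [j m' m'd|m' m'd].
  rewrite psD c'0 // addr0; case: eqP => // ji; rewrite /c0 psZ /psX; case: eqP => [m'E|]; last by rewrite mulr0.
  by move: m'd; rewrite ji m'E -mdegD submK // ltnNge du.
rewrite -[RHS](c'P _ m'd) /f' -addrA -opprD; congr ((_ - _) _).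
under eq_bigr do rewrite mulrDl; rewrite big_split /=; congr (_ + _).
rewrite (bigD1 i) //= eqxx big1 ?addr0 // => j /negPf ->.
by rewrite mul0r.
Qed.

(** The degreewise corrections are summed; by their order only those with d <= deg m + deg (U i)
    contribute at m, so each coefficient is a finite sum. *)
Lemma ps_division f : J f -> exists c : 'I_s -> powser k n, f = \sum_i c i * F i.
Proof.
move=> Jf.
have /choice[C hC] : forall df : nat * powser k n, exists c : 'I_s -> powser k n,
    J df.2 -> (forall m, (mdeg m < df.1)%N -> df.2 m = 0) ->
    (forall i m, (mdeg m + mdeg (U i) < df.1)%N -> c i m = 0) /\
    forall m, (mdeg m <= df.1)%N -> (df.2 - \sum_i c i * F i) m = 0.
  move=> [d g]; have [h|h] := EM (J g /\ forall m, (mdeg m < d)%N -> g m = 0).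
    by have [c hc] := ps_division_step h.1 h.2; exists c.
  by exists (fun=> 0) => Jg gd; case: h.
pose fs := fix fs d := if d is d'.+1 then fs d' - \sum_i C (d', fs d') i * F i else f.
pose cs d := C (d, fs d).
have fsP d : J (fs d) /\ forall m, (mdeg m < d)%N -> fs d m = 0.
  elim: d => [//|d [Jd d0]]; split; last by move=> m; rewrite ltnS => md; apply: (hC (d, fs d) Jd d0).2.
  by apply: idealB => //; apply: ideal_sum.
have csP d i m : (mdeg m + mdeg (U i) < d)%N -> cs d i m = 0.
  by have [Jd d0] := fsP d; exact: (hC (d, fs d) Jd d0).1.
have fE N : f = fs N + \sum_i (\sum_(d < N) cs d i) * F i.
  elim: N => [|N IH]; first by rewrite big1 ?addr0 // => i _; rewrite big_ord0 mul0r.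
  have -> : \sum_i (\sum_(d < N.+1) cs d i) * F i =
      \sum_i cs N i * F i + \sum_i (\sum_(d < N) cs d i) * F i.
    by rewrite -big_split; apply: eq_bigr => i _; rewrite big_ord_recr /= addrC mulrDl.
  by rewrite addrA subrK.
exists (fun i m => \sum_(d < (mdeg m + mdeg (U i)).+1) cs d i m).
apply/funext => m; pose N := (mdeg m + \sum_i mdeg (U i)).+1.
rewrite {1}(fE N) psD (fsP N).2 ?add0r; last by rewrite ltnS leq_addr.
rewrite !ps_sum; apply: eq_bigr => i _.
apply: (@ps_agreeM _ _ (mdeg m).+1) => // m' m'm; rewrite ps_sum.
rewrite -(big_mkord xpredT (fun d => cs d i m')).
rewrite (@big_cat_nat _ _ _ (mdeg m' + mdeg (U i)).+1 0 N) //=; last first.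
  rewrite ltnS; apply: leq_add; first by rewrite -ltnS.
  by rewrite (bigD1 i) //= leq_addr.
rewrite big_mkord [X in _ + X]big_nat_cond [X in _ + X]big1 ?addr0 // => d /andP[/andP[md _] _].
exact: csP.
Qed.

End Division.

Lemma noetherian_powser : noetherian_ideals (powser k n).
Proof.
move=> J hJ.
have [l [lA lP]] := dickson_basis (fun u => exists f, [/\ J f, f u = 1 & forall m, (m < u)%O -> f m = 0]).
have /choice[F hF] : forall i : 'I_(size l), exists f, [/\ J f, f (nth 0%MM l i) = 1 & forall m, (m < (nth 0%MM l i))%O -> f m = 0].
  by move=> i; apply: lA; exact: mem_nth.
have JU f : J f -> forall u, f u != 0 -> (forall m, (m < u)%O -> f m = 0) ->
    exists i : 'I_(size l), ((nth 0%MM l i) <= u)%MM.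
  move=> Jf u fu umin; have [|v vl vu] := lP u.
    exists ((f u)^-1 *: f); split.
    - by rewrite -[f]mul1r scalerAl; exact: idealM.
    - by rewrite psZ mulVf.
    - by move=> m mu; rewrite psZ (umin m mu) mulr0.
  have vi : (index v l < size l)%N by rewrite index_mem.
  by exists (Ordinal vi); rewrite /= nth_index.
exists (size l), F => f; split=> [Jf|[c ->]]; last by apply: ideal_sum => // i; case: (hF i).
apply: (@ps_division _ F (fun i => (nth 0%MM l i)) _ _ J) => //.
- by move=> i; case: (hF i).
- by move=> i m; case: (hF i) => _ _; apply.
- by move=> i; case: (hF i).
Qed.

End PowerSeriesRing.

(** * Coefficient rings *)

Lemma horner_taylor2 (R : comNzRingType) (p : {poly R}) (a h : R) :
  exists e, p.[a + h] = p.[a] + p^`().[a] * h + e * (h * h).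
Proof.
elim/poly_ind: p => [|p c [e IH]].
  by exists 0; rewrite deriv0 !horner0 !mul0r !addr0.
exists (p^`().[a] + e * a + e * h).
rewrite derivD derivM derivX derivC addr0 mulr1 !hornerD !hornerMX !hornerC IH; ring.
Qed.

Section CoefficientRing.
Variables (k : fieldType) (R : comUnitAlgType k).
Hypothesis loc : local_ring R.
Hypothesis char0 : forall n, n.+1%:R \is a @GRing.unit R.
Variable K : R -> Prop.
Hypothesis hK : ideal K.
Hypothesis K1 : ~ K 1.
Hypothesis Km : forall y z : R, nonunit y -> nonunit z -> K (y * z).

(* The subrings of which a maximal one maps onto the residue field. *)
Definition transversal_ring (S : R -> Prop) : Prop :=
  [/\ [/\ S 1, forall x y, S x -> S y -> S (x - y) & forall x y, S x -> S y -> S (x * y)],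
      forall c : k, S c%:A, forall x, K x -> S x & forall x, S x -> nonunit x -> K x].

Lemma nonunitB (x y : R) : nonunit x -> nonunit y -> nonunit (x - y).
Proof. by move=> ux uy; apply: loc => //; rewrite -mulN1r; exact: nonunitM. Qed.

Lemma nonunit_ideal x : K x -> nonunit x.
Proof. exact: proper_nonunit. Qed.

Lemma transversal_ring_base : transversal_ring (fun x => exists c y, K y /\ x = c%:A + y).
Proof.
split; [split| | |].
- by exists 1, 0; rewrite scale1r addr0; case: hK.
- move=> _ _ [c [y [Ky ->]]] [e [z [Kz ->]]]; exists (c - e), (y - z).
  by split; [exact: idealB|rewrite scalerBl opprD addrACA].
- move=> _ _ [c [y [Ky ->]]] [e [z [Kz ->]]]; exists (c * e), (c%:A * z + (e%:A + z) * y).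
  split; first by apply: idealD => //; exact: idealM.
  by rewrite -[(c * e)%:A]scalerA -[c *: e%:A]mulr_algl; ring.
- by move=> c; exists c, 0; rewrite addr0; case: hK.
- by move=> x Kx; exists 0, x; rewrite scale0r add0r.
- move=> _ [c [y [Ky ->]]] u; have [->|c0] := eqVneq c 0; first by rewrite scale0r add0r.
  exfalso; have : nonunit (c%:A : R) by rewrite -(addrK y c%:A); apply: nonunitB => //; exact: nonunit_ideal.
  by rewrite /nonunit scaler_unit ?unitfE // unitr1.
Qed.

Section RingTheory.
Variable S : R -> Prop.
Hypothesis hS : transversal_ring S.

Lemma transversal0 : S 0.
Proof. by case: hS => -[S1 SB _] _ _ _; rewrite -(subrr 1); exact: SB. Qed.

Lemma transversalN x : S x -> S (- x).
Proof. by case: hS => -[_ SB _] _ _ _ Sx; rewrite -sub0r; apply: SB => //; exact: transversal0. Qed.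

Lemma transversalD x y : S x -> S y -> S (x + y).
Proof. by case: (hS) => -[_ SB _] _ _ _ Sx Sy; rewrite -[y]opprK; apply: SB => //; exact: transversalN. Qed.

Lemma transversal_sum n (F : 'I_n -> R) : (forall i, S (F i)) -> S (\sum_i F i).
Proof. by move=> SF; elim/big_ind: _ => //; [exact: transversal0|exact: transversalD]. Qed.

Definition coefs_in (p : {poly R}) : Prop := forall i, S p`_i.

Lemma coefs_inB p q : coefs_in p -> coefs_in q -> coefs_in (p - q).
Proof. by case: (hS) => -[_ SB _] _ _ _ Sp Sq i; rewrite coefB; exact: SB. Qed.

Lemma coefs_inM p q : coefs_in p -> coefs_in q -> coefs_in (p * q).
Proof.
by case: (hS) => -[_ _ SM] _ _ _ Sp Sq i; rewrite coefM; apply: transversal_sum => j; exact: SM.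
Qed.

Lemma coefs_inC c : S c -> coefs_in c%:P.
Proof. by move=> Sc i; rewrite coefC; case: eqP => // _; exact: transversal0. Qed.

Lemma coefs_inX n : coefs_in 'X^n.
Proof.
move=> i; rewrite coefXn; case: (i == n); first by case: (hS) => -[].
exact: transversal0.
Qed.

Lemma transversal_adjoin a :
  (forall p, coefs_in p -> nonunit p.[a] -> K p.[a]) ->
  transversal_ring (fun x => exists2 p, coefs_in p & x = p.[a]).
Proof.
move=> ha; case: (hS) => -[S1 _ _] Sk KS _; split; [split| | |].
- by exists 1%:P; [exact: coefs_inC|rewrite hornerC].
- move=> _ _ [p Sp ->] [q Sq ->]; exists (p - q); first exact: coefs_inB.
  by rewrite hornerD hornerN.
- move=> _ _ [p Sp ->] [q Sq ->]; exists (p * q); first exact: coefs_inM.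
  by rewrite hornerM.
- by move=> c; exists c%:A%:P; [exact: coefs_inC|rewrite hornerC].
- by move=> x Kx; exists x%:P; [exact/coefs_inC/KS|rewrite hornerC].
- by move=> _ [p Sp ->]; exact: ha.
Qed.

End RingTheory.

(** A maximal transversal ring S works. If the residue of a were missing, S could be enlarged: by a
    when a is transcendental over the residue field of S, and otherwise by a Hensel lift of a, for
    which one Newton step suffices as K contains m^2. *)
Lemma coefficient_ring : exists2 S, transversal_ring S &
  forall r : R, exists2 s, S s & nonunit (r - s).
Proof.
have [|S [hS Smax]] := @Zorn_bigcup R (fun S => transversal_ring S \/ S = set0).
- move=> F FP tot; have [[S0 FS0 tS0]|hn] := EM (exists2 S, F S & transversal_ring S); last first.
    right; apply/seteqP; split=> // x [S FS Sx]; case: (FP _ FS) => [tS|S0].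
      by case: hn; exists S.
    by rewrite S0 in Sx.
  have ub A B x y : F A -> F B -> A x -> B y -> exists C, [/\ transversal_ring C, F C, C x & C y].
    move=> FA FB Ax By; have tr C z : F C -> C z -> transversal_ring C.
      by move=> FC Cz; case: (FP _ FC) => // C0; rewrite C0 in Cz.
    case: (tot _ _ FA FB) => h; [exists B|exists A]; split=> //; try exact: h.
      exact: tr By.
    exact: tr Ax.
  left; case: (tS0) => -[S01 _ _] S0k S0K _; split; [split| | |].
  + by exists S0.
  + move=> x y [A FA Ax] [B FB By]; have [C [[[_ CB _] _ _ _] FC Cx Cy]] := ub _ _ _ _ FA FB Ax By.
    by exists C => //; exact: CB.
  + move=> x y [A FA Ax] [B FB By]; have [C [[[_ _ CM] _ _ _] FC Cx Cy]] := ub _ _ _ _ FA FB Ax By.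
    by exists C => //; exact: CM.
  + by move=> c; exists S0.
  + by move=> x Kx; exists S0 => //; exact: S0K.
  + by move=> x [A FA Ax]; have [C [[_ _ _ CK] FC Cx _]] := ub _ _ _ _ FA FA Ax Ax; exact: CK.
have tS : transversal_ring S.
  case: hS => // S0; exfalso; apply: (Smax _ _ (or_introl transversal_ring_base)).
  rewrite S0; split=> // /(_ 0); apply.
  by exists 0, 0; rewrite scale0r addr0; case: hK.
have [[S1 SB SM] Sk KS SK] := tS.
have Smaxi S' : transversal_ring S' -> (forall x, S x -> S' x) -> forall x, S' x -> S x.
  move=> tS' SS' x S'x; apply: contrapT => nSx; apply: (Smax S'); last by left.
  by split=> // /(_ _ S'x).
have Sinv s : S s -> s \is a GRing.unit -> S s^-1.
  move=> Ss us; apply: (Smaxi (fun x => exists x1 t, [/\ S x1, S t, t \is a GRing.unit & x = x1 / t])).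
  - split; [split| | |].
    + by exists 1, 1; rewrite divr1 unitr1.
    + move=> _ _ [x [t [Sx St ut ->]]] [y [u [Sy Su uu ->]]].
      exists (x * u - y * t), (t * u); split; [by apply: SB; apply: SM|exact: SM|by rewrite unitrM ut|].
      by rewrite invrM // mulrBl; congr (_ - _); [|rewrite [u^-1 / t]mulrC]; rewrite mulrA mulrK.
    + move=> _ _ [x [t [Sx St ut ->]]] [y [u [Sy Su uu ->]]].
      exists (x * y), (t * u); split; [exact: SM|exact: SM|by rewrite unitrM ut|].
      by rewrite invrM // [u^-1 / t]mulrC mulrACA.
    + by move=> c; exists c%:A, 1; rewrite divr1 unitr1.
    + by move=> x /KS Sx; exists x, 1; rewrite divr1 unitr1.
    + move=> _ [x [t [Sx St ut ->]]] ux; rewrite mulrC; apply: idealM => //; apply: SK => //.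
      by rewrite -(divrK ut x) mulrC; exact: nonunitM.
  - by move=> x Sx; exists x, 1; rewrite divr1 unitr1.
  - by exists 1, s; rewrite mul1r.
exists S => // a; apply: contrapT => hn.
have far b : nonunit (b - a) -> ~ S b.
  by move=> ub Sb; apply: hn; exists b => //; rewrite -opprB -mulN1r; exact: nonunitM.
have adj b : nonunit (b - a) ->
    ~ (forall p, coefs_in S p -> nonunit p.[b] -> K p.[b]).
  move=> ub /(transversal_adjoin tS) tSb; apply: (far _ ub); apply: (Smaxi _ tSb).
    by move=> x Sx; exists x%:P; [exact: coefs_inC|rewrite hornerC].
  by exists 'X; [exact: (coefs_inX tS 1)|rewrite hornerX].
have smallK (p : {poly R}) b : coefs_in S p -> (forall i, nonunit p`_i) -> K p.[b].
  move=> Sp up; rewrite horner_coef; elim/big_ind: _ => [|x y|i _].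
  - by case: hK.
  - exact: idealD.
  - by rewrite mulrC; apply: idealM => //; exact: SK.
(* Nontrivial relations of the residue of a over the residue field of S; a shortest one plays the
   role of the minimal polynomial. *)
pose bad (p : {poly R}) := [/\ coefs_in S p, nonunit p.[a] & exists i, p`_i \is a GRing.unit].
have [p0 bp0] : exists p, bad p.
  apply: contrapT => nb; apply: (adj a); first by rewrite subrr; exact: nonunit0.
  move=> p Sp up; apply: smallK => // i; apply/negP => ui; apply: nb; exists p.
  by split=> //; exists i.
have [N] : exists N, (exists2 p, bad p & size p = N) /\ forall q, bad q -> (N <= size q)%N.
  have ex : exists N, `[< exists2 p, bad p & size p = N >].
    by exists (size p0); apply/asboolP; exists p0.
  have [N /asboolP hN Nmin] := ex_minnP ex; exists N; split=> // q bq.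
  by apply: Nmin; apply/asboolP; exists q.
case=> -[p [Sp up [i0 ui0]] sp] pmin.
have small q : coefs_in S q -> nonunit q.[a] -> (size q < N)%N -> forall i, nonunit q`_i.
  move=> Sq uq sq i; apply/negP => ui; have /pmin : bad q by split=> //; exists i.
  by rewrite leqNgt sq.
have ulc : lead_coef p \is a GRing.unit.
  apply: contrapT => /negP nlc.
  have sp0 : (0 < size p)%N.
    by rewrite lt0n size_poly_eq0; apply: contraTN ui0 => /eqP ->; rewrite coef0 unitr0.
  pose q := p - lead_coef p *: 'X^((size p).-1).
  have qE i : q`_i = if i == (size p).-1 then 0 else p`_i.
    rewrite coefB coefZ coefXn; case: eqP => [->|_]; last by rewrite mulr0 subr0.
    by rewrite mulr1 lead_coefE subrr.
  have sq : (size q < N)%N.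
    rewrite -sp -(prednK sp0) ltnS; apply/leq_sizeP => j; rewrite leq_eqVlt => /predU1P[<-|h].
      by rewrite qE eqxx.
    by rewrite qE gtn_eqF // nth_default // -(prednK sp0).
  have Sq : coefs_in S q.
    by move=> i; rewrite qE; case: eqP => // _; exact: transversal0.
  have uq : nonunit q.[a].
    rewrite hornerD hornerN hornerZ; apply: nonunitB => //.
    by rewrite mulrC; exact: nonunitM.
  have := small _ Sq uq sq i0; rewrite qE; case: eqP => [e|_].
    by move: nlc; rewrite lead_coefE -e ui0.
  by rewrite /nonunit ui0.
pose p1 := (lead_coef p)^-1 *: p.
have Sp1 : coefs_in S p1.
  by move=> i; rewrite coefZ; apply: SM => //; apply: Sinv => //; exact: Sp.
have sp1 : size p1 = N.
  apply/eqP; rewrite eqn_leq -{1}sp size_scale_leq /=; apply: pmin.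
  split=> //; first by rewrite hornerZ; exact: nonunitM.
  by exists i0; rewrite coefZ unitrM unitrV ulc.
have monp1 : p1`_N.-1 = 1 by rewrite coefZ -sp -lead_coefE mulVr.
have up1 : nonunit p1.[a] by rewrite hornerZ; exact: nonunitM.
have N2 : (1 < N)%N.
  case: N sp1 monp1 {sp pmin small} => [|[|//]] sp1 monp1.
    by move/eqP: sp1; rewrite size_poly_eq0 => /eqP e; rewrite e coef0 in monp1; move/esym/eqP: monp1; rewrite oner_eq0.
  by move: up1; rewrite (size1_polyC (eq_leq sp1)) hornerC monp1 /nonunit unitr1.
have Sd : coefs_in S p1^`().
  move=> i; rewrite coef_deriv; move: (p1`_i.+1) (Sp1 i.+1) => x Sx.
  elim: i.+1 => [|j IH]; first exact: transversal0.
  by rewrite mulrS; apply: transversalD.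
(* Separability: p1' is shorter and its top coefficient N - 1 is a unit in characteristic zero. *)
have ud : p1^`().[a] \is a GRing.unit.
  apply: contrapT => /negP nd; have sd : (size p1^`() < N)%N.
    by rewrite -sp1 lt_size_deriv // -size_poly_eq0 sp1 -lt0n (ltnW N2).
  have := small _ Sd nd sd N.-2; rewrite coef_deriv.
  have -> : N.-2.+1 = N.-1 by case: N N2 {sp pmin small sp1 monp1 sd} => [|[]].
  rewrite monp1; have -> : N.-1 = N.-2.+1 by case: N N2 {sp pmin small sp1 monp1 sd} => [|[]].
  by rewrite /nonunit char0.
pose h := - (p1.[a] / p1^`().[a]).
have uh : nonunit h by rewrite /h -mulrN mulrC; exact: nonunitM.
have Kp1 : K p1.[a + h].
  have [e ->] := horner_taylor2 p1 a h.
  have -> : p1.[a] + p1^`().[a] * h = 0 by rewrite /h mulrN mulrCA divrr // mulr1 subrr.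
  by rewrite add0r; apply: idealM => //; exact: Km.
apply: (adj (a + h)); first by rewrite addrC addKr.
(* r is the remainder of g modulo the monic p1. If its value is a nonunit, minimality of N puts its
   coefficients in m, hence in K. *)
move=> g Sg; suff [r [Sr sr Kgr]] : exists r, [/\ coefs_in S r, (size r < N)%N & K (g.[a + h] - r.[a + h])].
  move=> ug; rewrite -(subrK r.[a + h] g.[a + h]); apply: idealD => //.
  apply: smallK => //; apply: small => //.
  have [e re] := horner_taylor2 r a h.
  have -> : r.[a] = g.[a + h] - (g.[a + h] - r.[a + h]) - (r^`().[a] + e * h) * h by rewrite re; ring.
  by apply: nonunitB; [apply: nonunitB => //; exact: nonunit_ideal|exact: nonunitM].
have [M gM] := ubnP (size g); elim: M g Sg gM => // M IH g Sg gM.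
have [gN|Ng] := ltnP (size g) N; first by exists g; rewrite subrr; split=> //; case: hK.
pose g1 := g - (lead_coef g)%:P * 'X^(size g - N) * p1.
have sg0 : (0 < size g)%N := leq_trans (ltnW N2) Ng.
have SX : coefs_in S ((lead_coef g)%:P * 'X^(size g - N)).
  by apply: coefs_inM => //; [apply: coefs_inC => //; exact: Sg|exact: coefs_inX].
have Sg1 : coefs_in S g1 by apply: coefs_inB => //; apply: coefs_inM.
have sg1 : (size g1 < M)%N.
  rewrite -ltnS; apply: leq_trans gM; rewrite ltnS -(prednK sg0) ltnS.
  have cE j : ((lead_coef g)%:P * 'X^(size g - N) * p1)`_j =
      lead_coef g * (if (j < size g - N)%N then 0 else p1`_(j - (size g - N))).
    by rewrite -mulrA coefCM coefXnM.
  apply/leq_sizeP => j hj; rewrite coefB cE.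
  have jN : (j < size g - N)%N = false by move: hj N2 Ng; clear; lia.
  rewrite jN; move: hj; rewrite leq_eqVlt => /predU1P[<-|hj].
    have -> : ((size g).-1 - (size g - N) = N.-1)%N by move: N2 Ng; clear; lia.
    by rewrite monp1 mulr1 lead_coefE subrr.
  have h1 : (size g <= j)%N by move: hj sg0; clear; lia.
  have h2 : (size p1 <= j - (size g - N))%N by rewrite sp1; move: h1 N2 Ng; clear; lia.
  by rewrite (nth_default _ h1) (nth_default _ h2) mulr0 subr0.
have [r [Sr sr Kr]] := IH g1 Sg1 sg1; exists r; split=> //.
have -> : g.[a + h] - r.[a + h] =
    g1.[a + h] - r.[a + h] + ((lead_coef g)%:P * 'X^(size g - N)).[a + h] * p1.[a + h].
  by rewrite /g1 hornerD hornerN hornerM; ring.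
by apply: idealD => //; exact: idealM.
Qed.

End CoefficientRing.

(** * Localizations and universal derivations *)

Lemma span_ind (R : comNzRingType) (M : lmodType R) (X : M -> Prop) (S : M -> Prop) v :
  submodule S -> (forall x, X x -> S x) -> v \in span X -> S v.
Proof.
move=> hS XS /asboolP h; apply/(mem_submod_of hS); apply: h => x /XS Sx.
exact/(mem_submod_of hS).
Qed.

Lemma lmod_iso_sym (R : comNzRingType) (A B : lmodType R) (g : {linear A -> B}) :
  injective g -> (forall b, exists a, g a = b) -> lmod_iso B A.
Proof.
move=> injg surg; have [h hh] := lift_injective (w := idfun) injg surg.
by exists h; exists g => x; [exact: hh|apply: injg; exact: hh].
Qed.

Definition invertible (A : comNzRingType) (x : A) : Prop := exists y, x * y = 1.

Lemma invertible_unit (R : comUnitRingType) (x : R) : invertible x <-> x \is a GRing.unit.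
Proof.
split=> [[y xy]|ux]; last by exists x^-1; exact: divrr.
by apply/unitrP; exists y; rewrite mulrC.
Qed.

Lemma invertibleMl (A : comNzRingType) (x y : A) : invertible (x * y) -> invertible x.
Proof. by move=> [z]; rewrite -mulrA => h; exists (y * z). Qed.

Lemma invertible_rmorph (A B : comNzRingType) (h : {rmorphism A -> B}) x :
  invertible x -> invertible (h x).
Proof. by move=> [y xy]; exists (h y); rewrite -rmorphM xy rmorph1. Qed.

Section LocalSurjection.
Variables (A : comNzRingType) (R : comUnitRingType) (h : {rmorphism A -> R}).
Hypothesis surj : forall y, exists x, h x = y.
Hypothesis locA : forall x y : A, invertible (x + y) -> invertible x \/ invertible y.

(** If w lifts the inverse of h x, one of x w and 1 - x w is invertible, and the latter maps to
    0. *)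
Lemma local_surj_unit x : h x \is a GRing.unit -> invertible x.
Proof.
move=> ux; have [w hw] := surj (h x)^-1.
have : invertible (x * w + (1 - x * w)) by exists 1; rewrite mulr1 addrC subrK.
move/locA => [/invertibleMl//|/(invertible_rmorph h)].
by rewrite rmorphB rmorphM rmorph1 hw divrr // subrr => -[y]; rewrite mul0r => /esym/eqP; rewrite oner_eq0.
Qed.

Lemma local_surj : local_ring R.
Proof.
move=> x y ux uy; apply/negP.
have [x' hx] := surj x; have [y' hy] := surj y.
rewrite -hx -hy -rmorphD => /local_surj_unit/locA[] /(invertible_rmorph h)/invertible_unit.
  by rewrite hx; apply/negP.
by rewrite hy; apply/negP.
Qed.

End LocalSurjection.

Lemma char0_unit (k : fieldType) (R : comUnitAlgType k) : [pchar k] =i pred0 ->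
  forall n, n.+1%:R \is a @GRing.unit R.
Proof.
move=> ch n; have -> : n.+1%:R = (n.+1%:R : k)%:A :> R by rewrite scaler_nat.
rewrite scaler_unit ?unitr1 // unitfE; apply/negP => n0.
by have [p] := natf0_pchar (ltn0Sn n) n0; rewrite ch.
Qed.

Section Localization.
Variables (k : fieldType) (A : comAlgType k) (q : prime_idealr A) (L : comUnitAlgType k).
Variable iota : {lrmorphism A -> L}.
Hypothesis loc : is_localization q iota.

Lemma localization_invertible a s : s \notin q -> (invertible (iota a / iota s) <-> a \notin q).
Proof.
case: loc => uq fr ker sq; rewrite invertible_unit; split=> [ua|/uq ua]; last first.
  by rewrite unitrM unitrV ua uq.
apply/negP => aq; have [b [t [tq ht]]] := fr (iota a / iota s)^-1.
have e : iota (a * b - s * t) = 0.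
  rewrite rmorphB /= !rmorphM /=; apply/eqP; rewrite subr_eq0; apply/eqP.
  have us := uq _ sq; have ut := uq _ tq.
  have -> : iota b = (iota a / iota s)^-1 * iota t by rewrite ht divrK.
  have uia : iota a \is a GRing.unit by rewrite -(divrK us (iota a)) unitrM ua.
  by rewrite invrM ?unitrV // invrK mulrA [iota s / _]mulrC mulrA divrr // mul1r.
have [u uq' /(congr1 (fun x => x \in q))] := ker _ e.
rewrite (rpred0 q) prime_idealrM (negPf uq') /= => /idP abst.
have : s * t \in q.
  by rewrite -[s * t](subKr (a * b)) rpredB // mulrC idealMr.
by rewrite prime_idealrM (negPf sq) (negPf tq).
Qed.

Lemma localization_local (x y : L) : invertible (x + y) -> invertible x \/ invertible y.
Proof.
case: (loc) => uq fr _; have [a [s [sq ->]]] := fr x; have [b [t [tq ->]]] := fr y.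
have us := uq _ sq; have ut := uq _ tq.
have -> : iota a / iota s + iota b / iota t = iota (a * t + b * s) / iota (s * t).
  rewrite rmorphD !rmorphM invrM // mulrDl; congr (_ + _).
    by rewrite mulrA mulrK.
  by rewrite [(iota t)^-1 * _]mulrC mulrA mulrK.
rewrite !localization_invertible ?prime_idealrM ?negb_or ?sq // => h.
have [aq|] := boolP (a \in q); last by left.
by right; apply: contra h => bq; rewrite rpredD // mulrC idealMr.
Qed.

Lemma localization_noetherian : noetherian_ideals A -> noetherian_ideals L.
Proof.
move=> noeth J hJ; have [|n [x hx]] := noeth (fun a => J (iota a)).
  by split=> [|a u v Ju Jv]; rewrite ?rmorph0 ?rmorphD ?rmorphM; [case: hJ|exact: hJ.2].
case: (loc) => uq fr _.
exists n, (iota \o x) => z; split=> [Jz|[c ->]].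
  have [a [s [sq zE]]] := fr z; have us := uq _ sq.
  have /hx[c ac] : J (iota a) by rewrite -(divrK us (iota a)) -zE mulrC; exact: idealM.
  exists (fun i => iota (c i) / iota s); rewrite zE ac rmorph_sum mulr_suml.
  by apply: eq_bigr => i _; rewrite rmorphM mulrAC.
apply: ideal_sum => // i; apply/hx; exists (fun j => (j == i)%:R).
by rewrite (bigD1 i) //= eqxx mul1r big1 ?addr0 // => j /negPf ->; rewrite mul0r.
Qed.

End Localization.

(** * Kaehler differentials *)

Section UniversalDerivation.
Variables (k : fieldType) (R : comUnitAlgType k) (M : lmodType R) (d : R -> M).
Hypothesis ud : universal_derivation d.

Lemma Der_linear (N : lmodType R) (D : Der N) : derivation D.
Proof. by have /asboolP := valP D. Qed.

Lemma derivation_comp (N : lmodType R) (h : {linear M -> N}) : derivation (h \o d).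
Proof.
case: ud => -[dD dM dk] _; split=> /= [x y|x y|c]; first by rewrite dD linearD.
  by rewrite dM linearD !linearZ.
by rewrite dk linear0.
Qed.

Lemma universal_derivation_iso (N : lmodType R) : lmod_iso (Der N) (hom M N).
Proof.
have /choice[D hD] : forall h : hom M N, exists D : Der N, forall x, D x = h (d x).
  move=> h; have DP : (hom_lin h \o d) \in @der_pred k R N by apply/asboolP; exact: derivation_comp.
  by exists (MkDer DP).
have [|g hg] := @linear_map _ (hom M N) (Der N) D.
  by move=> a h h'; apply/val_inj/funext => x; rewrite /= hD -[RHS]/(a *: D h x + D h' x) !hD.
apply: (@lmod_iso_sym _ _ _ g).
  move=> h h' /(congr1 (fun D : Der N => der_val D)); rewrite !hg => e.
  have [h0 _ uniq] := ud.2 _ _ (derivation_comp (hom_lin h)).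
  apply/val_inj/funext => v; rewrite -[LHS]/(hom_lin h v) -[RHS]/(hom_lin h' v) !uniq // => x.
  by have := congr1 (fun f => f x) e; rewrite !hD.
move=> E; have [h hE _] := ud.2 _ _ (Der_linear E).
have [|h' hh'] := @linear_hom _ M N h; first by move=> a x y; rewrite linearP.
by exists h'; apply/val_inj/funext => x; rewrite /= hg hD hh' hE.
Qed.

Hypothesis loc : local_ring R.
Hypothesis char0 : forall n, n.+1%:R \is a @GRing.unit R.

(* The projection along a coefficient ring is a derivation onto m / K.       *)
Lemma universal_derivation_cotangent (f : R) (K : R -> Prop) : nonunit f -> ideal K ->
  (forall y z : R, nonunit y -> nonunit z -> K (y * z)) -> d f \in max_smul M -> K f.
Proof.
move=> uf hK Km df; have [K1|K1] := EM (K 1); first by rewrite -[f]mulr1; exact: idealM.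
have [S [[S1 SB SM] Sk _ SK] Sr] := coefficient_ring loc char0 hK K1 Km.
pose N : lmodType R := quotmod (submod_of (submodule_ideal hK)).
have piE x y : K (x - y) -> quot_pi (submod_of (submodule_ideal hK)) x = quot_pi (submod_of (submodule_ideal hK)) y.
  by move=> Kxy; apply/quot_pi_eq/mem_submod_of.
have [D hD] : exists D : R -> N, forall su : R * R, S su.1 /\ nonunit su.2 ->
    D (su.1 + su.2) = quot_pi (submod_of (submodule_ideal hK)) su.2.
  apply: factor_fun => -[s u] [t v] /= [Ss uu] [St uv] e; apply: piE.
  have -> : u - v = t - s.
    by apply/eqP; rewrite -subr_eq0; apply/eqP; transitivity (s + u - (t + v)); [ring|rewrite e subrr].
  apply: SK; first exact: SB.
  have -> : t - s = u - v by apply/eqP; rewrite -subr_eq0; apply/eqP; transitivity (t + v - (s + u)); [ring|rewrite e subrr].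
  exact: nonunitB.
have dec x : exists s u, [/\ S s, nonunit u & x = s + u].
  by have [s Ss us] := Sr x; exists s, (x - s); rewrite addrCA subrr addr0.
have S0 : S 0 by rewrite -(subrr 1); exact: SB.
have SD s t : S s -> S t -> S (s + t).
  by move=> Ss St; rewrite -[t]opprK; apply: (SB) => //; rewrite -sub0r; exact: SB.
have dD : derivation D.
  split=> [x y|x y|c].
  - have [s [u [Ss us ->]]] := dec x; have [t [v [St uv ->]]] := dec y.
    rewrite addrACA (hD (s + t, u + v)) /= ?(hD (s, u)) ?(hD (t, v)) //=; first by rewrite linearD.
    by split; [exact: SD|exact: loc].
  - have [s [u [Ss us ->]]] := dec x; have [t [v [St uv ->]]] := dec y.
    have -> : (s + u) * (t + v) = s * t + (s * v + t * u + u * v) by ring.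
    rewrite (hD (s * t, s * v + t * u + u * v)) ?(hD (s, u)) ?(hD (t, v)) //=; last first.
      by split; [exact: SM|do !apply: loc; apply: nonunitM].
    rewrite -!linearZ -linearD; apply: piE; rewrite !regular_scaleE.
    have -> : s * v + t * u + u * v - ((s + u) * v + (t + v) * u) = - v * u by ring.
    by rewrite mulNr -mulrN; apply: Km => //; rewrite -mulN1r; exact: nonunitM.
  - rewrite -[c%:A]addr0 (hD (c%:A, 0)) /= ?linear0 //.
    by split=> //; exact: nonunit0.
have [h hDh _] := ud.2 _ _ dD.
(* The map a h vanishes on every d x because m^2 lies in K, so it is 0 by uniqueness. *)
have hm a w : nonunit a -> h (a *: w) = 0.
  move=> ua; have zero : derivation (fun _ : R => 0 : N).
    by split=> *; rewrite ?scaler0 ?addr0.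
  have [h0 h0E uniq] := ud.2 _ _ zero.
  have e (g : {linear M -> N}) : (forall x, g (d x) = 0) -> g w = 0.
    move=> gd; rewrite (uniq g) => [|x]; last by rewrite gd.
    by rewrite -(uniq \0) // => x.
  have := e (a \*: h); rewrite linearZ /= => -> // x; rewrite /= -hDh.
  have [s [u [Ss us ->]]] := dec x; rewrite (hD (s, u)) //= -linearZ.
  rewrite -(linear0 (quot_pi _)); apply: piE; rewrite subr0 regular_scaleE; exact: Km.
have : h (d f) = 0.
  apply: (@span_ind R M _ (fun v => h v = 0) (d f) _ _ df); first by split=> [|a x y hx hy]; rewrite ?linear0 // linearP hx hy scaler0 addr0.
  by move=> _ [a [w [ua ->]]]; exact: hm.
rewrite -hDh -[f]add0r (hD (0, f)) //= -(linear0 (quot_pi _)) => /quot_pi_eq.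
by rewrite subr0 add0r => /(mem_submod_of (submodule_ideal hK)).
Qed.

End UniversalDerivation.

(** * Differentials of power series rings *)

Section KrullIntersection.
Variable R : comUnitRingType.
Hypothesis noeth : noetherian_ideals R.

Definition in_span (V : lmodType R) (v : nat -> V) (j : nat) (x : V) : Prop :=
  forall S, submodule S -> (forall i, (i < j)%N -> S (v i)) -> S x.

(** The ideals of first entries of the successive spans stabilize at some N; beyond it, first
    entries can be cleared by elements of the span of the first N terms, and n drops. *)
Lemma row_sequence n (v : nat -> 'rV[R]_n) : exists j, in_span v j (v j).
Proof.
elim: n v => [|n IH] v; first by exists 0%N => S [S0 _] _; rewrite [v 0%N]thinmx0.
pose J N (y : R) := exists2 u, in_span v N u & u 0 0 = y.
have [N|N y [u hu uy]|N hN] := @ideal_acc R noeth J.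
- split; first by exists 0; [move=> S []|rewrite mxE].
  move=> a _ _ [u hu <-] [t ht <-]; exists (a *: u + t); last by rewrite !mxE.
  by move=> S hS Sv; apply: hS.2; [exact: hu|exact: ht].
- by exists u => // S hS Sv; apply: hu => // i iN; apply: Sv; exact: ltnW.
have /choice[u hu] l : exists u, in_span v N u /\ u 0 0 = v (N + l)%N 0 0.
  have [|t ht tE] := hN (N + l).+1 (v (N + l)%N 0 0); last by exists t.
  by exists (v (N + l)%N) => // S _; apply.
pose w l : 'rV[R]_(1 + n) := v (N + l)%N - u l.
have wE l : w l = row_mx 0 (rsubmx (w l)).
  rewrite -[LHS]hsubmxK; congr row_mx; apply/rowP => i; rewrite !mxE.
  have -> : lshift n i = 0 :> 'I_(1 + n) by apply/val_inj; rewrite /= ord1.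
  by rewrite (hu l).2 subrr.
have [j hj] := IH (fun l => rsubmx (w l)); exists (N + j)%N => S hS Sv.
have Su l : S (u l) by apply: (hu l).1 => // i iN; apply: Sv; exact: ltn_addr.
rewrite -[v _](subrK (u j)) -[X in S (X + _)]/(w j) -[w j]scale1r; apply: hS.2 => //.
rewrite wE; apply: (hj (fun r => S (row_mx 0 r : 'rV[R]_(1 + n)))).
  split; first by rewrite row_mx0; case: hS.
  move=> a x y Sx Sy; have -> : row_mx 0 (a *: x + y) = a *: row_mx 0 x + row_mx 0 y :> 'rV[R]_(1 + n).
    by rewrite scale_row_mx add_row_mx scaler0 addr0.
  exact: hS.2.
move=> i ij; rewrite -wE /w addrC -scaleN1r; apply: hS.2 => //.
by apply: Sv; rewrite ltn_add2l.
Qed.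

Lemma fin_gen_sequence (M : lmodType R) (w : nat -> M) : fin_gen M -> exists j, in_span w j (w j).
Proof.
move=> [n [x hx]]; have /choice[c hc] := fun j => hx (w j).
have [j hj] := row_sequence (fun l => \row_i c l i).
have [|g hg] := @linear_map _ 'rV[R]_n M (fun r => \sum_i r 0 i *: x i).
  move=> a r t; rewrite scaler_sumr -big_split; apply: eq_bigr => i _ /=.
  by rewrite !mxE scalerDl scalerA.
have gw l : g (\row_i c l i) = w l.
  by rewrite hg hc; apply: eq_bigr => i _; rewrite mxE.
exists j => S hS Sw; rewrite -gw; apply: (hj (fun r => S (g r))) => [|i ij]; last by rewrite gw; exact: Sw.
by split=> [|a r t Sr St]; rewrite ?linear0 ?linearP; [case: hS|exact: hS.2].
Qed.

Hypothesis loc : local_ring R.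

(** Since v_j = a v_(j+1), all earlier terms are multiples of a v_j. When v_j lies in their span,
    v_j = r a v_j, which forces v_j = 0. *)
Lemma krull_intersection (M : lmodType R) (a : R) (w : M) : fin_gen M -> nonunit a ->
  (forall v : M, a *: v = 0 -> v = 0) -> (forall j, exists v, w = a ^+ j *: v) -> w = 0.
Proof.
move=> fgM ua rega /choice[v hv].
have vS j : v j = a *: v j.+1.
  have rj l (y : M) : a ^+ l *: y = 0 -> y = 0.
    by elim: l y => [|l IH] y; rewrite ?scale1r // exprS -scalerA => /rega/IH.
  apply/eqP; rewrite -subr_eq0; apply/eqP/(rj j).
  by rewrite scalerBr scalerA -exprSr -!hv subrr.
have [j hj] := fin_gen_sequence v fgM.
have [r vr] : exists r, v j = (r * a) *: v j.
  apply: (hj (fun y => exists r, y = (r * a) *: v j)).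
    split=> [|b _ _ [r ->] [t ->]]; first by exists 0; rewrite mul0r scale0r.
    by exists (b * r + t); rewrite scalerA -scalerDl mulrDl mulrA.
  move=> i; elim: j {hj} => // j IH; rewrite ltnS leq_eqVlt => /predU1P[->|/IH[r ->]].
    by exists 1; rewrite mul1r -vS.
  by exists (r * a); rewrite vS scalerA.
have u1 : 1 - r * a \is a GRing.unit.
  apply: contrapT => /negP nu; suff : nonunit (1 : R) by rewrite /nonunit unitr1.
  by rewrite -[1](subrK (r * a)); apply: loc => //; exact: nonunitM.
have v0 : v j = 0.
  by rewrite -[v j]scale1r -(mulVr u1) -scalerA scalerBl scale1r -vr subrr scaler0.
by rewrite (hv j) v0 scaler0.
Qed.

End KrullIntersection.

(** * Differentials of quotients of k[[x]] *)

Section PowerSeriesQuotient.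
Variables (k : fieldType) (R : comUnitAlgType k) (m : nat).
Variable pi : {lrmorphism powser k m -> R}.
Hypothesis surj : forall y, exists x, pi x = y.
Implicit Types F G : powser k m.

Lemma ps_invertible F : invertible F <-> F 0%MM != 0.
Proof.
split=> [[G FG]|/ps_unit//]; apply: contraTneq isT => F0.
have := congr1 (fun H : powser k m => H 0%MM) FG; rewrite psM0 F0 mul0r ps1 eqxx.
by move/esym/eqP; rewrite oner_eq0.
Qed.

Lemma ps_local F G : invertible (F + G) -> invertible F \/ invertible G.
Proof.
rewrite !ps_invertible psD => FG; have [F0|] := eqVneq (F 0%MM) 0; last by left.
by right; rewrite F0 add0r in FG.
Qed.

Lemma powser_quotient_local : local_ring R.
Proof. exact: local_surj surj ps_local. Qed.

Lemma ps_nonunit F : nonunit (pi F) <-> F 0%MM = 0.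
Proof.
split=> [/negP uF|F0].
  apply/eqP; apply: contrapT => /negP /ps_invertible h; apply: uF.
  exact/invertible_unit/(invertible_rmorph pi).
apply/negP => /(local_surj_unit surj ps_local)/ps_invertible.
by rewrite F0 eqxx.
Qed.

Local Notation x i := (pi (psX k U_(i))).
Local Notation grad F := (\row_i pi (ps_deriv i F)).

Lemma nonunit_var i : nonunit (x i).
Proof. by apply/ps_nonunit; rewrite /psX eq_sym mnm1_eq0. Qed.

Lemma ps_derivZ i (c : k) F : ps_deriv i (c *: F) = c *: ps_deriv i F.
Proof. by apply/funext => u; rewrite psZ /ps_deriv psZ mulrnAr. Qed.

Lemma ps_deriv1 i : ps_deriv i (1 : powser k m) = 0.
Proof.
apply: (addrI (ps_deriv i 1)); rewrite addr0 -{3}[1]mulr1 ps_derivM.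
by rewrite mulr1 mul1r.
Qed.

Lemma gradD F G : grad (F + G) = grad F + grad G :> 'rV[R]_m.
Proof. by apply/rowP => i; rewrite !mxE ps_derivD rmorphD. Qed.

Lemma gradB F G : grad (F - G) = grad F - grad G :> 'rV[R]_m.
Proof.
apply/rowP => i; rewrite !mxE -rmorphB; congr (pi _); apply/funext => u.
by rewrite psB /ps_deriv psB mulrnBl.
Qed.

Lemma gradM F G : grad (F * G) = pi F *: grad G + pi G *: grad F :> 'rV[R]_m.
Proof.
by apply/rowP => i; rewrite !mxE ps_derivM rmorphD !rmorphM /= addrC [pi (ps_deriv i F) * _]mulrC.
Qed.

Lemma grad_const (c : k) : grad (c *: (1 : powser k m)) = 0 :> 'rV[R]_m.
Proof. by apply/rowP => i; rewrite !mxE ps_derivZ ps_deriv1 scaler0 rmorph0. Qed.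

Lemma grad_var i : grad (psX k U_(i)) = delta_mx 0 i :> 'rV[R]_m.
Proof. by apply/rowP => j; rewrite !mxE ps_derivX rmorph_nat eqxx. Qed.

Lemma ps_order1 F : exists G : 'I_m -> powser k m,
  F = F 0%MM *: 1 + \sum_i psX k U_(i) * G i.
Proof.
have [p [G [FE p0]]] := ps_decompose 1 F; exists G; rewrite {1}FE; congr (_ + _).
have pE u : u != 0%MM -> p@_u = 0.
  move=> u0; apply/eqP; apply: contraNT u0 => /p0 h; apply/eqP/mnmP => i.
  by rewrite mnm0E; apply/eqP; rewrite -leqn0 -ltnS.
apply/funext => u; rewrite psZ ps1 /ps_of; have [->|/pE ->] := eqVneq u 0%MM; last by rewrite mulr0.
rewrite mulr1 FE psD ps_sum big1 ?addr0 // => i _.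
by rewrite psM0 expr1 /psX eq_sym mnm1_eq0 mul0r.
Qed.

(** Euler's formula modulo m^2: in F = sum of x_i G_i, the partial derivative by x_i differs from
    G_i by an element of m. *)
Lemma euler_mod (K : R -> Prop) F : ideal K ->
  (forall y z : R, nonunit y -> nonunit z -> K (y * z)) -> F 0%MM = 0 ->
  K (pi F - \sum_i (grad F : 'rV[R]_m) 0 i * x i).
Proof.
move=> hK Km F0; have [G FE] := ps_order1 F; rewrite F0 scale0r add0r in FE.
rewrite {1}FE rmorph_sum -sumrB; apply: (big_ind K); first by case: hK.
  by move=> a b; exact: idealD.
move=> i _; rewrite mxE rmorphM mulrC -mulrBl; apply: (Km _ _ _ (nonunit_var i)).
rewrite -rmorphB; apply/ps_nonunit; rewrite psB FE.
have -> : ps_deriv i (\sum_j psX k U_(j) * G j) = G i + \sum_j psX k U_(j) * ps_deriv i (G j).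
  transitivity (\sum_j ps_deriv i (psX k U_(j) * G j)).
    elim/big_rec2: _ => [|j y z _ <-]; last by rewrite ps_derivD.
    by apply/funext => u; rewrite /ps_deriv !ps0 mul0rn.
  under eq_bigr do rewrite ps_derivM ps_derivX; rewrite big_split; congr (_ + _).
  rewrite (bigD1 i) //= eqxx mul1r big1 ?addr0 // => j ji.
  by rewrite eq_sym (negPf ji) mul0r.
rewrite psD opprD addrA subrr add0r ps_sum big1 ?oppr0 // => j _.
by rewrite psM0 /psX eq_sym mnm1_eq0 mul0r.
Qed.

Section Differentials.
Variables (M : lmodType R) (g : {linear quotmod (jacobian pi) -> M}).
Hypothesis bij_g : bijective g.

Definition ps_class (v : 'rV[R]_m) : M := g (quot_pi (jacobian pi) v).

Lemma ps_class_linear : linear ps_class.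
Proof. by move=> a u v; rewrite /ps_class !linearP. Qed.
HB.instance Definition _ := GRing.isLinear.Build R _ _ _ ps_class ps_class_linear.

Lemma ps_class_onto w : exists v, ps_class v = w.
Proof.
have [g' gK g'K] := bij_g; exists (repr (g' w)).
by rewrite /ps_class quot_repr g'K.
Qed.

Lemma ps_class_jacobian v : ps_class v = 0 <-> v \in jacobian pi.
Proof.
rewrite /ps_class; split=> [h|vJ].
  suff : quot_pi (jacobian pi) v = 0.
    by rewrite -(linear0 (quot_pi (jacobian pi))) => /quot_pi_eq; rewrite subr0.
  by apply: (bij_inj bij_g); rewrite h linear0.
rewrite -(linear0 g); congr (g _); rewrite -(linear0 (quot_pi (jacobian pi))).
by apply/quot_pi_eq; rewrite subr0.
Qed.

Lemma grad_jacobian F : pi F = 0 -> ps_class (grad F) = 0.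
Proof. by move=> F0; apply/ps_class_jacobian/asboolP => S; apply; exists F. Qed.

Lemma ps_class_ext (N : lmodType R) (w : {linear 'rV[R]_m -> N}) :
  (forall F, pi F = 0 -> w (grad F) = 0) -> exists h : {linear M -> N}, forall v, h (ps_class v) = w v.
Proof.
move=> wJ; apply: (@lift_surjective _ _ _ _ ps_class w ps_class_onto).
move=> v /ps_class_jacobian vJ; apply: (@span_ind R _ _ (fun v => w v = 0) v _ _ vJ).
  by split=> [|a u t hu ht]; rewrite ?linear0 // linearP hu ht scaler0 addr0.
by move=> _ [F F0 ->]; exact: wJ.
Qed.

Lemma ps_differential : exists d : R -> M, forall F, d (pi F) = ps_class (grad F).
Proof.
have [|d hd] := @factor_fun _ _ M (fun=> True) pi (fun F => ps_class (grad F)).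
  move=> F G _ _ FG; apply/eqP; rewrite -subr_eq0 -linearB -gradB; apply/eqP.
  by apply: grad_jacobian; rewrite rmorphB /= FG subrr.
by exists d => F; exact: hd.
Qed.

Section Derivation.
Variable d : R -> M.
Hypothesis dE : forall F, d (pi F) = ps_class (grad F).

Lemma ps_differentialD r s : d (r + s) = d r + d s.
Proof.
have [F <-] := surj r; have [G <-] := surj s.
by rewrite -rmorphD !dE gradD linearD.
Qed.

Lemma ps_differentialM r s : d (r * s) = r *: d s + s *: d r.
Proof.
have [F <-] := surj r; have [G <-] := surj s.
by rewrite -rmorphM !dE gradM linearD !linearZ.
Qed.

(** By [euler_mod] the map dx_i -> x_i into R/K respects the Jacobian relations. The induced map on
    M sends d f to the class of f and kills mM. *)
Lemma ps_differential_cotangent (f : R) (K : R -> Prop) : nonunit f -> ideal K ->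
  (forall y z : R, nonunit y -> nonunit z -> K (y * z)) -> d f \in max_smul M -> K f.
Proof.
move=> uf hK Km df; pose S := submod_of (submodule_ideal hK).
have [|w hw] := @linear_map _ 'rV[R]_m (quotmod S) (fun v => quot_pi S (\sum_i v 0 i * x i)).
  move=> a u v; rewrite -linearZ -linearD; congr (quot_pi S _).
  rewrite regular_scaleE mulr_sumr -big_split; apply: eq_bigr => i _ /=.
  by rewrite !mxE mulrDl mulrA.
have pi0 r : quot_pi S r = 0 <-> K r.
  rewrite -(linear0 (quot_pi S)); split=> [/quot_pi_eq|Kr].
    by rewrite subr0 => /(mem_submod_of (submodule_ideal hK)).
  by apply/quot_pi_eq; rewrite subr0; apply/(mem_submod_of (submodule_ideal hK)).
have wE F : F 0%MM = 0 -> w (grad F) = quot_pi S (pi F).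
  move=> F0; rewrite hw; apply/esym/quot_pi_eq/(mem_submod_of (submodule_ideal hK)).
  exact: euler_mod.
have [F|h hh] := ps_class_ext (w := w).
  move=> F0; rewrite wE ?F0 ?linear0 //.
  by apply/ps_nonunit; rewrite F0; exact: nonunit0.
have [F fE] := surj f; have F0 : F 0%MM = 0 by apply/ps_nonunit; rewrite fE.
apply/pi0; rewrite -fE -wE // -hh -dE fE.
apply: (@span_ind R M _ (fun v => h v = 0) (d f) _ _ df).
  by split=> [|a u v hu hv]; rewrite ?linear0 // linearP hu hv scaler0 addr0.
move=> _ [a [u [ua ->]]]; have [v <-] := ps_class_onto u.
rewrite linearZ /= hh hw -linearZ; apply/pi0; rewrite regular_scaleE mulr_sumr.
apply: (big_ind K); [by case: (hK)|by move=> y z; exact: idealD|move=> i _].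
by rewrite mulrCA; apply: idealM => //; apply: Km => //; exact: nonunit_var.
Qed.

Section Universal.
Variable N : lmodType R.
Hypothesis separated : forall w : N,
  (forall t, exists v : 'I_m -> N, w = \sum_i x i ^+ t *: v i) -> w = 0.

(** The defect e of the chain rule is a derivation vanishing on polynomials. Writing F as a
    polynomial plus the sum of x_i^t G_i puts e F in the submodule generated by the x_i^t N, for
    every t. *)
Lemma ps_chain_rule (D : R -> N) F : derivation D ->
  D (pi F) = \sum_i (grad F : 'rV[R]_m) 0 i *: D (x i).
Proof.
move=> [DD DM Dk].
pose e F := D (pi F) - \sum_i (grad F : 'rV[R]_m) 0 i *: D (x i).
have eD G H : e (G + H) = e G + e H.
  rewrite /e rmorphD DD gradD addrACA -opprD -big_split; congr (_ - _).
  by apply: eq_bigr => i _; rewrite mxE scalerDl.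
have eM G H : e (G * H) = pi G *: e H + pi H *: e G.
  rewrite /e rmorphM DM gradM !scalerBr addrACA -opprD !scaler_sumr -big_split; congr (_ - _).
  by apply: eq_bigr => i _; rewrite !mxE scalerDl !scalerA.
have ek c : e (c *: 1) = 0.
  rewrite /e linearZ rmorph1 Dk grad_const big1 ?subr0 // => i _.
  by rewrite mxE scale0r.
have e0 : e 0 = 0 by rewrite -(scale0r 1) ek.
have e_sum (I : Type) (r : seq I) (H : I -> powser k m) : e (\sum_(i <- r) H i) = \sum_(i <- r) e (H i).
  by elim/big_rec2: _ => [|i y z _ <-].
have eZ c G : e (c *: G) = (c%:A : R) *: e G.
  have -> : c *: G = (c *: 1) * G by rewrite -scalerAl mul1r.
  by rewrite eM ek scaler0 addr0 linearZ rmorph1.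
have eX i : e (psX k U_(i)) = 0.
  rewrite /e grad_var (bigD1 i) //= mxE !eqxx scale1r big1 ?addr0 ?subrr // => j /negPf ji.
  by rewrite mxE eqxx ji scale0r.
have eXu u : e (psX k u) = 0.
  move: {2}(mdeg u) (erefl (mdeg u)) => t; elim: t u => [|t IH] u.
    move/eqP; rewrite mdeg_eq0 => /eqP ->.
    have -> : psX k 0%MM = 1 *: (1 : powser k m) by rewrite scale1r.
    exact: ek.
  move=> ut; have [i ui] : exists i, u i != 0%N.
    apply: contrapT => h; have u0 : u = 0%MM.
      by apply/mnmP => i; rewrite mnm0E; apply/eqP; apply: contrapT => /negP ui; apply: h; exists i.
    by rewrite u0 mdeg0 in ut.
  have le : (U_(i) <= u)%MM by rewrite lep1mP.
  rewrite -(submK le) addmC psXD eM eX scaler0 addr0 IH ?scaler0 //.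
  by apply/eqP; move: ut; rewrite -{1}(submK le) mdegD mdeg1 addn1 => -[->].
have eXt i t : e (psX k U_(i) ^+ t) = 0 by rewrite -psX_exp.
apply/eqP; rewrite -subr_eq0; apply/eqP; apply: separated => t.
have [p [G [FE _]]] := ps_decompose t F; exists (fun i => e (G i)).
rewrite -/(e F) {1}FE eD e_sum.
have -> : e (ps_of p) = 0.
  have -> : ps_of p = \sum_(u <- msupp p) p@_u *: psX k u.
    apply/funext => u; rewrite ps_sum /ps_of {1}[p]mpolyE raddf_sum; apply: eq_bigr => v _.
    by rewrite /= mcoeffZ psZ mcoeffX /psX eq_sym.
  by rewrite e_sum big1 // => u _; rewrite eZ eXu scaler0.
rewrite add0r; apply: eq_bigr => i _.
by rewrite eM eXt scaler0 addr0 rmorphXn.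
Qed.

Lemma ps_Der_iso : lmod_iso (Der N) (hom M N).
Proof.
have der (h : {linear M -> N}) : derivation (h \o d).
  split=> /= [r s|r s|c]; first by rewrite ps_differentialD linearD.
    by rewrite ps_differentialM linearD !linearZ.
  have -> : c%:A = pi (c *: 1) by rewrite linearZ rmorph1.
  by rewrite dE grad_const !linear0.
have /choice[D hD] : forall h : hom M N, exists D : Der N, forall r, D r = h (d r).
  move=> h; have DP : (hom_lin h \o d) \in @der_pred k R N by apply/asboolP; exact: der.
  by exists (MkDer DP).
have [|G hG] := @linear_map _ (hom M N) (Der N) D.
  by move=> a h h'; apply/val_inj/funext => r; rewrite /= hD -[RHS]/(a *: D h r + D h' r) !hD.
apply: (@lmod_iso_sym _ _ _ G).
  move=> h h' /(congr1 (fun D : Der N => der_val D)); rewrite !hG => e.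
  apply/val_inj/funext => v; have [u <-] := ps_class_onto v.
  rewrite -[LHS]/(hom_lin h _) -[RHS]/(hom_lin h' _) [u]row_sum_delta !linear_sum.
  apply: eq_bigr => i _; rewrite !linearZ /= -grad_var -dE.
  by have := congr1 (fun f => f (x i)) e; rewrite !hD /hom_lin => ->.
move=> E; have dE' := Der_linear E.
have [|w hw] := @linear_map _ 'rV[R]_m N (fun v => \sum_i v 0 i *: E (x i)).
  move=> a u v; rewrite scaler_sumr -big_split; apply: eq_bigr => i _ /=.
  by rewrite !mxE scalerDl scalerA.
have E0 : E 0 = 0.
  by case: dE' => ED _ _; apply: (addrI (E 0)); rewrite -ED !addr0.
have [F F0|h hh] := ps_class_ext (w := w).
  by rewrite hw -ps_chain_rule // F0.
have [|h' hh'] := @linear_hom _ M N h; first by move=> a u v; rewrite linearP.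
exists h'; apply/val_inj/funext => r; have [F <-] := surj r.
by rewrite /= hG hD hh' dE hh hw -ps_chain_rule.
Qed.

End Universal.
End Derivation.
End Differentials.
End PowerSeriesQuotient.

(** * Separatedness of the canonical module *)

Section CanonicalModule.
Variable R : comUnitRingType.
Hypothesis noeth : noetherian_ideals R.
Hypothesis loc : local_ring R.
Hypothesis dim1 : krull_dim R 1.
Variable omega : lmodType R.

(** Depth one provides some omega-regular b, and a power of b is a multiple of a. *)
Lemma depth1_regular (a : R) : nonunit a -> (forall x, a * x = 0 -> x = 0) -> depth omega 1 ->
  forall v : omega, a *: v = 0 -> v = 0.
Proof.
move=> ua rega [[[|b [|//]] // _ [ub [regb _]]] _] v av.
have [||n [c bn]] := nonunit_nilp noeth loc dim1 rega (ideal_principal a) (x := b).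
- by exists 1; rewrite mulr1.
- exact: ub (mem_head _ _).
have : b ^+ n *: v = 0 by rewrite bn mulrC -scalerA av scaler0.
elim: n v {av bn} => [|n IH] v; first by rewrite scale1r.
by rewrite exprS -scalerA => /regb/IH.
Qed.

(** A common power t puts every x_i^t in (a), so w is divisible by all powers of the omega-regular
    element a. *)
Lemma canonical_separated m (x : 'I_m -> R) : reduced_ring R -> canonical_module omega ->
  (forall i, nonunit (x i)) -> forall w : omega,
  (forall t, exists v : 'I_m -> omega, w = \sum_i x i ^+ t *: v i) -> w = 0.
Proof.
move=> red [n [dimn fg dep _ _]] ux w hw; rewrite (krull_dim_unique dimn dim1) in dep.
have [a ua rega] := exists_regular_nonunit noeth loc dim1 red.
have /choice[e he] i : exists t, exists b, x i ^+ t = a * b.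
  apply: (nonunit_nilp noeth loc dim1 rega (ideal_principal a)) => //.
  by exists 1; rewrite mulr1.
pose t := \max_i e i.
have /choice[b hb] i : exists b, x i ^+ t = a * b.
  have [b hb] := he i; exists (b * x i ^+ (t - e i)).
  by rewrite mulrA -hb -exprD subnKC // /t leq_bigmax.
apply: (krull_intersection noeth loc fg ua (depth1_regular ua rega dep)) => j.
have [v ->] := hw (t * j)%N; exists (\sum_i b i ^+ j *: v i).
by rewrite scaler_sumr; apply: eq_bigr => i _; rewrite exprM hb exprMn scalerA.
Qed.

End CanonicalModule.

Theorem corollary5p12 (k : fieldType) (chark : [pchar k] =i pred0)
    (R : comUnitAlgType k) (P : presentation R)
    (Omega : lmodType R) (hOmega : differential_module P Omega)
    (omega : lmodType R) (homega : canonical_module omega)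
    (F : min_presentation Omega)
    (hred : reduced_ring R) (hdim : krull_dim R 1)
    (htf : torsionfree Omega) :
  (is_zero_module (Ext 1 (transpose F) (Der omega)) /\
   is_zero_module (Ext 2 (transpose F) (Der omega))) \/
  (is_zero_module (Ext 1 Omega Omega) /\
   is_zero_module (Ext 2 (transpose F) (Der omega))) ->
  regular_local R.
Proof.
move=> vanish; have E2 : is_zero_module (Ext 2 (transpose F) (Der omega)).
  by case: vanish => -[].
have char0 := char0_unit R chark.
case: P hOmega => [m q L iota pi hq surj|m pi surj] /=.
  move=> [d ud]; have [[dD dM _] _] := ud.
  have noeth : noetherian_ideals R.
    exact: (noetherian_surj (h := pi) surj (localization_noetherian hq (@noetherian_mpoly k m))).
  have loc : local_ring R := local_surj (h := pi) surj (localization_local hq).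
  apply: (regular_of_cotangent (d := d) noeth loc hdim hred char0 homega htf dD dM _ _ E2).
    exact: universal_derivation_cotangent.
  exact: (universal_derivation_iso ud).
move=> [g bij_g]; have [d dE] := ps_differential bij_g.
have noeth : noetherian_ideals R := noetherian_surj (h := pi) surj (@noetherian_powser k m).
have loc := powser_quotient_local surj.
apply: (regular_of_cotangent (d := d) noeth loc hdim hred char0 homega htf _ _ _ _ E2).
- exact: (ps_differentialD surj dE).
- exact: (ps_differentialM surj dE).
- exact: (ps_differential_cotangent surj bij_g dE).
- apply: (ps_Der_iso surj bij_g dE) => w.
  by apply: (canonical_separated noeth loc hdim hred homega) => i; exact: nonunit_var.
Qed.
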